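(* Let $n\ge 1$, let $V:\mathbb{R}^{n+1}\to\mathbb{C}$ and $W:\mathbb{R}^{n+1}\to\mathbb{C}^n$ be measurable functions with $V\in L^\infty(\mathbb{R}^{n+1})$ and $|W|\in L^\infty(\mathbb{R}^{n+1})$, and let $c\in\mathbb{R}\setminus\{0\}$ and $(x_0,t_0)\in\mathbb{R}^n\times\mathbb{R}$. Suppose that $u\in H^1_t\cap H^2_x$ satisfies the differential inequality $$|i\partial_t u+\Delta u|\le |Vu|+|W\cdot\nabla u|$$ almost everywhere in $\mathbb{R}^{n+1}$, and that $u$ vanishes (almost everywhere) on the set $$\{(x,t)\in\mathbb{R}^{n+1}: c(t-t_0)+|x-x_0|^2>0\}.$$ Then $u$ is identically zero in $\mathbb{R}^{n+1}$ (as an element of $L^2(\mathbb{R}^{n+1})$).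
   Context: Points of $\mathbb{R}^{n+1}$ are written $(x,t)$ with $x\in\mathbb{R}^n$ (space) and $t\in\mathbb{R}$ (time). $\nabla$ and $\Delta$ denote the gradient and Laplacian in the space variable $x$ only. Functions are complex-valued. $W\cdot\nabla u=\sum_{j=1}^n W_j\,\partial_{x_j}u$. The functions $V$ and $W$ may depend on time or be independent of time. $H^1_t$ denotes the space of functions $u$ on $\mathbb{R}^{n+1}$ whose (weak) derivatives up to order $1$ with respect to $t$ belong to $L^2(\mathbb{R}^{n+1})$, i.e. $u,\partial_t u\in L^2(\mathbb{R}^{n+1})$; $H^2_x$ denotes the space of functions on $\mathbb{R}^{n+1}$ whose (weak) derivatives up to order $2$ with respect to the variables $x$ belong to $L^2(\mathbb{R}^{n+1})$. *)

(* Defs.v *)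
From HB Require Import structures.
From mathcomp Require Import all_boot all_order all_algebra.
From mathcomp Require Import complex.
From mathcomp Require Import all_classical all_reals all_analysis.
Set Implicit Arguments.
Unset Strict Implicit.
Unset Printing Implicit Defensive.
Import Order.TTheory GRing.Theory Num.Theory.
Import numFieldNormedType.Exports.
Import ComplexField.Normc.

Local Open Scope classical_set_scope.
Local Open Scope ring_scope.

(* The product sigma-algebra on R^n, as for n.-tuple in mathcomp-analysis; it
   is the Borel sigma-algebra. *)
Definition rV_display : measure_display. Proof. exact: default_measure_display. Qed.

Section measurable_rV.
Context (R : realType) (n : nat).

Let coord : 'I_n -> 'rV[R]_n -> measurableTypeR R :=
  fun i x => x ord0 i.

Let rV_set0 : g_sigma_preimage coord set0.
Proof. exact: sigma_algebra0. Qed.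

Let rV_setC A : g_sigma_preimage coord A -> g_sigma_preimage coord (~` A).
Proof. exact: sigma_algebraC. Qed.

Let rV_bigcup (F : (set 'rV[R]_n)^nat) :
  (forall i, g_sigma_preimage coord (F i)) ->
  g_sigma_preimage coord (\bigcup_i F i).
Proof. exact: sigma_algebra_bigcup. Qed.

HB.instance Definition _ := @isMeasurable.Build rV_display
  'rV[R]_n (g_sigma_preimage coord) rV_set0 rV_setC rV_bigcup.

Lemma measurable_coord (i : 'I_n) :
  measurable_fun [set: 'rV[R]_n]
    (fun x : 'rV[R]_n => x ord0 i : measurableTypeR R).
Proof.
move=> _ Y mY; rewrite setTI; apply: sub_sigma_algebra => /=.
rewrite -bigcup_seq/=; exists i => /=; first by rewrite mem_index_enum.
by exists Y => //; rewrite setTI.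
Qed.

End measurable_rV.

Lemma measurable_fun_rV (R : realType) d (T : measurableType d) n
    (f : T -> 'rV[R]_n) :
  (forall i, measurable_fun [set: T] (fun t => f t ord0 i : measurableTypeR R)) ->
  measurable_fun [set: T] f.
Proof.
pose coord (i : 'I_n) (x : 'rV[R]_n) : measurableTypeR R := x ord0 i.
move=> mf; suff H : g_sigma_preimage (fun i => coord i \o f) `<=` measurable.
  move=> _ A mA; rewrite setTI; apply: H.
  by rewrite g_sigma_preimage_comp; exists A => //; rewrite setTI.
apply: smallest_sub; first exact: sigma_algebra_measurable.
case: n => [|n] in f coord mf *; first by rewrite big_ord0.
rewrite -bigcup_mkord_ord; apply: bigcup_sub => i Ii.
by move=> A [B mB <-]; exact: mf.
Qed.

Section lebesgue_rV.
Variable R : realType.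

Definition rcons_rV n (p : 'rV[R]_n * measurableTypeR R) : 'rV[R]_n.+1 :=
  \row_(i < n.+1) if unlift ord_max i is Some j then p.1 ord0 j else p.2.

Lemma measurable_rcons_rV n :
  measurable_fun [set: 'rV[R]_n * measurableTypeR R] (@rcons_rV n).
Proof.
apply: measurable_fun_rV => i; rewrite /rcons_rV.
under eq_fun do rewrite mxE.
case: (unlift ord_max i) => [j|]; last exact: measurable_snd.
exact: measurableT_comp (@measurable_coord R n j) measurable_fst.
Qed.

(* Lebesgue measure on R^n, identifying R^n.+1 with R^n * R *)
Fixpoint lebesgue_rV n : {measure set 'rV[R]_n -> \bar R} :=
  if n is m.+1 then
    measure_function_pushforward__canonical__measure_function_Measure
      (lebesgue_rV m \x lebesgue_measure)%E (@measurable_rcons_rV m)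
  else \d_(0 : 'rV[R]_0).

Definition lebesgue_spacetime n : {measure set ('rV[R]_n * measurableTypeR R)%type -> \bar R} :=
  (lebesgue_rV n \x lebesgue_measure)%E.

Lemma measurable_box n (a b : 'I_n -> R) :
  measurable [set x : 'rV[R]_n | forall i, x ord0 i \in `[a i, b i]].
Proof.
rewrite (_ : mkset _ = \bigcap_(i in [set: 'I_n])
    ((fun x : 'rV[R]_n => x ord0 i : measurableTypeR R) @^-1`
      `[a i, b i]%classic)); last first.
  by apply/seteqP; split => x /= H i; [move=> _; exact: H|exact: H i I].
apply: fin_bigcap_measurable => // i _; rewrite -[X in measurable X]setTI.
by apply: measurable_coord => //; exact: measurable_itv.
Qed.

Lemma lebesgue_rV_box n (a b : 'I_n -> R) : (forall i, a i <= b i) ->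
  lebesgue_rV n [set x | forall i, x ord0 i \in `[a i, b i]] =
  (\prod_(i < n) (b i - a i))%:E.
Proof.
elim: n => [|n IH] in a b *.
  move=> _; rewrite big_ord0 /= diracE mem_set//.
  by move=> [].
move=> ab; rewrite big_ord_recr /= /pushforward.
rewrite [X in product_measure1 _ _ X](_ : _ =
  [set x : 'rV[R]_n | forall i, x ord0 i \in
    `[a (widen_ord (leqnSn n) i), b (widen_ord (leqnSn n) i)]] `*`
  `[a ord_max, b ord_max]%classic); last first.
  have liftE (i : 'I_n) : lift ord_max i = widen_ord (leqnSn n) i.
    by apply: val_inj; rewrite /= /bump leqNgt ltn_ord.
  apply/seteqP; split => [[x t] /= H|[x t] /= [Hx Ht] i].
    split=> [i|].
      by have := H (lift ord_max i); rewrite /rcons_rV mxE liftK /= liftE.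
    by have := H ord_max; rewrite /rcons_rV mxE unlift_none.
  rewrite /rcons_rV mxE; case: unliftP => [j ->|-> //].
  by rewrite liftE; exact: Hx.
rewrite product_measure1E//; last exact: measurable_box.
rewrite IH//= lebesgue_measure_itv /= lte_fin.
by case: ltgtP (ab ord_max) => // -> _; rewrite subrr mulr0 mule0.
Qed.
End lebesgue_rV.

Definition sqnorm (R : realType) n (x : 'rV[R]_n) : R :=
  \sum_(j < n) x ord0 j ^+ 2.

(* The norm that the library puts on matrices is the sup norm. *)
Definition euclidean_norm (R : realType) n (w : 'rV[R[i]]_n) : R :=
  Num.sqrt (\sum_(j < n) normc (w ord0 j) ^+ 2).

Section spacetime_functions.
Variables (R : realType) (n : nat).
Local Notation E := ('rV[R]_n * R)%type.
Local Notation mE := ('rV[R]_n * measurableTypeR R)%type.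
Local Notation mu := (lebesgue_spacetime R n).
Implicit Types (u g V : E -> R[i]) (W : E -> 'rV[R[i]]_n).
Implicit Types (phi : E -> R) (vs : seq E).

(* measurable_fun on mE is Borel measurability; Lebesgue measurability is
   agreement almost everywhere with a Borel function. The integral below is
   still the right one for such functions, because it is defined through the
   supremum over the simple functions below the integrand. *)
Definition lebesgue_measurable u :=
  exists g, [/\ measurable_fun [set: mE] (fun p => complex.Re (g p)),
                measurable_fun [set: mE] (fun p => complex.Im (g p)) &
                {ae mu, forall p, u p = g p}].

Definition inL2 u :=
  lebesgue_measurable u /\ finite_norm mu 2%:E (fun p => normc (u p)).

Definition inLoo V :=
  lebesgue_measurable V /\ finite_norm mu +oo%E (fun p => normc (V p)).

Definition inLoo_vector W :=
  (forall j, lebesgue_measurable (fun p => W p ord0 j)) /\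
  finite_norm mu +oo%E (fun p => euclidean_norm (W p)).

Definition cintegral u : R[i] :=
  Complex (\int[mu]_p complex.Re (u p)) (\int[mu]_p complex.Im (u p)).

Definition iter_derive phi vs : E -> R := foldr (fun v f => 'D_v f) phi vs.

(* C_c^oo: iterated derivatives along all directions exist and are
   differentiable, hence continuous. *)
Definition test_function phi :=
  (forall vs p, differentiable (iter_derive phi vs) p) /\
  compact (closure [set p | phi p != 0]).

Definition is_weak_derivative vs u g :=
  forall phi, test_function phi ->
    cintegral (fun p => u p * (iter_derive phi vs p)%:C%C) =
    (-1) ^+ size vs * cintegral (fun p => g p * (phi p)%:C%C).

Definition has_weak_derivative_in_L2 vs u :=
  exists g, inL2 g /\ is_weak_derivative vs u g.

(* A representative of the weak derivative, which is unique almost everywhere;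
   meaningful only under has_weak_derivative_in_L2 vs u. *)
Definition weak_derivative vs u : E -> R[i] :=
  xget (cst 0) [set g | inL2 g /\ is_weak_derivative vs u g].

Definition xdir (j : 'I_n) : E := (delta_mx ord0 j, 0).
Definition tdir : E := (0, 1).

Definition H1t u := inL2 u /\ has_weak_derivative_in_L2 [:: tdir] u.

Definition H2x u := inL2 u /\
  forall js : seq 'I_n, (size js <= 2)%N ->
    has_weak_derivative_in_L2 (map xdir js) u.

Definition time_derivative u : E -> R[i] := weak_derivative [:: tdir] u.

Definition gradient u (p : E) : 'rV[R[i]]_n :=
  \row_j weak_derivative [:: xdir j] u p.

Definition laplacian u (p : E) : R[i] :=
  \sum_(j < n) weak_derivative [:: xdir j; xdir j] u p.

End spacetime_functions.

(* Main.v *)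
From HB Require Import structures.
Require Import Defs.
From mathcomp Require Import all_boot all_order all_algebra.
From mathcomp Require Import complex.
From mathcomp Require Import all_classical all_reals all_analysis.
From mathcomp Require Import measurable_realfun ess_sup_inf.
From mathcomp Require Import ring lra.
Import Order.TTheory GRing.Theory Num.Theory.
Import numFieldNormedType.Exports.
Import ComplexField.Normc.
Set Implicit Arguments.
Unset Strict Implicit.
Unset Printing Implicit Defensive.

Local Open Scope classical_set_scope.
Local Open Scope ring_scope.

(** Let phi = c (t - t0) + |y|^2 with y = x - x0, so that u lives on phi <= 0.
    The proof weighs u by exp (b phi), which is at most 1 on the support of u for
    every b > 0, and lets a cutoff in time grow. As the weight is bounded where u
    is not zero, square integrability of u controls the errors at infinity.

    The core is a Carleman inequality ([carleman]). Conjugated by the weight, the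
    operator i d_t + Lap becomes S + A, where S = i d_t + Lap + 4 b^2 |y|^2 is
    symmetric and A = - 4 b y . grad - 2 b n - i b c is skew. The square of
    the norm of (S + A) f is at least 4 Re <S f, A f>, which comes from the
    commutator of S and A. As phi is convex in x and linear in t, the commutator
    is positive: Re <S f, A f> equals 4 b |grad f|^2 + 16 b^3 |y f|^2. This
    controls f itself through the uncertainty principle n b |f|^2 <= b^2 |y f|^2 + |grad f|^2 ([uncertainty]).

    Apply this to f = exp (b phi) chi(t / T) eta(x) u. On the support of chi the
    condition phi <= 0 bounds y, so eta can be chosen to equal 1 near the support
    of u and produces no error. The differential inequality bounds the weighted
    operator by f, grad f and y f, with a constant M that depends on n, V and W;
    for b = 1 + M these terms are absorbed by the left-hand side. What remains is
    |f|^2 <= C T^-2 |u|^2, from the derivative of chi ([carleman_localized]).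
    When T grows this forces u = 0 ([system_unique_continuation]).

    Everything is done with the real and imaginary parts of u, which satisfy a
    coupled real system. As u has only the weak derivatives u_t, u_j and u_jk,
    the commutator is computed without ever differentiating further:
    <F_v, G_w> = <F_w, G_v> holds for first weak derivatives alone
    ([wder_exchange]). This and integration by parts are obtained by
    mollification, in the form of a pairing of F and G through a kernel
    concentrated near the diagonal. Such pairings converge to <F, G> because the
    energy, the double integral of k(p, q) (F p - F q)^2, tends to 0 for square
    integrable F of bounded support ([vanishing_energy_sqint]). This is proved
    for indicators by a monotone class argument, which starts from intervals and
    passes to products. *)

(** * Approximate identities on a measure space *)

Section Vanishing.
Context {R : realType}.
Local Open Scope ereal_scope.

Definition vanishing (u : nat -> \bar R) :=
  forall e : R, (0 < e)%R -> \forall m \near \oo, u m <= e%:E.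

Lemma vanishing_le (u v : nat -> \bar R) :
  (forall m, u m <= v m) -> vanishing v -> vanishing u.
Proof.
by move=> uv v0 e e0; apply: filterS (v0 e e0) => m; apply: le_trans.
Qed.

Lemma vanishingD (u v : nat -> \bar R) :
  vanishing u -> vanishing v -> vanishing (fun m => u m + v m).
Proof.
move=> u0 v0 e e0; have e2 : (0 < e / 2)%R by rewrite divr_gt0.
apply: filterS2 (u0 _ e2) (v0 _ e2) => m um vm.
by rewrite [e]splitr EFinD leeD.
Qed.

Lemma vanishingZ (u : nat -> \bar R) (c : R) : (0 <= c)%R ->
  vanishing u -> vanishing (fun m => c%:E * u m).
Proof.
move=> c0 u0 e e0; have e2 : (0 < e / (c + 1))%R by rewrite divr_gt0 ?ltr_wpDl.
apply: filterS (u0 _ e2) => m um.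
apply: (@le_trans _ _ (c%:E * (e / (c + 1))%:E)); first exact: lee_wpmul2l.
rewrite -EFinM lee_fin mulrCA ger_pMr// ler_pdivrMr ?ltr_wpDl//.
by rewrite mul1r lerDl.
Qed.

Lemma vanishing0 : vanishing (fun=> 0).
Proof. by move=> e e0; near=> m; rewrite lee_fin ltW. Unshelve. all: end_near. Qed.

Lemma vanishing_approx (u : nat -> \bar R) :
  (forall e : R, (0 < e)%R ->
    exists2 v, vanishing v & forall m, u m <= v m + e%:E) -> vanishing u.
Proof.
move=> H e e0; have e2 : (0 < e / 2)%R by rewrite divr_gt0.
have [v v0 uv] := H _ e2; apply: filterS (v0 _ e2) => m vm.
by rewrite (le_trans (uv m))// [in leRHS](splitr e) EFinD leeD2r.
Qed.

Lemma cvg0_vanishing (u : nat -> \bar R) : u @ \oo --> 0 -> vanishing u.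
Proof.
move=> /fine_cvgP[fu /cvgrPdist_le u0] e e0.
apply: filterS2 fu (u0 _ e0) => m fm.
by rewrite sub0r normrN -[X in X <= _](fineK fm) lee_fin; exact/le_trans/ler_norm.
Qed.

End Vanishing.

Section Energy.
Context d (T : measurableType d) (R : realType).
Variable mu : {sigma_finite_measure set T -> \bar R}.
Implicit Types (k : T * T -> R) (F G : T -> R).
Local Open Scope ereal_scope.

(** Continuity of [F] in mean at the scale of the kernel [k]. With it no translate
    of a square integrable function has to be studied. *)
Definition energy k F : \bar R :=
  \int[mu \x mu]_z (k z * (F z.1 - F z.2) ^+ 2)%:E.

Definition bistochastic k :=
  [/\ measurable_fun [set: T * T] k, (forall z, (0 <= k z)%R),
      (forall x, \int[mu]_y (k (x, y))%:E = 1) &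
      (forall y, \int[mu]_x (k (x, y))%:E = 1)].

Lemma measurable_energy_integrand k F : bistochastic k -> measurable_fun [set: T] F ->
  measurable_fun [set: T * T] (fun z => (k z * (F z.1 - F z.2) ^+ 2)%:E).
Proof.
case=> mk _ _ _ mF; apply/measurable_EFinP; apply: measurable_funM => //.
apply: measurable_funX; apply: measurable_funB.
  exact: measurableT_comp mF measurable_fst.
exact: measurableT_comp mF measurable_snd.
Qed.

Lemma energyD k F G : bistochastic k ->
  measurable_fun [set: T] F -> measurable_fun [set: T] G ->
  energy k (F \+ G)%R <= 2%:E * energy k F + 2%:E * energy k G.
Proof.
move=> bk mF mG; have [mk k0 _ _] := bk.
have i0 (H : T -> R) z : 0 <= (k z * (H z.1 - H z.2) ^+ 2)%:E.
  by rewrite lee_fin mulr_ge0// sqr_ge0.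
have mZ (H : T -> R) : measurable_fun [set: T] H -> measurable_fun [set: T * T]
    (fun z => 2%:E * (k z * (H z.1 - H z.2) ^+ 2)%:E).
  by move=> mH; apply: measurable_funeM; exact: measurable_energy_integrand.
rewrite /energy -!ge0_integralZl_EFin//; try exact: measurable_energy_integrand.
rewrite -ge0_integralD//; try by move=> z _; rewrite mule_ge0// ?lee_fin.
- apply: ge0_le_integral => //.
  + by apply: measurable_energy_integrand => //; exact: measurable_funD.
  + by apply: emeasurable_funD; exact: mZ.
  + move=> z _; rewrite -!EFinM -EFinD lee_fin.
    rewrite ![(2 * (k z * _))%R]mulrCA -mulrDr ler_wpM2l//=.
    rewrite -subr_ge0.
    rewrite (_ : (_ - _)%R = ((F z.1 - F z.2) - (G z.1 - G z.2)) ^+ 2)%R.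
      exact: sqr_ge0.
    by ring.
- exact: mZ.
- exact: mZ.
Qed.

(** From (s - t)^2 <= 2 s^2 + 2 t^2, each of the two marginals of [k] integrating
    one of the squares. *)
Lemma energy_le k F : bistochastic k -> measurable_fun [set: T] F ->
  energy k F <= 4%:E * \int[mu]_x (F x ^+ 2)%:E.
Proof.
move=> bk mF; have [mk k0 k1 k2] := bk.
have mF2 : measurable_fun [set: T] (fun x => (F x ^+ 2)%:E).
  by apply/measurable_EFinP; exact: measurable_funX.
have mkF (p : T * T -> T) : measurable_fun [set: T * T] p ->
    measurable_fun [set: T * T] (fun z => (k z * F (p z) ^+ 2)%:E).
  move=> mp; apply/measurable_EFinP; apply: measurable_funM => //.
  by apply: measurable_funX; exact: measurableT_comp.
have kF0 (p : T * T -> T) z : 0 <= (k z * F (p z) ^+ 2)%:E.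
  by rewrite lee_fin mulr_ge0// sqr_ge0.
have e1 : \int[mu \x mu]_z (k z * F z.1 ^+ 2)%:E = \int[mu]_x (F x ^+ 2)%:E.
  rewrite fubini_tonelli1//; last exact: mkF.
  apply: eq_integral => x _; rewrite /fubini_F /=.
  under eq_integral do rewrite mulrC EFinM.
  rewrite ge0_integralZl_EFin// ?sqr_ge0 ?k1 ?mule1//.
    by move=> y _; rewrite lee_fin.
  by apply/measurable_EFinP; exact: measurableT_comp mk _.
have e2 : \int[mu \x mu]_z (k z * F z.2 ^+ 2)%:E = \int[mu]_x (F x ^+ 2)%:E.
  rewrite fubini_tonelli2//; last exact: mkF.
  apply: eq_integral => x _; rewrite /fubini_G /=.
  under eq_integral do rewrite mulrC EFinM.
  rewrite ge0_integralZl_EFin// ?sqr_ge0 ?k2 ?mule1//.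
    by move=> y _; rewrite lee_fin.
  by apply/measurable_EFinP; exact: measurableT_comp mk _.
have -> : 4%:E * \int[mu]_x (F x ^+ 2)%:E =
    \int[mu \x mu]_z (2%:E * ((k z * F z.1 ^+ 2)%:E + (k z * F z.2 ^+ 2)%:E)).
  rewrite ge0_integralZl_EFin//; last 2 first.
    by move=> z _; rewrite adde_ge0.
    by apply: emeasurable_funD; exact: mkF.
  rewrite ge0_integralD//; [|exact: mkF|exact: mkF].
  rewrite e1 e2 (_ : 4%R = (2 * 2)%R); last by ring.
  rewrite EFinM -muleA; congr (_ * _).
  by rewrite mule_natl mule2n.
apply: ge0_le_integral => //.
- by move=> z _; rewrite lee_fin mulr_ge0// sqr_ge0.
- exact: measurable_energy_integrand.
- by apply: measurable_funeM; apply: emeasurable_funD; exact: mkF.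
- move=> z _; rewrite -EFinD -EFinM lee_fin -mulrDr [leRHS]mulrCA ler_wpM2l//.
  rewrite -subr_ge0 (_ : (_ - _)%R = (F z.1 + F z.2) ^+ 2)%R ?sqr_ge0//.
  by ring.
Qed.

(** With [energyD] and [energy_le] this makes the functions with vanishing energy
    a closed subspace of L2. *)
Lemma vanishing_energy_approx (k : nat -> T * T -> R) F :
  (forall m, bistochastic (k m)) -> measurable_fun [set: T] F ->
  (forall e : R, (0 < e)%R -> exists G, [/\ measurable_fun [set: T] G,
    vanishing (fun m => energy (k m) G) &
    \int[mu]_x ((F x - G x) ^+ 2)%:E <= e%:E]) ->
  vanishing (fun m => energy (k m) F).
Proof.
move=> bk mF H; apply: vanishing_approx => e e0.
have e8 : (0 < e / 8)%R by rewrite divr_gt0.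
have [G [mG vG FG]] := H _ e8.
exists (fun m => 2%:E * energy (k m) G); first exact: vanishingZ.
move=> m; have mFG : measurable_fun [set: T] (F \- G)%R.
  exact: measurable_funB.
rewrite {1}(_ : F = (G \+ (F \- G))%R); last first.
  by apply/funext => x /=; rewrite addrC subrK.
apply: (le_trans (energyD _ mG mFG)) => //; apply: leeD2l.
apply: (@le_trans _ _ (2%:E * (4%:E * (e / 8)%:E))); last first.
  by rewrite -!EFinM lee_fin; lra.
rewrite lee_wpmul2l// (le_trans (energy_le (bk m) mFG))//.
by rewrite lee_wpmul2l.
Qed.

(** The window [Q] has finite measure, so that the indicators of its subsets are
    square integrable. *)
Definition resolves (k : nat -> T * T -> R) (Q : set T) :=
  [/\ (forall m, bistochastic (k m)), measurable Q, mu Q < +oo &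
    forall A, measurable A ->
      vanishing (fun m => energy (k m) \1_(A `&` Q))].

(** The pi-lambda theorem: the sets whose indicators have vanishing energy form a
    Dynkin system, since countable disjoint unions are approximated in L2 by
    finite ones. *)
Lemma resolves_g_sigma_algebra (k : nat -> T * T -> R) Q (G : set (set T)) :
  (forall m, bistochastic (k m)) -> measurable Q -> mu Q < +oo ->
  @measurable d T = <<s G >> -> setI_closed G ->
  vanishing (fun m => energy (k m) \1_Q) ->
  (forall A, G A -> vanishing (fun m => energy (k m) \1_(A `&` Q))) ->
  resolves k Q.
Proof.
move=> bk mQ Qoo mG GI vQ vG; split => // A.
pose D := [set A : set T | measurable A /\
  vanishing (fun m => energy (k m) \1_(A `&` Q))].
suff : <<s G >> `<=` D by rewrite -mG => GD /GD[].
rewrite -setI_closed_g_dynkin_g_sigma_algebra//; apply: smallest_sub; last first.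
  by move=> B GB; split; [rewrite mG; exact: sub_sigma_algebra|exact: vG].
have mI B : measurable B -> measurable_fun [set: T] (\1_(B `&` Q) : T -> R).
  by move=> mB; apply: measurable_indic; exact: measurableI.
have DU (B C : set T) : B `&` C = set0 -> D B -> D C -> D (B `|` C).
  move=> BC [mB vB] [mC vC]; split; first exact: measurableU.
  rewrite (_ : \1_((B `|` C) `&` Q) =
      (\1_(B `&` Q) \+ \1_(C `&` Q))%R :> (T -> R)); last first.
    apply/funext => x /=; rewrite !indicE !in_setI in_setU.
    have : (x \in B `&` C) = false by rewrite BC in_set0.
    rewrite in_setI; case: (x \in B); case: (x \in C); case: (x \in Q) => //= _;
      by rewrite ?addr0 ?add0r.
  apply: vanishing_le
    (vanishingD (vanishingZ (ler0n _ 2) vB) (vanishingZ (ler0n _ 2) vC)).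
  by move=> m; exact: energyD (mI _ mB) (mI _ mC).
split.
- by split; rewrite ?setTI.
- move=> B [mB vB]; split; first exact: measurableC.
  rewrite (_ : \1_((~` B) `&` Q) =
      (\1_Q \+ (-1 \o* \1_(B `&` Q)))%R :> (T -> R)); last first.
    apply/funext => x /=; rewrite !indicE !in_setI in_setC.
    by case: (x \in B); case: (x \in Q) => /=; lra.
  have mN : measurable_fun [set: T] (-1 \o* \1_(B `&` Q) : T -> R)%R.
    by apply: measurable_funM => //; exact: mI.
  apply: vanishing_le
    (vanishingD (vanishingZ (ler0n _ 2) vQ) (vanishingZ (ler0n _ 2) vB)).
  move=> m; apply: (le_trans (energyD _ _ mN)) => //.
  rewrite le_eqVlt; apply/orP; left; apply/eqP; congr (_ + _ * _).
  by apply: eq_integral => z _ /=; congr EFin; ring.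
- move=> F tF DF; have mF n : measurable (F n) by case: (DF n).
  have mFk n : measurable (\bigcup_(i >= n) F i) by exact: bigcup_measurable.
  have mU : measurable (\bigcup_k F k) by exact: bigcup_measurable.
  split => //.
  apply: vanishing_energy_approx => //; first exact: mI.
  move=> e e0.
  have : mu ((\bigcup_(i >= n) F i) `&` Q) @[n --> \oo] --> 0.
    have F0 : \bigcap_n ((\bigcup_(i >= n) F i) `&` Q) = set0.
      apply/seteqP; split => // x Fx.
      have [[i _ Fix] _] := Fx 0%N I.
      have [[j /= ij Fjx] _] := Fx i.+1 I.
      have := (@trivIsetP _ _ _ _).1 tF i j I I.
      rewrite ltn_eqF// => /(_ isT) Fij.
      by suff : (F i `&` F j) x by rewrite Fij.
    rewrite -[X in _ --> X](measure0 mu) -F0.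
    apply: nonincreasing_cvg_mu => //.
    - apply: le_lt_trans Qoo; apply: le_measure; rewrite ?inE//.
      exact: measurableI.
    - by move=> n; exact: measurableI.
    - by rewrite F0.
    - move=> n p np; apply/subsetPset => x [[i /= pi Fix] Qx]; split => //.
      by exists i => //=; exact: leq_trans pi.
  move=> /cvg0_vanishing /(_ _ e0) [n _ /(_ n (leqnn n)) /= ne].
  exists \1_((\big[setU/set0]_(i < n) F i) `&` Q); split.
  + apply: mI; exact: bigsetU_measurable.
  + suff : D (\big[setU/set0]_(i < n) F i) by case.
    elim: n {ne} => [|n IH].
      rewrite big_ord0; split => //; rewrite set0I.
      apply: vanishing_le vanishing0 => m; rewrite /energy integral0_eq// => z _.
      by rewrite !indicE !in_set0 subrr expr0n mulr0.
    rewrite big_ord_recr /=; apply: DU => //.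
    by apply: (@trivIset_bigsetUI _ predT) => //; apply: sub_trivIset tF.
  + apply: le_trans ne.
    rewrite -[X in mu X]setIT -integral_indic//; last exact: measurableI.
    apply: ge0_le_integral => //.
    * by move=> x _; rewrite lee_fin sqr_ge0.
    * apply/measurable_EFinP; apply: measurable_funX; apply: measurable_funB; apply: mI => //.
      exact: bigsetU_measurable.
    * by apply/measurable_EFinP; exact: mI.
    * move=> x _; rewrite lee_fin !indicE !in_setI.
      have PU : x \in \big[setU/set0]_(i < n) F i -> x \in \bigcup_k F k.
        by rewrite !inE; exact: bigsetU_bigcup.
      have UPT : x \in \bigcup_k F k -> (x \in \big[setU/set0]_(i < n) F i) ||
          (x \in \bigcup_(i >= n) F i).
        rewrite inE => -[i _ Fix]; have [ni|ni] := leqP n i.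
          by apply/orP; right; rewrite inE; exists i.
        by apply/orP; left; rewrite inE -bigcup_mkord; exists i.
      move: PU UPT.
      case: (x \in \bigcup_k F k); case: (x \in \big[setU/set0]_(i < n) F i);
        case: (x \in \bigcup_(i >= n) F i); case: (x \in Q) => //= PU UPT;
        rewrite ?subrr ?subr0 ?expr1n ?expr0n//=;
        by [have := PU isT | have := UPT isT].
Qed.

End Energy.

Section EnergyL2.
Import HBNNSimple.
Context d (T : measurableType d) (R : realType).
Variable mu : {sigma_finite_measure set T -> \bar R}.
Implicit Types (F G : T -> R).
Local Open Scope ereal_scope.

Lemma vanishing_energyD (k : nat -> T * T -> R) F G :
  (forall m, bistochastic mu (k m)) ->
  measurable_fun [set: T] F -> measurable_fun [set: T] G ->
  vanishing (fun m => energy mu (k m) F) ->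
  vanishing (fun m => energy mu (k m) G) ->
  vanishing (fun m => energy mu (k m) (F \+ G)%R).
Proof.
move=> bk mF mG vF vG.
apply: vanishing_le
  (vanishingD (vanishingZ (ler0n _ 2) vF) (vanishingZ (ler0n _ 2) vG)).
by move=> m; exact: energyD.
Qed.

Lemma vanishing_energyZ (k : nat -> T * T -> R) (c : R) F :
  (forall m, bistochastic mu (k m)) -> measurable_fun [set: T] F ->
  vanishing (fun m => energy mu (k m) F) ->
  vanishing (fun m => energy mu (k m) (c \*o F)%R).
Proof.
move=> bk mF vF.
apply: vanishing_le (vanishingZ (sqr_ge0 c) vF) => m.
have [mk k0 _ _] := bk m.
rewrite /energy -ge0_integralZl_EFin ?sqr_ge0//; last 2 first.
- by move=> z _; rewrite lee_fin mulr_ge0// sqr_ge0.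
- exact: measurable_energy_integrand.
rewrite le_eqVlt; apply/orP; left; apply/eqP; apply: eq_integral => z _ /=.
by rewrite -EFinM; congr EFin; ring.
Qed.

Lemma vanishing_energy_nnsfun k Q (g : {nnsfun T >-> R}) :
  resolves mu k Q -> (forall x, ~ Q x -> g x = 0%R) ->
  vanishing (fun m => energy mu (k m) g).
Proof.
move=> [bk mQ _ vk] gQ.
have gE : g = (fun x => \sum_(y <- finmap.enum_fset (fset_set (range g)))
    y * \1_(g @^-1` [set y] `&` Q) x)%R :> (T -> R).
  apply/funext => x; have [Qx|nQx] := pselect (Q x).
    rewrite {1}(fimfunE g) fsbig_finite//=; apply: eq_bigr => y _.
    by rewrite !indicE in_setI (mem_set Qx) andbT.
  rewrite gQ// big1// => y _.
  by rewrite indicE in_setI (memNset nQx) andbF mulr0.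
rewrite gE.
elim: (finmap.enum_fset _) => [|y s IH].
  apply: vanishing_le vanishing0 => m; rewrite /energy integral0_eq// => z _.
  by rewrite !big_nil subrr expr0n mulr0.
under [X in vanishing (fun m => energy _ _ X)]eq_fun do rewrite big_cons.
have mI z : measurable (g @^-1` [set z] `&` Q) by exact: measurableI.
apply: vanishing_energyD => //.
- by apply: measurable_funM.
- by apply: measurable_sum => z; exact: measurable_funM.
- by apply: vanishing_energyZ => //; exact: vk.
Qed.

(** Simple functions increase to [F], and by dominated convergence they do so in L2. *)
Lemma vanishing_energy_ge0 k Q F :
  resolves mu k Q -> measurable_fun [set: T] F -> (forall x, (0 <= F x)%R) ->
  (forall x, ~ Q x -> F x = 0%R) -> \int[mu]_x (F x ^+ 2)%:E < +oo ->
  vanishing (fun m => energy mu (k m) F).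
Proof.
move=> rk mF F0 FQ iF; have [bk mQ _ vk] := rk.
have mEF : measurable_fun [set: T] (EFin \o F) by exact/measurable_EFinP.
pose g := nnsfun_approx measurableT mEF.
have gF n x : (g n x <= F x)%R.
  by rewrite -lee_fin; rewrite nnsfun_approxE; apply: le_approx => // y _; rewrite lee_fin.
have g0 n x : (0 <= g n x)%R by [].
have gcvg x : (fun n => (F x - g n x)^+2)%R @ \oo --> (0 : R)%R.
  have : (fun n => g n x) @ \oo --> F x.
    apply: (@fine_cvg _ _ _ _ (fun n => (g n x)%:E) (F x)).
    exact: (cvg_nnsfun_approx measurableT mEF (fun y _ => F0 y)).
  move=> gx; rewrite (_ : 0%R = ((F x - F x) * (F x - F x))%R); last first.
    by rewrite subrr mulr0.
  under eq_fun do rewrite expr2.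
  by apply: cvgM; apply: cvgB => //; exact: cvg_cst.
have mFg n : measurable_fun [set: T] (fun x => ((F x - g n x) ^+ 2)%:E).
  by apply/measurable_EFinP; apply: measurable_funX; exact: measurable_funB.
have iF2 : mu.-integrable [set: T] (fun x => (F x ^+ 2)%:E).
  apply/integrableP; split.
    by apply/measurable_EFinP; exact: measurable_funX.
  by under eq_integral do rewrite gee0_abs ?lee_fin ?sqr_ge0//.
have := @dominated_cvg _ _ _ mu [set: T] measurableT
  (fun n x => ((F x - g n x) ^+ 2)%:E) (cst 0) (fun x => (F x ^+ 2)%:E).
move=> /(_ mFg) H.
apply: vanishing_energy_approx => // e e0.
have {}H : \int[mu]_x ((F x - g n x) ^+ 2)%:E @[n --> \oo] --> 0.
  rewrite -[X in _ --> X](integral0 mu [set: T]); apply: H => //.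
  - by move=> x _; apply: cvg_EFin; [exact: nearW|exact: gcvg].
  - move=> n x _; rewrite gee0_abs ?lee_fin ?sqr_ge0//.
    by rewrite lerXn2r ?nnegrE ?subr_ge0// lerBlDr lerDl.
have [n _ /(_ n (leqnn n)) /= ne] := cvg0_vanishing H e0.
exists (g n); split => //.
apply: vanishing_energy_nnsfun rk _ => x nQx.
by apply/le_anti; rewrite g0 andbT (le_trans (gF n x))// FQ.
Qed.

(** The mollification theorem in L2: positive and negative parts reduce it to
    [vanishing_energy_ge0]. *)
Lemma vanishing_energy_sqint k Q F :
  resolves mu k Q -> measurable_fun [set: T] F ->
  (forall x, ~ Q x -> F x = 0%R) -> \int[mu]_x (F x ^+ 2)%:E < +oo ->
  vanishing (fun m => energy mu (k m) F).
Proof.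
move=> rk mF FQ iF; have [bk _ _ _] := rk.
pose P x := Num.max (F x) 0%R; pose N x := Num.max (- F x)%R 0%R.
have mP : measurable_fun [set: T] P by exact: measurable_maxr.
have mN : measurable_fun [set: T] N.
  by apply: measurable_maxr => //; exact: measurableT_comp.
have le2 (G : T -> R) : measurable_fun [set: T] G ->
    (forall x, `|G x| <= `|F x|)%R -> \int[mu]_x (G x ^+ 2)%:E < +oo.
  move=> mG GF; apply: le_lt_trans iF; apply: ge0_le_integral => //.
  - by move=> x _; rewrite lee_fin sqr_ge0.
  - by apply/measurable_EFinP; exact: measurable_funX.
  - by apply/measurable_EFinP; exact: measurable_funX.
  - move=> x _; rewrite lee_fin -real_normK ?num_real//.
    by rewrite -[leRHS]real_normK ?num_real// lerXn2r ?nnegrE.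
rewrite (_ : F = (P \+ (-1 \*o N))%R); last first.
  by apply/funext => x /=; rewrite /P /N; case: ltP => ?; case: ltP => ?; lra.
apply: vanishing_energyD => //.
- by apply: measurable_funM.
- apply: (vanishing_energy_ge0 rk) => //.
  + by move=> x; rewrite /P le_max lexx orbT.
  + by move=> x nQ; rewrite /P FQ// maxxx.
  + by apply: le2 => // x; rewrite /P; have [_|_] := ltP (F x) 0%R;
      rewrite ?normr0.
- apply: vanishing_energyZ => //; apply: (vanishing_energy_ge0 rk) => //.
  + by move=> x; rewrite /N le_max lexx orbT.
  + by move=> x nQ; rewrite /N FQ// oppr0 maxxx.
  + by apply: le2 => // x; rewrite /N; have [_|_] := ltP (- F x)%R 0%R;
      rewrite ?normrN ?normr0.
Qed.

End EnergyL2.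

Section ProductMeasure.
Context d1 d2 (T1 : measurableType d1) (T2 : measurableType d2) (R : realType).
Variables (m1 : {sigma_finite_measure set T1 -> \bar R})
          (m2 : {sigma_finite_measure set T2 -> \bar R}).
Local Open Scope ereal_scope.

(** A name for the product, on which sigma-finiteness is canonical: the
    anonymous product measure does not unify with it when iterated. *)
Definition prodm : set (T1 * T2) -> \bar R := m1 \x m2.

HB.instance Definition _ := Measure.copy prodm (m1 \x m2).

Lemma prodm_sigma_finite : sigma_finite setT prodm.
Proof.
have /sigma_finiteP[F [TF ndF Foo]] := sigma_finiteT m1.
have /sigma_finiteP[G [TG ndG Goo]] := sigma_finiteT m2.
exists (fun n => F n `*` G n).
  rewrite -setXTT TF TG; apply/seteqP; split => -[x y] /=.
    move=> [[n _ Fnx] [k _ Gky]]; exists (maxn n k) => //; split.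
    - by move: x Fnx; apply/subsetPset/ndF/leq_maxl.
    - by move: y Gky; apply/subsetPset/ndG/leq_maxr.
  by move=> [n _ [/= ? ?]]; split; exists n.
move=> k; have [? ?] := Foo k; have [? ?] := Goo k.
split; first exact: measurableX.
by rewrite /prodm product_measure1E// lte_mul_pinfty// ge0_fin_numE.
Qed.

HB.instance Definition _ :=
  Measure_isSigmaFinite.Build _ _ _ prodm prodm_sigma_finite.

End ProductMeasure.

Section ProductEnergy.
Context d1 d2 (T1 : measurableType d1) (T2 : measurableType d2) (R : realType).
Variables (m1 : {sigma_finite_measure set T1 -> \bar R})
          (m2 : {sigma_finite_measure set T2 -> \bar R}).
Local Open Scope ereal_scope.
Local Notation T12 := (T1 * T2)%type.
Local Notation m12 := (prodm m1 m2).

Definition fst2 (z : T12 * T12) : T1 * T1 := (z.1.1, z.2.1).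
Definition snd2 (z : T12 * T12) : T2 * T2 := (z.1.2, z.2.2).

Lemma measurable_fst2 : measurable_fun [set: T12 * T12] fst2.
Proof.
apply: measurable_fun_pair.
  exact: measurableT_comp measurable_fst measurable_fst.
exact: measurableT_comp measurable_fst measurable_snd.
Qed.

Lemma measurable_snd2 : measurable_fun [set: T12 * T12] snd2.
Proof.
apply: measurable_fun_pair.
  exact: measurableT_comp measurable_snd measurable_fst.
exact: measurableT_comp measurable_snd measurable_snd.
Qed.

Lemma integral_tensor (a : T1 * T1 -> R) (b : T2 * T2 -> R) :
  measurable_fun [set: T1 * T1] a -> measurable_fun [set: T2 * T2] b ->
  (forall z, (0 <= a z)%R) -> (forall z, (0 <= b z)%R) ->
  \int[m12 \x m12]_z (a (fst2 z) * b (snd2 z))%:E =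
  \int[m1 \x m1]_z (a z)%:E * \int[m2 \x m2]_z (b z)%:E.
Proof.
move=> ma mb a0 b0.
have mea : measurable_fun [set: T1 * T1] (EFin \o a) by exact/measurable_EFinP.
have meb : measurable_fun [set: T2 * T2] (EFin \o b) by exact/measurable_EFinP.
have ea0 z : 0 <= (a z)%:E by rewrite lee_fin.
have eb0 z : 0 <= (b z)%:E by rewrite lee_fin.
pose A x := \int[m1]_x' (a (x, x'))%:E.
pose B y := \int[m2]_y' (b (y, y'))%:E.
have A0 x : 0 <= A x by exact: integral_ge0.
have B0 x : 0 <= B x by exact: integral_ge0.
have mA : measurable_fun [set: T1] A.
  exact: (@measurable_fun_fubini_tonelli_F _ _ _ _ _ m1 _ mea).
have mB : measurable_fun [set: T2] B.
  exact: (@measurable_fun_fubini_tonelli_F _ _ _ _ _ m2 _ meb).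
have mab : measurable_fun [set: T12 * T12]
    (fun z => (a (fst2 z) * b (snd2 z))%:E).
  apply/measurable_EFinP; apply: measurable_funM.
    exact: measurableT_comp ma measurable_fst2.
  exact: measurableT_comp mb measurable_snd2.
rewrite [LHS]fubini_tonelli1//; last by move=> z; rewrite lee_fin mulr_ge0.
transitivity (\int[m12]_p (A p.1 * B p.2)).
  apply: eq_integral => -[x y] _; rewrite /fubini_F /=.
  rewrite [LHS]fubini_tonelli1; last 2 first.
  - exact: (measurable_fun_pair2 (x, y) mab).
  - by move=> q; rewrite lee_fin mulr_ge0.
  rewrite /fubini_F/= {1}/A -ge0_integralZr//; last first.
    exact: (measurable_fun_pair2 _ mea).
  apply: eq_integral => x' _; rewrite /fst2 /snd2/=.
  rewrite /B -ge0_integralZl_EFin//.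
  exact: (measurable_fun_pair2 _ meb).
rewrite [LHS]fubini_tonelli1; last 2 first.
- apply: emeasurable_funM.
    exact: measurableT_comp mA measurable_fst.
  exact: measurableT_comp mB measurable_snd.
- by move=> q; rewrite mule_ge0.
rewrite /fubini_F/= [in RHS]fubini_tonelli1// [in RHS]fubini_tonelli1//.
rewrite -ge0_integralZr//; last exact: integral_ge0.
by apply: eq_integral => x _; rewrite ge0_integralZl.
Qed.

Definition prod_kernel (k1 : T1 * T1 -> R) (k2 : T2 * T2 -> R) z : R :=
  (k1 (fst2 z) * k2 (snd2 z))%R.

Lemma bistochastic_prod k1 k2 :
  bistochastic m1 k1 -> bistochastic m2 k2 ->
  bistochastic m12 (prod_kernel k1 k2).
Proof.
move=> [mk1 k10 k1l k1r] [mk2 k20 k2l k2r].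
have mk : measurable_fun [set: T12 * T12] (prod_kernel k1 k2).
  apply: measurable_funM.
    exact: measurableT_comp mk1 measurable_fst2.
  exact: measurableT_comp mk2 measurable_snd2.
have mek : measurable_fun [set: T12 * T12] (EFin \o prod_kernel k1 k2).
  exact/measurable_EFinP.
have mek1 : measurable_fun [set: T1 * T1] (EFin \o k1) by exact/measurable_EFinP.
have mek2 : measurable_fun [set: T2 * T2] (EFin \o k2) by exact/measurable_EFinP.
split => //.
- by move=> z; rewrite mulr_ge0.
- move=> [x y]; rewrite [LHS]fubini_tonelli1; last 2 first.
  + exact: (measurable_fun_pair2 (x, y) mek).
  + by move=> q; rewrite lee_fin mulr_ge0.
  rewrite -(k1l x); apply: eq_integral => x' _.
  rewrite /fubini_F /prod_kernel /fst2 /snd2 /=.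
  under eq_integral do rewrite EFinM.
  rewrite ge0_integralZl_EFin ?k2l ?mule1// => [y' _|].
    by rewrite lee_fin.
  exact: (measurable_fun_pair2 _ mek2).
- move=> [x y]; rewrite [LHS]fubini_tonelli1; last 2 first.
  + exact: (measurable_fun_pair1 (x, y) mek).
  + by move=> q; rewrite lee_fin mulr_ge0.
  rewrite -(k1r x); apply: eq_integral => x' _.
  rewrite /fubini_F /prod_kernel /fst2 /snd2 /=.
  under eq_integral do rewrite EFinM.
  rewrite ge0_integralZl_EFin ?k2r ?mule1// => [y' _|].
    by rewrite lee_fin.
  exact: (measurable_fun_pair1 _ mek2).
Qed.

(** Square the identity f g - f' g' = (f - f') g + f' (g - g'). *)
Lemma energy_tensor k1 k2 (f : T1 -> R) (g : T2 -> R) :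
  bistochastic m1 k1 -> bistochastic m2 k2 ->
  measurable_fun [set: T1] f -> measurable_fun [set: T2] g ->
  energy m12 (prod_kernel k1 k2) (fun p => f p.1 * g p.2)%R <=
  2%:E * (energy m1 k1 f * \int[m2]_y (g y ^+ 2)%:E) +
  2%:E * (\int[m1]_x (f x ^+ 2)%:E * energy m2 k2 g).
Proof.
move=> bk1 bk2 mf mg; have [mk1 k10 k1l k1r] := bk1.
have [mk2 k20 k2l k2r] := bk2.
pose a1 (z : T1 * T1) : R := (k1 z * (f z.1 - f z.2) ^+ 2)%R.
pose b1 (z : T2 * T2) : R := (k2 z * g z.1 ^+ 2)%R.
pose a2 (z : T1 * T1) : R := (k1 z * f z.2 ^+ 2)%R.
pose b2 (z : T2 * T2) : R := (k2 z * (g z.1 - g z.2) ^+ 2)%R.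
have mf1 : measurable_fun [set: T1 * T1] (fun z => f z.1).
  exact: measurableT_comp mf measurable_fst.
have mf2 : measurable_fun [set: T1 * T1] (fun z => f z.2).
  exact: measurableT_comp mf measurable_snd.
have mg1 : measurable_fun [set: T2 * T2] (fun z => g z.1).
  exact: measurableT_comp mg measurable_fst.
have mg2 : measurable_fun [set: T2 * T2] (fun z => g z.2).
  exact: measurableT_comp mg measurable_snd.
have ma1 : measurable_fun [set: T1 * T1] a1.
  apply: measurable_funM => //; apply: measurable_funX; exact: measurable_funB.
have mb1 : measurable_fun [set: T2 * T2] b1.
  apply: measurable_funM => //; exact: measurable_funX.
have ma2 : measurable_fun [set: T1 * T1] a2.
  apply: measurable_funM => //; exact: measurable_funX.
have mb2 : measurable_fun [set: T2 * T2] b2.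
  apply: measurable_funM => //; apply: measurable_funX; exact: measurable_funB.
have a10 z : (0 <= a1 z)%R by rewrite mulr_ge0 ?sqr_ge0.
have b10 z : (0 <= b1 z)%R by rewrite mulr_ge0 ?sqr_ge0.
have a20 z : (0 <= a2 z)%R by rewrite mulr_ge0 ?sqr_ge0.
have b20 z : (0 <= b2 z)%R by rewrite mulr_ge0 ?sqr_ge0.
have <- : \int[m2 \x m2]_z (b1 z)%:E = \int[m2]_y (g y ^+ 2)%:E.
  rewrite [LHS]fubini_tonelli1//; last exact/measurable_EFinP.
  apply: eq_integral => y _; rewrite /fubini_F /b1 /=.
  under eq_integral do rewrite mulrC EFinM.
  rewrite ge0_integralZl_EFin ?sqr_ge0 ?k2l ?mule1// => [y' _|].
    by rewrite lee_fin.
  by apply/measurable_EFinP; exact: (measurable_fun_pair2 _ mk2).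
have <- : \int[m1 \x m1]_z (a2 z)%:E = \int[m1]_y (f y ^+ 2)%:E.
  rewrite [LHS]fubini_tonelli2//; last exact/measurable_EFinP.
  apply: eq_integral => y _; rewrite /fubini_G /a2 /=.
  under eq_integral do rewrite mulrC EFinM.
  rewrite ge0_integralZl_EFin ?sqr_ge0 ?k1r ?mule1// => [y' _|].
    by rewrite lee_fin.
  by apply/measurable_EFinP; exact: (measurable_fun_pair1 _ mk1).
rewrite /energy -/a1 -/b2 -!integral_tensor//.
have mt (a : T1 * T1 -> R) (b : T2 * T2 -> R) : measurable_fun [set: T1 * T1] a -> measurable_fun [set: T2 * T2] b ->
    measurable_fun [set: T12 * T12] (fun z => (a (fst2 z) * b (snd2 z))%:E : \bar R).
  move=> ma mb; apply/measurable_EFinP; apply: measurable_funM.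
    exact: measurableT_comp ma measurable_fst2.
  exact: measurableT_comp mb measurable_snd2.
rewrite -!ge0_integralZl_EFin//; try exact: (mt _ _ ma1 mb1);
  try exact: (mt _ _ ma2 mb2);
  try (by move=> z _; rewrite lee_fin; exact: mulr_ge0 (a10 _) (b10 _));
  try (by move=> z _; rewrite lee_fin; exact: mulr_ge0 (a20 _) (b20 _)).
rewrite -ge0_integralD//.
- apply: ge0_le_integral => //.
  + by move=> z _; rewrite lee_fin mulr_ge0 ?sqr_ge0// /prod_kernel mulr_ge0.
  + apply: (measurable_energy_integrand (F := fun p => f p.1 * g p.2)%R
      (bistochastic_prod bk1 bk2)).
    apply: measurable_funM.
      exact: measurableT_comp mf measurable_fst.
    exact: measurableT_comp mg measurable_snd.
  + apply: emeasurable_funD; apply: measurable_funeM.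
      exact: (mt _ _ ma1 mb1).
    exact: (mt _ _ ma2 mb2).
  + move=> [[x y] [x' y']] _ /=; rewrite -!EFinM -EFinD lee_fin.
    rewrite /prod_kernel /a1 /b1 /a2 /b2 /fst2 /snd2 /=.
    set K1 := k1 _; set K2 := k2 _.
    rewrite -subr_ge0 (_ : (_ - _)%R = (K1 * K2 *
      ((f x - f x') * g y - f x' * (g y - g y')) ^+ 2)%R); last by ring.
    apply: mulr_ge0; last exact: sqr_ge0.
    exact: mulr_ge0 (k10 _) (k20 _).
- move=> z _; apply: mule_ge0; rewrite lee_fin //.
  by [exact: mulr_ge0 (a10 _) (b10 _)|exact: mulr_ge0 (a20 _) (b20 _)].
- by apply: measurable_funeM; exact: (mt _ _ ma1 mb1).
- move=> z _; apply: mule_ge0; rewrite lee_fin //.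
  by [exact: mulr_ge0 (a10 _) (b10 _)|exact: mulr_ge0 (a20 _) (b20 _)].
- by apply: measurable_funeM; exact: (mt _ _ ma2 mb2).
Qed.

(** Rectangles generate the product sigma-algebra and are stable under
    intersection; on them [energy_tensor] applies. *)
Lemma resolves_prod k1 k2 Q1 Q2 :
  resolves m1 k1 Q1 -> resolves m2 k2 Q2 ->
  resolves m12 (fun m => prod_kernel (k1 m) (k2 m)) (Q1 `*` Q2).
Proof.
move=> [bk1 mQ1 Q1oo v1] [bk2 mQ2 Q2oo v2].
have vrect A B : measurable A -> measurable B ->
    vanishing (fun m => energy m12 (prod_kernel (k1 m) (k2 m))
      \1_((A `*` B) `&` (Q1 `*` Q2))).
  move=> mA mB.
  have mAQ : measurable (A `&` Q1) by exact: measurableI.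
  have mBQ : measurable (B `&` Q2) by exact: measurableI.
  have i2 d (T : measurableType d) (m : {measure set T -> \bar R}) (C : set T) :
      measurable C -> \int[m]_y ((\1_C y : R) ^+ 2)%:E = m C.
    move=> mC; rewrite -[C in RHS]setIT -integral_indic//; apply: eq_integral => y _.
    by rewrite indicE; case: (y \in C); rewrite ?expr1n ?expr0n.
  rewrite -setXI (_ : \1_((A `&` Q1) `*` (B `&` Q2)) =
    (fun p => \1_(A `&` Q1) p.1 * \1_(B `&` Q2) p.2)%R :> (T12 -> R)); last first.
    apply/funext => -[x y]; rewrite !indicE in_setX.
    by case: (x \in _); case: (y \in _); rewrite /= ?mulr1 ?mulr0.
  have fin d (T : measurableType d) (m : {measure set T -> \bar R}) (C D : set T) :
      measurable C -> measurable D -> m D < +oo ->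
      m (C `&` D) = (fine (m (C `&` D)))%:E.
    move=> mC mD Doo; rewrite fineK// ge0_fin_numE//.
    by apply: le_lt_trans Doo; apply: le_measure; rewrite ?inE//; exact: measurableI.
  apply: vanishing_le (vanishingD
    (vanishingZ (ler0n _ 2) (vanishingZ (fine_ge0 _) (v1 A mA)))
    (vanishingZ (ler0n _ 2) (vanishingZ (fine_ge0 _) (v2 B mB)))).
    move=> m; apply: le_trans (energy_tensor _ _ _ _) _ => //.
    by rewrite !i2// (fin _ _ m1)// (fin _ _ m2)// [X in 2%:E * X + _]muleC.
  - exact: measure_ge0.
  - exact: measure_ge0.
apply: (@resolves_g_sigma_algebra _ _ _ _ _ _
  [set A `*` B | A in measurable & B in measurable]).
- by move=> m; exact: bistochastic_prod.
- exact: measurableX.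
- rewrite [X in X < _](_ : _ = m1 Q1 * m2 Q2); last exact: product_measure1E.
  apply: lte_mul_pinfty => //.
  by rewrite ge0_fin_numE.
- exact: measurable_prod_measurableType.
- move=> _ _ [A mA [B mB <-]] [C mC [D mD <-]].
  rewrite -setXI; exists (A `&` C); first exact: measurableI.
  by exists (B `&` D) => //; exact: measurableI.
- rewrite -[X in \1_X]setTI -setXTT; exact: vrect.
- by move=> _ [A mA [B mB <-]]; exact: vrect.
Qed.

End ProductEnergy.

(** * Smooth functions of one variable *)

Section Smooth1.
Context {R : realType}.
Implicit Types (f g : R -> R) (B S : set (R -> R)).

(** Smoothness is membership in a set of functions closed under differentiation;
    unlike iterated derivatives, such sets combine without Leibniz formulas. *)
Definition smooth1 f := exists S : set (R -> R), S f /\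
  forall g, S g -> exists2 g', S g' & forall x : R, is_derive x 1 g (g' x).

Inductive alg1 B : (R -> R) -> Prop :=
| alg1_base f : B f -> alg1 B f
| alg1_cst c : alg1 B (fun=> c)
| alg1_add f g : alg1 B f -> alg1 B g -> alg1 B (fun x => f x + g x)
| alg1_mul f g : alg1 B f -> alg1 B g -> alg1 B (fun x => f x * g x).

(** All closure properties reduce to exhibiting generators whose derivatives
    are polynomials in the generators. *)
Lemma smooth1_alg B :
  (forall b, B b -> exists2 b', alg1 B b' & forall x : R, is_derive x 1 b (b' x)) ->
  forall f, alg1 B f -> smooth1 f.
Proof.
move=> HB f af; exists (alg1 B); split => // g; elim=> {g}.
- exact: HB.
- move=> c; exists (fun=> 0); first exact: alg1_cst.
  by move=> x; exact: is_derive_cst.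
- move=> f1 g1 _ [f1' af1 df1] _ [g1' ag1 dg1].
  exists (fun x => f1' x + g1' x); first exact: alg1_add.
  by move=> x; exact: is_deriveD.
- move=> f1 g1 h1 [f1' af1 df1] h2 [g1' ag1 dg1].
  exists (fun x => f1 x * g1' x + g1 x * f1' x).
    by apply: alg1_add; apply: alg1_mul.
  by move=> x; exact: is_deriveM.
Qed.

Lemma smooth1_derive f : smooth1 f ->
  exists2 f', smooth1 f' & forall x : R, is_derive x 1 f (f' x).
Proof.
move=> [S [Sf HS]]; have [f' Sf' df] := HS _ Sf.
by exists f' => //; exists S.
Qed.

Lemma smooth1_cst c : smooth1 (fun=> c).
Proof. by apply: (@smooth1_alg set0) => //; exact: alg1_cst. Qed.

Lemma smooth1_id : smooth1 id.
Proof.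
apply: (@smooth1_alg [set id]); last exact: alg1_base.
move=> b ->; exists (fun=> 1); first exact: alg1_cst.
by move=> x; exact: is_derive_id.
Qed.

Let smooth1_alg2 f g h : smooth1 f -> smooth1 g ->
  (forall B, B f -> B g -> alg1 B h) -> smooth1 h.
Proof.
move=> [S [Sf HS]] [S' [Sg HS']] H; apply: (@smooth1_alg (S `|` S')).
  move=> b [Sb|Sb].
    by have [b' Sb' db] := HS _ Sb; exists b' => //; apply: alg1_base; left.
  by have [b' Sb' db] := HS' _ Sb; exists b' => //; apply: alg1_base; right.
by apply: H; [left|right].
Qed.

Lemma smooth1D f g : smooth1 f -> smooth1 g -> smooth1 (fun x => f x + g x).
Proof.
move=> sf sg; apply: (smooth1_alg2 sf sg) => B Bf Bg.
by apply: alg1_add; exact: alg1_base.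
Qed.

Lemma smooth1M f g : smooth1 f -> smooth1 g -> smooth1 (fun x => f x * g x).
Proof.
move=> sf sg; apply: (smooth1_alg2 sf sg) => B Bf Bg.
by apply: alg1_mul; exact: alg1_base.
Qed.

Lemma is_derive_affine (f : R -> R) (a b x d : R) :
  is_derive (a * x + b) 1 f d -> is_derive x 1 (fun y => f (a * y + b)) (d * a).
Proof.
move=> df; apply: (@is_derive1_comp _ f (fun x => a * x + b)).
rewrite -[X in is_derive _ _ _ X]addr0.
apply: (@is_deriveD _ _ _ (fun y => a * y) (fun=> b)).
rewrite -[X in is_derive _ _ _ X]mulr1.
exact: (@is_deriveZ _ _ _ id a x 1 1).
Qed.

Lemma smooth1_affine f (a b : R) : smooth1 f -> smooth1 (fun x => f (a * x + b)).
Proof.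
move=> [S [Sf HS]].
apply: (@smooth1_alg [set h | exists2 g, S g & h = fun x => g (a * x + b)]);
  last by apply: alg1_base; exists f.
move=> _ [g Sg ->]; have [g' Sg' dg] := HS _ Sg.
exists (fun x => g' (a * x + b) * a).
  by apply: alg1_mul; [apply: alg1_base; exists g'|exact: alg1_cst].
by move=> x; exact: is_derive_affine.
Qed.

Lemma smooth1_expR f : smooth1 f -> smooth1 (fun x => expR (f x)).
Proof.
move=> [S [Sf HS]].
apply: (@smooth1_alg (S `|` [set (fun x => expR (f x))]));
  last by apply: alg1_base; right.
move=> b [Sb|->].
  by have [b' Sb' db] := HS _ Sb; exists b' => //; apply: alg1_base; left.
have [f' Sf' df] := HS _ Sf.
exists (fun x => expR (f x) * f' x).
  by apply: alg1_mul; apply: alg1_base; [right|left].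
move=> x; exact: (@is_derive1_comp _ expR f).
Qed.

Lemma smooth1V f : smooth1 f -> (forall x, f x != 0) -> smooth1 (fun x => (f x)^-1).
Proof.
move=> [S [Sf HS]] f0.
apply: (@smooth1_alg (S `|` [set (fun x => (f x)^-1)]));
  last by apply: alg1_base; right.
move=> b [Sb|->].
  by have [b' Sb' db] := HS _ Sb; exists b' => //; apply: alg1_base; left.
have [f' Sf' df] := HS _ Sf.
exists (fun x => -1 * ((f x)^-1 * (f x)^-1) * f' x).
  apply: alg1_mul; last by apply: alg1_base; left.
  apply: alg1_mul; first exact: alg1_cst.
  by apply: alg1_mul; apply: alg1_base; right.
move=> x; have := @is_deriveV _ f x (f' x) 1 (f0 x) (df x).
by rewrite mulN1r -invfM -expr2.
Qed.

(** Powers of 1/x times the flat function exp(-1/x): a family closed under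
    differentiation, up to linear combinations. *)
Definition flat (m : nat) (x : R) : R :=
  if 0 < x then x^-1 ^+ m * expR (- x^-1) else 0.

Lemma flat_ge0 m x : 0 <= flat m x.
Proof.
rewrite /flat; case: ifPn => // x0.
by rewrite mulr_ge0 ?expR_ge0// exprn_ge0// invr_ge0 ltW.
Qed.

(** The exponential grows faster than any power. The square makes [flat]
    differentiable at 0. *)
Lemma flat_le m x : flat m x <= m.+2`!%:R * x ^+ 2.
Proof.
rewrite /flat; case: ifPn => [x0|_]; last by rewrite mulr_ge0 ?sqr_ge0.
have y0 : 0 < x^-1 by rewrite invr_gt0.
rewrite expRN ler_pdivrMr ?expR_gt0//.
have := expR_ge1Dxn m.+1 (ltW y0); set e := expR _ => He.
have : x^-1 ^+ m.+2 / (m.+2)`!%:R <= e by apply: le_trans He; rewrite lerDr.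
rewrite ler_pdivrMr ?ltr0n ?fact_gt0// => {}He.
rewrite -(@ler_pM2l _ (x^-1 ^+ 2)) ?exprn_gt0//.
have -> : x^-1 ^+ 2 * ((m.+2)`!%:R * x ^+ 2 * e) = e * (m.+2)`!%:R.
  by field; rewrite gt_eqF.
by rewrite -exprD.
Qed.

Lemma is_derive_sq f (x d C : R) :
  (forall h, `|f (x + h) - f x - h * d| <= C * h ^+ 2) -> is_derive x 1 f d.
Proof.
move=> H.
have C0 : 0 <= C.
  by have := H 1; rewrite expr1n mulr1; exact/le_trans/normr_ge0.
have {}H : h^-1 *: ((f \o shift x) (h *: 1) - f x) @[h --> 0^'] --> d.
  apply/cvgrPdist_le => e e0; near=> h.
  have h0 : h != 0 by near: h; exact: nbhs_dnbhs_neq.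
  have he : `|h| <= e / (C + 1).
    near: h; apply: dnbhs0_le; rewrite divr_gt0// ltr_wpDl//.
  have -> : d - h^-1 *: ((f \o shift x) (h *: 1) - f x) =
      - (h^-1 * (f (x + h) - f x - h * d)).
    by rewrite /= /GRing.scale/= mulr1 (addrC h); field.
  rewrite normrN normrM normfV ler_pdivrMl ?normr_gt0//.
  apply: le_trans (H h) _; rewrite -real_normK ?num_real// expr2 mulrCA.
  rewrite ler_wpM2l// (le_trans (ler_wpM2l C0 he))// mulrCA ger_pMr//.
  by rewrite ler_pdivrMr ?ltr_wpDl// mul1r lerDl.
by split; [apply: cvgP H|exact: cvg_lim H].
Unshelve. all: end_near. Qed.

Lemma is_derive_flat m (x : R) :
  is_derive x 1 (flat m) (flat m.+2 x - m%:R * flat m.+1 x).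
Proof.
have [x0|x0|->] := ltgtP x 0.
- have -> : flat m.+2 x - m%:R * flat m.+1 x = 0.
    by rewrite /flat ltNge (ltW x0)/= mulr0 subr0.
  apply: (@near_eq_is_derive _ _ _ (fun=> 0)).
  near=> y; rewrite /flat ltNge ltW//=; near: y; exact: lt_nbhsl.
- have fx p : flat p x = x^-1 ^+ p * expR (- x^-1) by rewrite /flat x0.
  rewrite !fx.
  apply: (@near_eq_is_derive _ _ _ (fun y : R => y^-1 ^+ m * expR (- y^-1) : R)).
    near=> y; rewrite /flat; suff -> : 0 < y by [].
    near: y; exact: lt_nbhsr.
  have dV : is_derive x 1 (fun y : R => y^-1) (- x ^- 2).
    have := @is_deriveV _ id x 1 1 _ (is_derive_id _ _).
    by rewrite /GRing.scale /= mulr1; apply; rewrite gt_eqF.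
  have dX := is_deriveX m dV.
  have dN : is_derive x 1 (fun y : R => - y^-1) (x ^- 2).
    by rewrite -[X in is_derive _ _ _ X]opprK; exact: is_deriveN.
  have dE := @is_derive1_comp _ expR (fun y : R => - y^-1) x _ _
    (is_derive_expR (- x^-1)) dN.
  have := is_deriveM dX dE.
  rewrite (_ : (fun y : R => y^-1) ^+ m * (expR \o (fun y => - y^-1)) =
    (fun y => y^-1 ^+ m * expR (- y^-1))); last first.
    by apply/funext => y; rewrite fctE /= fctE.
  move=> dM; apply: (is_derive_eq dM).
  rewrite /GRing.scale /= fctE /=; set e := expR _; clear -x0.
  rewrite -!exprVn; case: m => [|m] /=; first by rewrite !expr0; ring.
  by rewrite !exprS; ring.
- have f0 p : flat p 0 = 0 by rewrite /flat ltxx.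
  rewrite !f0 mulr0 subr0; apply: (@is_derive_sq _ _ _ m.+2`!%:R) => h.
  by rewrite add0r f0 subr0 mulr0 subr0 ger0_norm ?flat_ge0 ?flat_le.
Unshelve. all: end_near. Qed.

Lemma smooth1_flat m : smooth1 (flat m).
Proof.
apply: (@smooth1_alg [set h | exists m, h = flat m]);
  last by apply: alg1_base; exists m.
move=> _ [p ->]; exists (fun x => flat p.+2 x + - p%:R * flat p.+1 x).
  apply: alg1_add; first by apply: alg1_base; exists p.+2.
  by apply: alg1_mul; [exact: alg1_cst|apply: alg1_base; exists p.+1].
by move=> x; rewrite mulNr; exact: is_derive_flat.
Qed.

End Smooth1.

Section Step.
Context {R : realType}.

Lemma is_derive_flat0 (x : R) : is_derive x 1 (flat 0) (flat 2 x).
Proof. by have := is_derive_flat 0 x; rewrite mul0r subr0. Qed.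

Let lower (x : R) := flat 0 (1 * x + 1).
Let upper (x : R) := flat 0 (-1 * x + 1).

Lemma flat_gt0 m (x : R) : 0 < x -> 0 < flat m x.
Proof. by move=> x0; rewrite /flat x0 mulr_gt0 ?expR_gt0// exprn_gt0// invr_gt0. Qed.

Lemma flat_eq0 m (x : R) : x <= 0 -> flat m x = 0.
Proof. by rewrite /flat leNgt => /negbTE ->. Qed.

Let den_gt0 x : 0 < lower x + upper x.
Proof.
rewrite /lower /upper; have [x0|x0] := ltP 0 (1 * x + 1).
  by rewrite ltr_pwDl ?flat_gt0 ?flat_ge0.
by rewrite ltr_wpDl ?flat_ge0 ?flat_gt0//; lra.
Qed.

(** A smooth transition from 0 (below -1) to 1 (above 1); its derivative serves
    as mollifier and its translates as cutoffs. *)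
Definition step (x : R) : R := lower x * (lower x + upper x)^-1.

Definition step' (x : R) : R :=
  (flat 2 (1 * x + 1) * upper x + lower x * flat 2 (-1 * x + 1)) *
  ((lower x + upper x)^-1 * (lower x + upper x)^-1).

Lemma smooth1_step : smooth1 step.
Proof.
apply: smooth1M; first exact: smooth1_affine (smooth1_flat 0).
apply: smooth1V; last by move=> x; rewrite gt_eqF.
by apply: smooth1D; exact: smooth1_affine (smooth1_flat 0).
Qed.

Lemma smooth1_step' : smooth1 step'.
Proof.
have sV : smooth1 (fun x => (lower x + upper x)^-1).
  apply: smooth1V; last by move=> x; rewrite gt_eqF.
  by apply: smooth1D; exact: smooth1_affine (smooth1_flat 0).
apply: smooth1M; last exact: smooth1M.
by apply: smooth1D; apply: smooth1M; exact: smooth1_affine (smooth1_flat _).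
Qed.

Lemma is_derive_step (x : R) : is_derive x 1 step (step' x).
Proof.
have dl : is_derive x 1 lower (flat 2 (1 * x + 1) * 1).
  by apply: is_derive_affine; exact: is_derive_flat0.
have du : is_derive x 1 upper (flat 2 (-1 * x + 1) * -1).
  by apply: is_derive_affine; exact: is_derive_flat0.
have dden := is_deriveD dl du.
have n0 : (lower + upper) x != 0 by rewrite gt_eqF//; exact: den_gt0.
have dV := is_deriveV n0 dden.
apply: (is_derive_eq (is_deriveM dl dV)).
rewrite /GRing.scale /= /step' -!exprVn.
have : lower x + upper x != 0 by [].
rewrite (_ : (lower + upper) x = lower x + upper x)//.
by move: (lower x) (upper x) => l u lu; field.
Qed.

Lemma step'_ge0 x : 0 <= step' x.
Proof.
rewrite /step' mulr_ge0// ?mulr_ge0 ?invr_ge0 ?(ltW (den_gt0 _))//.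
by rewrite addr_ge0// mulr_ge0// flat_ge0.
Qed.

Lemma step_ge0 x : 0 <= step x.
Proof. by rewrite /step mulr_ge0 ?flat_ge0 ?invr_ge0 ?(ltW (den_gt0 _)). Qed.

Lemma step_le1 x : step x <= 1.
Proof. by rewrite /step ler_pdivrMr ?den_gt0// mul1r lerDl flat_ge0. Qed.

Lemma step_0 x : x <= -1 -> step x = 0.
Proof. by move=> x1; rewrite /step /lower flat_eq0 ?mul0r//; lra. Qed.

Lemma step_1 x : 1 <= x -> step x = 1.
Proof.
move=> x1; rewrite /step /upper (@flat_eq0 _ (-1 * x + 1)) ?addr0 ?mulfV//; last lra.
by rewrite gt_eqF// flat_gt0//; lra.
Qed.

Lemma step'_0 x : 1 <= `|x| -> step' x = 0.
Proof.
rewrite ler_normr => /orP[x1|x1].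
  by rewrite /step' /upper !(@flat_eq0 _ (-1 * x + 1)) ?mulr0 ?addr0 ?mul0r//; lra.
by rewrite /step' /lower !(@flat_eq0 _ (1 * x + 1)) ?mul0r ?addr0 ?mul0r//; lra.
Qed.

Lemma smooth1_continuous (f : R -> R) : smooth1 f -> continuous f.
Proof.
move=> /smooth1_derive[f' _ df] x; apply: differentiable_continuous.
by apply/derivable1_diffP; have [] := df x.
Qed.

Lemma smooth1_measurable (f : R -> R) : smooth1 f -> measurable_fun [set: R] f.
Proof. by move=> /smooth1_continuous; exact: continuous_measurable_fun. Qed.

Lemma ge0_integral_derive (F f : R -> R) (a b : R) : a < b ->
  (forall x : R, is_derive x 1 F (f x)) -> smooth1 f ->
  (forall x, ~ (a <= x <= b) -> f x = 0) ->
  (\int[lebesgue_measure]_x (f x)%:E = (F b - F a)%:E)%E.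
Proof.
move=> ab dF sf f0.
rewrite (_ : (fun x => (f x)%:E) = (fun x => (f x)%:E) \_ `[a, b]); last first.
  apply/funext => x; rewrite patchE; case: ifPn => //.
  by rewrite notin_setE /= in_itv/= => /f0 ->.
rewrite -integral_mkcond EFinB; apply: continuous_FTC2 => //.
- by apply: continuous_subspaceT => x; exact: smooth1_continuous.
- split.
  + by move=> x _; have [] := dF x.
  + apply: cvg_at_right_filter; apply: differentiable_continuous.
    by apply/derivable1_diffP; have [] := dF a.
  + apply: cvg_at_left_filter; apply: differentiable_continuous.
    by apply/derivable1_diffP; have [] := dF b.
- by move=> x _; rewrite derive1E; have [] := dF x.
Qed.

End Step.

(** * Mollification resolves Lebesgue measure *)

Section Kernel1.
Context {R : realType}.
Local Notation RR := (measurableTypeR R).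
Local Notation leb := (@lebesgue_measure R).

(** An approximate identity: its mass over an interval is a difference of values of
    [step]. The summand 0 gives the argument the shape of [smooth1_affine]. *)
Definition moll (m : nat) (s : R) : R := m.+1%:R * step' (m.+1%:R * s + 0).

Lemma smooth1_moll m : smooth1 (moll m).
Proof.
by apply: smooth1M; [exact: smooth1_cst|exact: smooth1_affine smooth1_step'].
Qed.

Lemma moll_ge0 m s : 0 <= moll m s.
Proof. by rewrite mulr_ge0// step'_ge0. Qed.

Lemma moll_eq0 m s : m.+1%:R^-1 <= `|s| -> moll m s = 0.
Proof.
move=> ms; rewrite /moll step'_0 ?mulr0// addr0 normrM ger0_norm//.
by rewrite mulrC -ler_pdivrMr// mul1r.
Qed.

Definition kernel1 (m : nat) (z : RR * RR) : R := moll m (z.1 - z.2).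

Lemma bistochastic_kernel1 m : bistochastic leb (kernel1 m).
Proof.
have m0 : 0 < m.+1%:R :> R by rewrite ltr0n.
have ge1 (x : R) : 1 <= m.+1%:R * (x + 1 - x) + 0 :> R.
  by rewrite addr0 addrAC subrr add0r mulr1 ler1n.
have [le1 ge1'] : m.+1%:R * -1 + 0 <= -1 :> R /\ 1 <= m.+1%:R * 1 + 0 :> R.
  by rewrite !addr0 mulrN1 lerN2 mulr1 ler1n.
have far (x y : R) : ~ (x - 1 <= y <= x + 1) -> moll m (x - y) = 0 /\ moll m (y - x) = 0.
  move=> xy; have H : m.+1%:R^-1 <= `|x - y|.
    apply: (@le_trans _ _ 1); first by rewrite invf_le1// ler1n.
    by rewrite leNgt; apply/negP; rewrite ltr_norml => /andP[? ?]; apply: xy; lra.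
  by rewrite !moll_eq0// distrC.
split.
- apply: (@measurableT_comp _ _ _ _ _ _ (moll m)).
    exact: (smooth1_measurable (smooth1_moll m)).
  by apply: measurable_funB; [exact: measurable_fst|exact: measurable_snd].
- by move=> z; exact: moll_ge0.
- move=> x.
  rewrite (_ : (fun y => _) = (fun y => (moll m (-1 * y + x))%:E)); last first.
    by apply/funext => y; rewrite /kernel1 /= mulN1r addrC.
  pose F (y : R) := - step (m.+1%:R * (-1 * y + x) + 0).
  transitivity (F (x + 1) - F (x - 1))%:E.
    apply: ge0_integral_derive.
    + by rewrite -subr_gt0; lra.
    + move=> y.
      have d1 := is_derive_affine (is_derive_step (m.+1%:R * (-1 * y + x) + 0)).
      have dd := is_derive_affine (f := fun y => step (m.+1%:R * y + 0)) d1.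
      by apply: (is_derive_eq (is_deriveN dd)); rewrite /moll mulrN1 opprK mulrC.
    + exact: smooth1_affine (smooth1_moll m).
    + by move=> y /far[+ _]; rewrite mulN1r addrC.
  rewrite /F opprK step_0; last by rewrite (_ : -1 * (x + 1) + x = -1)//; ring.
  by rewrite step_1 ?oppr0 ?add0r// (_ : -1 * (x - 1) + x = 1)//; ring.
- move=> x.
  rewrite (_ : (fun y => _) = (fun y => (moll m (1 * y + - x))%:E)); last first.
    by apply/funext => y; rewrite /kernel1 /= mul1r.
  pose F (y : R) := step (m.+1%:R * (1 * y + - x) + 0).
  transitivity (F (x + 1) - F (x - 1))%:E.
    apply: ge0_integral_derive.
    + by rewrite -subr_gt0; lra.
    + move=> y.
      have d1 := is_derive_affine (is_derive_step (m.+1%:R * (1 * y - x) + 0)).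
      have dd := is_derive_affine (f := fun y => step (m.+1%:R * y + 0)) d1.
      by apply: (is_derive_eq dd); rewrite /moll mulr1 mulrC.
    + exact: smooth1_affine (smooth1_moll m).
    + by move=> y /far[_]; rewrite mul1r.
  rewrite /F step_1; last by rewrite (_ : 1 * (x + 1) - x = 1)//; ring.
  by rewrite step_0 ?subr0// (_ : 1 * (x - 1) - x = -1)//; ring.
Qed.

(** The integrand vanishes unless the first variable is closer than [d] to an end
    point of the interval. *)
Lemma energy_itv m (a b : R) :
  (energy leb (kernel1 m) (\1_(`]a, b]%classic) : RR -> R) <= (4 * m.+1%:R^-1)%:E)%E.
Proof.
have [mk k0 k1 _] := bistochastic_kernel1 m.
set d : R := m.+1%:R^-1.
have d0 : 0 < d by rewrite invr_gt0.
pose J (c : R) : set RR := `[c - d, c + d]%classic.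
have mJ c : measurable (J c) by exact: measurable_itv.
have mIz c : measurable_fun [set: RR * RR] (fun z => \1_(J c) z.1 : R).
  apply: (@measurableT_comp _ _ _ _ _ _ (\1_(J c) : RR -> R)).
    by apply: measurable_indic.
  exact: measurable_fst.
have muJ c : leb (J c) = (2 * d)%:E.
  rewrite /J lebesgue_measure_itv/= lte_fin ifT; last by lra.
  by rewrite -EFinB; congr EFin; ring.
have i1 c : (\int[leb \x leb]_z (kernel1 m z * \1_(J c) z.1)%:E = (2 * d)%:E)%E.
  rewrite fubini_tonelli1/=; last 2 first.
  - apply/measurable_EFinP; exact: measurable_funM.
  - by move=> z; rewrite lee_fin mulr_ge0.
  rewrite -(muJ c) -[J c in RHS]setIT -integral_indic//.
  apply: eq_integral => x _; rewrite /fubini_F/=.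
  under eq_integral do rewrite mulrC EFinM.
  rewrite ge0_integralZl_EFin ?k1 ?mule1//.
    by move=> y _; rewrite lee_fin.
  by apply/measurable_EFinP; exact: measurable_fun_pair2 mk.
have -> : (4 * d)%:E = (\int[leb \x leb]_z
    ((kernel1 m z * \1_(J a) z.1)%:E + (kernel1 m z * \1_(J b) z.1)%:E))%E.
  have mi c : measurable_fun [set: RR * RR] (fun z => (kernel1 m z * \1_(J c) z.1)%:E).
    apply/measurable_EFinP; exact: measurable_funM.
  rewrite ge0_integralD//.
  - by rewrite !i1 -EFinD; congr EFin; ring.
  - by move=> z _; rewrite lee_fin mulr_ge0.
  - by move=> z _; rewrite lee_fin mulr_ge0.
apply: ge0_le_integral => //.
- by move=> z _; rewrite lee_fin mulr_ge0// sqr_ge0.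
- apply: (measurable_energy_integrand (bistochastic_kernel1 m)).
  by apply: measurable_indic; exact: measurable_itv.
- apply: emeasurable_funD; apply/measurable_EFinP; exact: measurable_funM.
move=> [x y] _ /=; rewrite -EFinD lee_fin -mulrDr.
have [xy|xy] := leP d `|x - y|; first by rewrite /kernel1 moll_eq0// !mul0r.
rewrite ler_wpM2l//.
have s (c : R) : ((x <= c) != (y <= c)) -> x \in J c.
  rewrite inE /J /= in_itv/=; move: xy; rewrite ltr_norml => /andP[? ?].
  by have [?|?] := leP x c; have [?|?] := leP y c => //= _; apply/andP; split; lra.
rewrite !indicE; have := s a; have := s b.
move: (x \in J a) (x \in J b) => ja jb; rewrite !mem_setE !in_itv/= !(ltNge a).
case: (x <= a); case: (y <= a); case: (x <= b); case: (y <= b);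
  case: ja; case: jb => //= sb sa;
  rewrite ?subrr ?subr0 ?sub0r ?sqrrN ?expr0n ?expr1n ?addr0 ?add0r//=;
  rewrite ?ler1n ?lerDl ?ler01 ?addr_ge0//;
  by [have := sa isT|have := sb isT].
Qed.

Lemma resolves_kernel1 (a b : R) : resolves leb kernel1 (`]a, b]%classic : set RR).
Proof.
have v (c d : R) : vanishing (fun m => energy leb (kernel1 m) (\1_(`]c, d]%classic) : RR -> R)).
  move=> e e0; near=> m; apply: le_trans (energy_itv m c d) _.
  rewrite lee_fin mulrC -ler_pdivlMr//; apply: ltW; near: m.
  by apply: near_infty_natSinv_lt (PosNum _); rewrite divr_gt0.
apply: (@resolves_g_sigma_algebra _ RR R leb kernel1 _ (@ocitv R)).
- exact: bistochastic_kernel1.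
- exact: measurable_itv.
- rewrite -[X in (X < _)%E]/(lebesgue_measure (`]a, b]%classic : set R)).
  by rewrite lebesgue_measure_itv/=; case: ifPn => // _; rewrite -EFinB ltry.
- by [].
- exact: ocitvI.
- exact: v.
- move=> A oA; have [AQ|AQ] := pselect (A `&` `]a, b]%classic = set0).
    by rewrite AQ -(@set_itvoc0 _ R 0); exact: v.
  have : ocitv (A `&` `]a, b]%classic).
    by apply: ocitvI => //; exact: is_ocitv.
  by move=> /ocitvP[//|[[c d] /= cd ->]]; exact: v.
Unshelve. all: end_near. Qed.

End Kernel1.

Section KernelSpacetime.
Context {R : realType}.
Local Notation RR := (measurableTypeR R).
Local Notation leb := (@lebesgue_measure R).

(** A copy of Lebesgue measure to carry the sigma-finite structure. *)
Definition leb_rV n : set 'rV[R]_n -> \bar R := lebesgue_rV R n.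

HB.instance Definition _ n := Measure.copy (@leb_rV n) (lebesgue_rV R n).

Definition cube n (N : R) : set 'rV[R]_n :=
  [set x | forall i, x ord0 i \in `[- N, N]].

Lemma leb_rV_sigma_finite n : sigma_finite setT (@leb_rV n).
Proof.
exists (fun N => @cube n N%:R).
  apply/esym/seteqP; split => // x _.
  have [N Nx] : exists N : nat, forall i, `|x ord0 i| <= N%:R.
    exists (\max_(i < n) Num.truncn `|x ord0 i|).+1 => i.
    apply: (@le_trans _ _ (Num.truncn `|x ord0 i|).+1%:R).
      by rewrite ltW// truncnS_gt.
    by rewrite ler_nat ltnS; exact: (leq_bigmax i).
  by exists N => // i; rewrite in_itv/= -ler_norml.
move=> N; split; first exact: measurable_box.
rewrite /leb_rV /cube.
have -> : lebesgue_rV R n [set x | forall i, x ord0 i \in `[- N%:R, N%:R]] =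
    (\prod_(i < n) (N%:R - - N%:R))%:E :> \bar R.
  by apply: lebesgue_rV_box => i; rewrite ge0_cp.
exact: ltry.
Qed.

HB.instance Definition _ n :=
  Measure_isSigmaFinite.Build _ _ _ (@leb_rV n) (leb_rV_sigma_finite n).

Section Pushforward.
Context d1 d2 (T1 : measurableType d1) (T2 : measurableType d2).
Variables (m1 : {sigma_finite_measure set T1 -> \bar R})
          (m2 : {sigma_finite_measure set T2 -> \bar R}).
Variables (phi : T1 -> T2) (mphi : measurable_fun [set: T1] phi).
Hypothesis m2E : forall A, measurable A -> m2 A = m1 (phi @^-1` A).
Local Open Scope ereal_scope.

Lemma ge0_integral_image (f : T2 -> \bar R) :
  measurable_fun [set: T2] f -> (forall y, 0 <= f y) ->
  \int[m2]_y f y = \int[m1]_x f (phi x).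
Proof.
move=> mf f0.
rewrite (@eq_measure_integral _ _ _ _ (pushforward m1 phi)); last first.
  by move=> A mA _; exact: m2E.
by rewrite ge0_integral_pushforward.
Qed.

(** Used with the measure preserving bijection of R^n * R with R^n.+1, on which the
    construction of Lebesgue measure rests. *)
Lemma resolves_image k1 (k2 : nat -> T2 * T2 -> R) Q :
  resolves m1 k1 (phi @^-1` Q) -> measurable Q ->
  (forall m, measurable_fun [set: T2 * T2] (k2 m)) ->
  (forall m z, (0 <= k2 m z)%R) ->
  (forall m x y, k2 m (phi x, phi y) = k1 m (x, y)) ->
  (forall y, exists x, phi x = y) ->
  resolves m2 k2 Q.
Proof.
move=> [bk1 _ Qoo vk1] mQ mk2 k20 k2E sphi.
have bk2 m : bistochastic m2 (k2 m).
  have [_ _ k1l k1r] := bk1 m.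
  have mek : measurable_fun [set: T2 * T2] (EFin \o k2 m) by exact/measurable_EFinP.
  split => // y; have [x <-] := sphi y.
  - rewrite ge0_integral_image; last 2 first.
    + exact: (measurable_fun_pair2 _ mek).
    + by move=> z; rewrite lee_fin.
    by rewrite -[RHS](k1l x); apply: eq_integral => z _; rewrite k2E.
  - rewrite (@ge0_integral_image (fun z => (k2 m (z, phi x))%:E)); last 2 first.
    + exact: (measurable_fun_pair1 _ mek).
    + by move=> z; rewrite lee_fin.
    by rewrite -[RHS](k1r x); apply: eq_integral => z _; rewrite k2E.
split => //; first by rewrite m2E.
move=> A mA.
have mAp : measurable (phi @^-1` A) by rewrite -[X in measurable X]setTI; exact: mphi.
apply: vanishing_le (vk1 _ mAp) => m.
have mI : measurable_fun [set: T2] (\1_(A `&` Q) : T2 -> R).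
  by apply: measurable_indic; exact: measurableI.
have mg := measurable_energy_integrand (bk2 m) mI.
have mI1 : measurable_fun [set: T1] (\1_(phi @^-1` A `&` phi @^-1` Q) : T1 -> R).
  apply: measurable_indic; apply: measurableI => //.
  by rewrite -[X in measurable X]setTI; exact: mphi.
have mg1 := measurable_energy_integrand (bk1 m) mI1.
rewrite le_eqVlt; apply/orP; left; apply/eqP; rewrite /energy.
have [_ k10 _ _] := bk1 m.
rewrite [LHS]fubini_tonelli1//; last first.
  by move=> z; rewrite lee_fin mulr_ge0// sqr_ge0.
rewrite [RHS]fubini_tonelli1//; last first.
  by move=> z; rewrite lee_fin mulr_ge0// sqr_ge0.
rewrite ge0_integral_image; last 2 first.
- apply: measurable_fun_fubini_tonelli_F => // z.
  by rewrite lee_fin mulr_ge0// sqr_ge0.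
- by move=> y; apply: integral_ge0 => z _; rewrite lee_fin mulr_ge0// sqr_ge0.
apply: eq_integral => x _; rewrite /fubini_F ge0_integral_image; last 2 first.
- exact: (measurable_fun_pair2 _ mg).
- by move=> z; rewrite lee_fin mulr_ge0// sqr_ge0.
by apply: eq_integral => y _; rewrite /= k2E.
Qed.

End Pushforward.

Definition kernel_rV n (m : nat) (z : 'rV[R]_n * 'rV[R]_n) : R :=
  \prod_(i < n) moll m (z.1 ord0 i - z.2 ord0 i).

(** Half-open, as are the intervals that generate the Borel sets. *)
Definition ocube n (N : R) : set 'rV[R]_n :=
  [set x | forall i, x ord0 i \in `]- N, N]].

Lemma measurable_ocube n N : measurable (@ocube n N).
Proof.
rewrite (_ : ocube _ = \bigcap_(i in [set: 'I_n])
    ((fun x : 'rV[R]_n => x ord0 i : measurableTypeR R) @^-1`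
      `]- N, N]%classic)); last first.
  by apply/seteqP; split => x /= H i; [move=> _; exact: H|exact: H i I].
apply: fin_bigcap_measurable => // i _; rewrite -[X in measurable X]setTI.
by apply: measurable_coord => //; exact: measurable_itv.
Qed.

Lemma measurable_kernel_rV n m : measurable_fun [set: _] (@kernel_rV n m).
Proof.
apply: (@measurable_prod _ _ R _ _ _
  (fun i (z : 'rV[R]_n * 'rV[R]_n) => moll m (z.1 ord0 i - z.2 ord0 i))) => i _.
apply: (@measurableT_comp _ _ _ _ _ _ (moll m)).
  exact: (smooth1_measurable (smooth1_moll m)).
apply: measurable_funB.
  exact: (measurableT_comp (@measurable_coord R n i) measurable_fst).
exact: (measurableT_comp (@measurable_coord R n i) measurable_snd).
Qed.

Lemma lift_max n (i : 'I_n) : lift ord_max i = widen_ord (leqnSn n) i.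
Proof. by apply: val_inj; rewrite /= /bump leqNgt ltn_ord. Qed.

Lemma resolves_kernel_rV n (N : R) :
  resolves (@leb_rV n) (@kernel_rV n) (@ocube n N).
Proof.
elim: n => [|n IH].
  have z0 (x y : 'rV[R]_0) : x = y by apply/rowP => -[].
  have bk m : bistochastic (@leb_rV 0) (@kernel_rV 0 m).
    have k1 z : @kernel_rV 0 m z = 1 by rewrite /kernel_rV big_ord0.
    have i1 : (\int[@leb_rV 0]_x 1 = 1)%E.
      rewrite integral_cst// mul1e.
      by rewrite -[LHS]/(\d_(0 : 'rV[R]_0) [set: 'rV[R]_0]) diracE mem_set.
    split.
    - exact: measurable_kernel_rV.
    - by move=> z; rewrite k1.
    - by move=> x; under eq_integral do rewrite k1.
    - by move=> x; under eq_integral do rewrite k1.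
  split => //.
  - exact: measurable_ocube.
  - rewrite -[X in (X < _)%E]/(\d_(0 : 'rV[R]_0) (@ocube 0 N)) diracE.
    exact: ltry.
  - move=> A mA; apply: vanishing_le vanishing0 => m.
    rewrite /energy integral0_eq// => z _.
    by rewrite (z0 z.1 z.2) subrr expr0n mulr0.
have mE A : measurable A -> @leb_rV n.+1 A =
    prodm (@leb_rV n) leb (@rcons_rV R n @^-1` A).
  by [].
refine (@resolves_image _ _ _ _ (prodm (@leb_rV n) leb) (@leb_rV n.+1)
  (@rcons_rV R n) (@measurable_rcons_rV R n) mE
  (fun m => prod_kernel (@kernel_rV n m) (kernel1 m)) (@kernel_rV n.+1)
  (@ocube n.+1 N) _ _ _ _ _ _).
- rewrite (_ : _ @^-1` _ = @ocube n N `*` `]- N, N]%classic).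
    exact: resolves_prod IH (resolves_kernel1 _ _).
  apply/seteqP; split => [[x t] /= H|[x t] /= [Hx Ht] i].
    split=> [i|].
      by have := H (lift ord_max i); rewrite /rcons_rV mxE liftK.
    by have := H ord_max; rewrite /rcons_rV mxE unlift_none.
  by rewrite /rcons_rV mxE; case: unliftP => [j _|_ //]; exact: Hx.
- exact: measurable_ocube.
- by move=> m; exact: measurable_kernel_rV.
- by move=> m z; apply: prodr_ge0 => i _; exact: moll_ge0.
- move=> m [x s] [y t]; rewrite /prod_kernel /kernel_rV /kernel1 big_ord_recr /=.
  congr (_ * _).
    by apply: eq_bigr => i _; rewrite -lift_max /rcons_rV !mxE liftK.
  by rewrite /rcons_rV !mxE unlift_none.
- move=> y; exists (\row_i y ord0 (lift ord_max i), y ord0 ord_max).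
  apply/rowP => i; rewrite /rcons_rV mxE.
  by case: unliftP => [j ->|-> //]; rewrite mxE.
Qed.

End KernelSpacetime.

(** * Smooth functions on space-time *)

(** The directional derivative, locked: iterated derivatives are then rewritten
    and compared as terms, without unfolding the limits. *)
HB.lock Definition pd (R : realType) (n : nat) (v : 'rV[R]_n * R)
  (f : 'rV[R]_n * R -> R) : 'rV[R]_n * R -> R := fun p => 'D_v f p.

Section SmoothE.
Context {R : realType} {n : nat}.
Local Notation E := ('rV[R]_n * R)%type.
Local Notation mE := ('rV[R]_n * measurableTypeR R)%type.
Implicit Types (f g : E -> R) (p q v w : E).

(** One index type for space and time, so that products over all coordinates and
    bounds on all of them need no case distinction. *)
Definition crd (i : option 'I_n) (p : E) : R :=
  if i is Some j then p.1 ord0 j else p.2.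

(** The algebra generated by smooth functions of one coordinate. It contains
    every weight, cutoff and mollifier needed here, and the calculus rules are
    proved by induction. *)
Inductive smoothE : (E -> R) -> Prop :=
| smoothE_base i (f : R -> R) : smooth1 f -> smoothE (fun p => f (crd i p))
| smoothED f g : smoothE f -> smoothE g -> smoothE (fun p => f p + g p)
| smoothEM f g : smoothE f -> smoothE g -> smoothE (fun p => f p * g p).

Lemma smoothE_cst c : smoothE (fun=> c).
Proof. exact: (@smoothE_base None (fun=> c) (smooth1_cst c)). Qed.

Lemma smoothEZ c f : smoothE f -> smoothE (fun p => c * f p).
Proof. by move=> sf; apply: smoothEM => //; exact: smoothE_cst. Qed.

Lemma smoothE_prod (I : Type) (s : seq I) (F : I -> E -> R) :
  (forall i, smoothE (F i)) -> smoothE (fun p => \prod_(i <- s) F i p).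
Proof.
move=> sF; elim: s => [|i s IH].
  by under eq_fun do rewrite big_nil; exact: smoothE_cst.
by under eq_fun do rewrite big_cons; exact: smoothEM.
Qed.

Lemma crd_shift i v p h : crd i (h *: v + p) = crd i v * h + crd i p.
Proof. by case: i => [j|] /=; rewrite ?mxE /= mulrC. Qed.

Lemma differentiable_crd i p : differentiable (crd i : E -> R) p.
Proof.
case: i => [j|] /=.
  apply: (@differentiable_comp _ _ _ _ fst (fun x : 'rV[R]_n => x ord0 j)).
    by apply: (@linear_differentiable _ _ _ (fst : {linear E -> 'rV[R]_n})) => q;
      exact: cvg_fst.
  exact: differentiable_coord.
by apply: (@linear_differentiable _ _ _ (snd : {linear E -> R^o})) => q;
  exact: cvg_snd.
Qed.

Lemma is_derive_line f p v (d : R) :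
  is_derive (0 : R) 1 (fun h : R => f (h *: v + p)) d -> is_derive p v f d.
Proof.
move=> [dh eh].
have e : (fun h : R => h^-1 *: (((fun h : R => f (h *: v + p)) \o shift 0)
    (h *: 1) - f (0 *: v + p))) = (fun h : R => h^-1 *: ((f \o shift p) (h *: v) - f p)).
  by apply/funext => h /=; rewrite addr0 scale0r add0r [h *: 1]mulr1.
by split; [move: dh; rewrite /derivable e|rewrite -eh /derive e].
Qed.

Lemma is_derive_crd i (f : R -> R) p v (d : R) :
  is_derive (crd i p) 1 f d -> is_derive p v (fun p => f (crd i p)) (d * crd i v).
Proof.
move=> df; apply: is_derive_line.
under eq_fun do rewrite crd_shift.
by apply: is_derive_affine; rewrite mulr0 add0r.
Qed.

Lemma smoothE_derive f : smoothE f -> forall v,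
  exists2 f', smoothE f' & forall p, is_derive p v f (f' p).
Proof.
move=> sf v; elim: {f} sf => [i f sf|f g _ [f' sf' df] _ [g' sg' dg]|
    f g sf [f' sf' df] sg [g' sg' dg]].
- have [f' sf' df] := smooth1_derive sf.
  exists (fun p => f' (crd i p) * crd i v).
    by apply: smoothEM; [exact: smoothE_base|exact: smoothE_cst].
  by move=> p; exact: is_derive_crd.
- exists (fun p => f' p + g' p); first exact: smoothED.
  by move=> p; exact: is_deriveD.
- exists (fun p => f p * g' p + g p * f' p); last first.
    by move=> p; exact: is_deriveM.
  by apply: smoothED; exact: smoothEM.
Qed.

Lemma pdE v f p : pd v f p = 'D_v f p.
Proof. by rewrite pd.unlock. Qed.

Lemma is_derive_pd f v p d : is_derive p v f d -> pd v f p = d.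
Proof. by rewrite pdE; case. Qed.

Lemma smoothE_pd f v : smoothE f -> smoothE (pd v f).
Proof.
move=> sf; have [f' sf' df] := smoothE_derive sf v.
by rewrite (_ : pd v f = f')//; apply/funext => p; exact: is_derive_pd.
Qed.

Lemma smoothE_is_derive f v p : smoothE f -> is_derive p v f (pd v f p).
Proof.
by move=> sf; have [f' sf' df] := smoothE_derive sf v; rewrite (is_derive_pd (df p)).
Qed.

Lemma smoothE_differentiable f p : smoothE f -> differentiable f p.
Proof.
elim => {f} [i f sf|f g _ ? _ ?|f g _ ? _ ?].
- apply: differentiable_comp; first exact: differentiable_crd.
  have [f' _ df] := smooth1_derive sf.
  by apply/derivable1_diffP; have [] := df (crd i p).
- exact: differentiableD.
- exact: differentiableM.
Qed.

Lemma smoothE_continuous f : smoothE f -> continuous f.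
Proof.
by move=> sf p; apply: differentiable_continuous; exact: smoothE_differentiable.
Qed.

Lemma measurable_crd i : measurable_fun [set: mE] (crd i : mE -> R).
Proof.
case: i => [j|]; last exact: measurable_snd.
exact: (measurableT_comp (@measurable_coord R n j) measurable_fst).
Qed.

Lemma smoothE_measurable f : smoothE f -> measurable_fun [set: mE] (f : mE -> R).
Proof.
elim => {f} [i f sf|f g _ ? _ ?|f g _ ? _ ?].
- apply: (@measurableT_comp _ _ _ _ _ _ f); first exact: smooth1_measurable.
  exact: measurable_crd.
- exact: measurable_funD.
- exact: measurable_funM.
Qed.

Lemma pd_crd i (f f' : R -> R) v : (forall s : R, is_derive s 1 f (f' s)) ->
  pd v (fun p => f (crd i p)) = (fun p => f' (crd i p) * crd i v).
Proof. by move=> df; apply/funext => p; apply: is_derive_pd; exact: is_derive_crd. Qed.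

Lemma pdM f g v : smoothE f -> smoothE g ->
  pd v (fun p => f p * g p) = (fun p => f p * pd v g p + g p * pd v f p).
Proof.
move=> sf sg; apply/funext => p; apply: is_derive_pd.
exact: is_deriveM (smoothE_is_derive v p sf) (smoothE_is_derive v p sg).
Qed.

Lemma pdD f g v : smoothE f -> smoothE g ->
  pd v (fun p => f p + g p) = (fun p => pd v f p + pd v g p).
Proof.
move=> sf sg; apply/funext => p; apply: is_derive_pd.
exact: is_deriveD (smoothE_is_derive v p sf) (smoothE_is_derive v p sg).
Qed.

Lemma pd_cst c v : pd v (fun=> c) = fun=> 0.
Proof. by apply/funext => p; apply: is_derive_pd; exact: is_derive_cst. Qed.

(** Schwarz's theorem, which on the generated algebra is an identity between
    polynomials in the derivatives of the factors. *)
Lemma pd_comm f v w : smoothE f -> pd v (pd w f) = pd w (pd v f).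
Proof.
move=> sf; elim: f / sf v w => [i f sf|f g sf hf sg hg|f g sf hf sg hg] v w.
- have [f' sf' df] := smooth1_derive sf.
  have [f'' sf'' df'] := smooth1_derive sf'.
  have sb : smoothE (fun p => f' (crd i p)) by exact: smoothE_base.
  rewrite !(pd_crd _ _ df) !(pdM _ sb (smoothE_cst _)) !pd_cst !(pd_crd _ _ df').
  by apply/funext => p; ring.
- rewrite !(pdD _ sf sg) (pdD _ (smoothE_pd w sf) (smoothE_pd w sg)).
  by rewrite (pdD _ (smoothE_pd v sf) (smoothE_pd v sg)) (hf v w) (hg v w).
- have E2 u1 u2 : pd u1 (pd u2 (fun p => f p * g p)) = (fun p =>
      f p * pd u1 (pd u2 g) p + pd u2 g p * pd u1 f p +
      (g p * pd u1 (pd u2 f) p + pd u2 f p * pd u1 g p)).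
    have sf' := smoothE_pd u2 sf; have sg' := smoothE_pd u2 sg.
    rewrite (pdM _ sf sg) (pdD _ (smoothEM sf sg') (smoothEM sg sf')).
    by rewrite (pdM _ sf sg') (pdM _ sg sf').
  by rewrite !E2 (hf v w) (hg v w); apply/funext => p; ring.
Qed.

(** Bounded support, in a form that sums, products and derivatives visibly preserve. *)
Definition boxed (N : R) f := forall p i, N < `|crd i p| -> f p = 0.

Lemma boxed_pd N f v : boxed N f -> boxed N (pd v f).
Proof.
move=> bf p i Np.
have : is_derive p v f 0.
  apply: (@near_eq_is_derive _ _ _ (fun=> 0)).
    near=> q; rewrite (bf q i)//; near: q.
    have : (fun q : E => `|crd i q|) @ p --> `|crd i p|.
      apply: cvg_norm; exact: differentiable_continuous (differentiable_crd i p).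
    by move=> /cvgr_gt; apply.
exact: is_derive_pd.
Unshelve. all: end_near. Qed.

Definition cbox (N : R) : set E := [set p | forall i, `|crd i p| <= N].

Lemma compact_cbox N : compact (cbox N).
Proof.
rewrite (_ : cbox N =
    [set x : 'rV[R]_n | forall i, `[- N, N]%classic (x ord0 i)] `*` `[- N, N]%classic).
  apply: compact_setX; last exact: segment_compact.
  by apply: (@rV_compact _ _ (fun=> `[- N, N]%classic)) => i; exact: segment_compact.
apply/seteqP; split => [p pN|p [/= xN tN] [i|]] /=.
- split => [i|]; rewrite /= in_itv/= -ler_norml.
    exact: (pN (Some i)).
  exact: (pN None).
- by have := xN i; rewrite in_itv/= -ler_norml.
- by move: tN; rewrite in_itv/= -ler_norml.
Qed.

Lemma cboxN N p : ~ cbox N p -> exists i, N < `|crd i p|.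
Proof.
by move=> /existsNP[i /negP]; rewrite -ltNge; exists i.
Qed.

(** By compactness of the box. *)
Lemma boxed_bounded N f : smoothE f -> boxed N f -> exists C, forall p, `|f p| <= C.
Proof.
move=> sf bf.
have /compact_bounded[M [_ HM]] : compact (f @` cbox N).
  apply: continuous_compact; last exact: compact_cbox.
  by apply: continuous_subspaceT => p; exact: smoothE_continuous.
have {}HM p : cbox N p -> `|f p| <= M + 1 by move=> Np; apply: HM; [rewrite ltrDl|exists p].
exists `|M + 1| => p; have [Np|/cboxN[i Np]] := pselect (cbox N p).
  by rewrite (le_trans (HM p Np))// ler_norm.
by rewrite (bf p i Np) normr0.
Qed.

Lemma smoothE_test N f : smoothE f -> boxed N f -> test_function f.
Proof.
move=> sf bf; split.
  move=> vs p; apply: smoothE_differentiable.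
  rewrite (_ : iter_derive f vs = foldr (@pd R n) f vs).
    by elim: vs => //= v vs; exact: smoothE_pd.
  by elim: vs => //= v vs ->; apply/funext => q; rewrite pdE.
have cN : closed (cbox N).
  by apply: compact_closed; [exact: norm_hausdorff|exact: compact_cbox].
apply: (@subclosed_compact _ _ (cbox N)).
- exact: closed_closure.
- exact: compact_cbox.
- rewrite ((closure_id (cbox N)).1 cN); apply: closureS => p /=.
  by apply: contraNP => /cboxN[i Np]; rewrite (bf p i Np) eqxx.
Qed.

Lemma crdB i p q : crd i (p - q) = crd i p - crd i q.
Proof. by case: i => [j|] /=; rewrite ?mxE. Qed.

Lemma smoothE_shift q f : smoothE f -> smoothE (fun p => f (p - q)).
Proof.
elim => {f} [i f sf|f g _ ? _ ?|f g _ ? _ ?].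
- under eq_fun do rewrite crdB -[crd i _]mul1r.
  exact: (smoothE_base i (smooth1_affine 1 (- crd i q) sf)).
- exact: smoothED.
- exact: smoothEM.
Qed.

Lemma smoothE_reflect q f : smoothE f -> smoothE (fun p => f (q - p)).
Proof.
elim => {f} [i f sf|f g _ ? _ ?|f g _ ? _ ?].
- under eq_fun do rewrite crdB addrC -mulN1r.
  exact: (smoothE_base i (smooth1_affine (-1) (crd i q) sf)).
- exact: smoothED.
- exact: smoothEM.
Qed.

Lemma pd_shift q f v : smoothE f ->
  pd v (fun p => f (p - q)) = (fun p => pd v f (p - q)).
Proof.
elim => {f} [i f sf|f g sf hf sg hg|f g sf hf sg hg].
- have [f' sf' df] := smooth1_derive sf.
  rewrite (pd_crd _ _ df).
  rewrite (_ : (fun p => f (crd i (p - q))) =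
      (fun p => (fun s => f (1 * s + - crd i q)) (crd i p))); last first.
    by apply/funext => r; rewrite crdB mul1r.
  rewrite (pd_crd _ _ (fun s => is_derive_affine (df (1 * s + - crd i q)))).
  by apply/funext => p; rewrite crdB mul1r mulr1.
- rewrite (pdD _ (smoothE_shift q sf) (smoothE_shift q sg)) (pdD _ sf sg) hf hg.
  by [].
- rewrite (pdM _ (smoothE_shift q sf) (smoothE_shift q sg)) (pdM _ sf sg) hf hg.
  by [].
Qed.

Lemma pd_reflect q f v : smoothE f ->
  pd v (fun p => f (q - p)) = (fun p => - pd v f (q - p)).
Proof.
elim => {f} [i f sf|f g sf hf sg hg|f g sf hf sg hg].
- have [f' sf' df] := smooth1_derive sf.
  rewrite (pd_crd _ _ df).
  rewrite (_ : (fun p => f (crd i (q - p))) =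
      (fun p => (fun s => f (-1 * s + crd i q)) (crd i p))); last first.
    by apply/funext => r; rewrite crdB; congr f; ring.
  rewrite (pd_crd _ _ (fun s => is_derive_affine (df (-1 * s + crd i q)))).
  apply/funext => p; rewrite crdB (_ : -1 * _ + _ = crd i q - crd i p); ring.
- have sr := smoothE_reflect q sf; have sr' := smoothE_reflect q sg.
  rewrite (pdD _ sr sr') (pdD _ sf sg) hf hg.
  by apply/funext => p; rewrite opprD.
- have sr := smoothE_reflect q sf; have sr' := smoothE_reflect q sg.
  rewrite (pdM _ sr sr') (pdM _ sf sg) hf hg.
  by apply/funext => p; ring.
Qed.

End SmoothE.

(** * Square integrable functions on space-time *)

Section SquareIntegrable.
Context {R : realType} {n : nat}.
Local Notation E := ('rV[R]_n * R)%type.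
Local Notation mE := ('rV[R]_n * measurableTypeR R)%type.
Local Notation leb := (@lebesgue_measure R).
Local Notation mu := (prodm (@leb_rV R n) leb).
Implicit Types (F G H : mE -> R).

Definition sqint F :=
  measurable_fun [set: mE] F /\ (\int[mu]_p (F p ^+ 2)%:E < +oo)%E.

Definition ip F G : R := \int[mu]_p (F p * G p).

Lemma sqint_le F G : measurable_fun [set: mE] F ->
  (forall p, F p ^+ 2 <= G p ^+ 2) -> sqint G -> sqint F.
Proof.
move=> mF FG [mG iG]; split => //; apply: le_lt_trans iG.
apply: ge0_le_integral => //.
- by move=> p _; rewrite lee_fin sqr_ge0.
- by apply/measurable_EFinP; exact: measurable_funX.
- by apply/measurable_EFinP; exact: measurable_funX.
- by move=> p _; rewrite lee_fin.
Qed.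

Lemma sqintZ c F : sqint F -> sqint (fun p => c * F p).
Proof.
move=> [mF iF]; split; first exact: measurable_funM.
under eq_integral do rewrite exprMn EFinM.
rewrite ge0_integralZl_EFin ?sqr_ge0//.
- by rewrite lte_mul_pinfty ?lee_fin ?sqr_ge0.
- by move=> p _; rewrite lee_fin sqr_ge0.
- by apply/measurable_EFinP; exact: measurable_funX.
Qed.

Lemma sqintD F G : sqint F -> sqint G -> sqint (fun p => F p + G p).
Proof.
move=> /(sqintZ 2) [mF iF] /(sqintZ 2) [mG iG]; move: (mF) (mG) => mF' mG'.
have m2 H : measurable_fun [set: mE] (fun p => 2 * H p) -> measurable_fun [set: mE] H.
  move=> mH; rewrite (_ : H = (fun p => 2^-1 * (2 * H p))); last first.
    by apply/funext => p; rewrite mulKf.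
  exact: measurable_funM.
have mX H : measurable_fun [set: mE] H ->
    measurable_fun [set: mE] (fun p => (H p ^+ 2)%:E).
  by move=> mH; apply/measurable_EFinP; exact: measurable_funX.
split; first by apply: measurable_funD; exact: m2.
apply: (@le_lt_trans _ _ (\int[mu]_p (((2 * F p) ^+ 2)%:E + ((2 * G p) ^+ 2)%:E))%E).
  apply: ge0_le_integral => //.
  - by move=> p _; rewrite lee_fin sqr_ge0.
  - by apply: mX; apply: measurable_funD; exact: m2.
  - by apply: emeasurable_funD; exact: mX.
  - move=> p _; rewrite -EFinD lee_fin -subr_ge0.
    rewrite (_ : _ - _ = (F p - G p) ^+ 2 + 2 * (F p) ^+ 2 + 2 * (G p) ^+ 2).
      by rewrite !addr_ge0// ?(mulr_ge0 (ler0n _ 2))// sqr_ge0.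
    by ring.
rewrite ge0_integralD//; try exact: mX; try by move=> p _; rewrite lee_fin sqr_ge0.
by rewrite lte_add_pinfty.
Qed.

Lemma sqint_sum (I : Type) (s : seq I) (F : I -> mE -> R) :
  (forall i, sqint (F i)) -> sqint (fun p => \sum_(i <- s) F i p).
Proof.
move=> sF; elim: s => [|i s IH].
  under eq_fun do rewrite big_nil; split => //.
  by under eq_integral do rewrite expr0n; rewrite integral0.
by under eq_fun do rewrite big_cons; exact: sqintD.
Qed.

Lemma sqintM (g F : mE -> R) (C : R) : measurable_fun [set: mE] g -> (forall p, `|g p| <= C) ->
  sqint F -> sqint (fun p => g p * F p).
Proof.
move=> mg gC sF; apply: (@sqint_le _ (fun p => C * F p)); last exact: sqintZ.
  by apply: measurable_funM => //; case: sF.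
move=> p; rewrite !exprMn ler_wpM2r ?sqr_ge0//.
by rewrite -real_normK ?num_real// lerXn2r ?nnegrE// (le_trans _ (gC p)).
Qed.

Lemma sqint_integrable F G : sqint F -> sqint G ->
  mu.-integrable [set: mE] (fun p => (F p * G p)%:E).
Proof.
move=> [mF iF] [mG iG].
have mX H : measurable_fun [set: mE] H ->
    measurable_fun [set: mE] (fun p => (H p ^+ 2)%:E).
  by move=> mH; apply/measurable_EFinP; exact: measurable_funX.
apply/integrableP; split.
  by apply/measurable_EFinP; exact: measurable_funM.
apply: (@le_lt_trans _ _ (\int[mu]_p ((F p ^+ 2)%:E + (G p ^+ 2)%:E))%E).
  apply: ge0_le_integral => //.
  - apply: measurableT_comp => //.
    by apply/measurable_EFinP; exact: measurable_funM.
  - by apply: emeasurable_funD; exact: mX.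
  - move=> p _; rewrite -EFinD lee_fin ler_norml -subr_ge0 opprK -[X in _ && X]subr_ge0.
    have -> : F p * G p + (F p ^+ 2 + G p ^+ 2) =
      ((F p + G p) ^+ 2 + F p ^+ 2 + G p ^+ 2) / 2 by field.
    have -> : F p ^+ 2 + G p ^+ 2 - F p * G p =
      ((F p - G p) ^+ 2 + F p ^+ 2 + G p ^+ 2) / 2 by field.
    by rewrite !divr_ge0 ?addr_ge0 ?sqr_ge0.
rewrite ge0_integralD//; try exact: mX; try by move=> p _; rewrite lee_fin sqr_ge0.
by rewrite lte_add_pinfty.
Qed.

Lemma ipC F G : ip F G = ip G F.
Proof. by apply: eq_Rintegral => p _; rewrite mulrC. Qed.

Lemma ipD F G H : sqint F -> sqint G -> sqint H ->
  ip (fun p => F p + G p) H = ip F H + ip G H.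
Proof.
move=> sF sG sH; rewrite /ip -RintegralD//; try exact: sqint_integrable.
by apply: eq_Rintegral => p _; rewrite mulrDl.
Qed.

Lemma ipZ c F H : sqint F -> sqint H -> ip (fun p => c * F p) H = c * ip F H.
Proof.
move=> sF sH; rewrite /ip -RintegralZl//; last exact: sqint_integrable.
by apply: eq_Rintegral => p _; rewrite mulrA.
Qed.

Lemma ip_sum (I : Type) (s : seq I) (F : I -> mE -> R) H :
  (forall i, sqint (F i)) -> sqint H ->
  ip (fun p => \sum_(i <- s) F i p) H = \sum_(i <- s) ip (F i) H.
Proof.
move=> sF sH; elim: s => [|i s IH].
  rewrite big_nil /ip; under eq_Rintegral do rewrite big_nil mul0r.
  by rewrite Rintegral_cst// mul0r.
rewrite big_cons -IH -ipD//; last exact: sqint_sum.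
by apply: eq_Rintegral => p _; rewrite big_cons.
Qed.

(** Moves factors from one side of the pairing to the other. *)
Lemma eq_ip F G F' G' : (forall p, F p * G p = F' p * G' p) -> ip F G = ip F' G'.
Proof. by move=> e; apply: eq_Rintegral => p _; exact: e. Qed.

Lemma ip_ge0 F : 0 <= ip F F.
Proof. by apply: Rintegral_ge0 => p _; rewrite -expr2 sqr_ge0. Qed.

Lemma le_ip F G F' G' : sqint F -> sqint G -> sqint F' -> sqint G' ->
  (forall p, F p * G p <= F' p * G' p) -> ip F G <= ip F' G'.
Proof. by move=> ? ? ? ? H; apply: le_Rintegral => //; exact: sqint_integrable. Qed.

Lemma ip_fin F : sqint F -> (ip F F)%:E = (\int[mu]_p (F p ^+ 2)%:E)%E.
Proof.
move=> [mF iF]; rewrite /ip /Rintegral fineK//.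
rewrite ge0_fin_numE//; apply: integral_ge0 => p _.
by rewrite lee_fin -expr2 sqr_ge0.
Qed.

Lemma ip_eq0 F : sqint F -> ip F F = 0 -> {ae mu, forall p, F p = 0}.
Proof.
move=> sF FF0.
have mF2 : measurable_fun [set: mE] (fun p => (F p ^+ 2)%:E).
  by apply/measurable_EFinP; apply: measurable_funX; case: sF.
have := (ae_eq_integral_abs mu measurableT mF2).1.
under eq_integral do rewrite gee0_abs ?lee_fin ?sqr_ge0//.
rewrite -ip_fin// FF0 => /(_ erefl); apply: filterS => p /(_ I) [].
by move/eqP; rewrite sqrf_eq0 => /eqP.
Qed.

End SquareIntegrable.

(** * Weak derivatives and integration by parts *)

Section WeakDerivative.
Context {R : realType} {n : nat}.
Local Notation E := ('rV[R]_n * R)%type.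
Local Notation mE := ('rV[R]_n * measurableTypeR R)%type.
Local Notation leb := (@lebesgue_measure R).
Local Notation mu := (prodm (@leb_rV R n) leb).
Implicit Types (F G H : mE -> R) (k : E -> R) (v w : E).

Definition window (N : R) : set mE := @ocube R n (N + 1) `*` `](- (N + 1)), (N + 1)]%classic.

Definition kernelE (m : nat) (z : mE * mE) : R :=
  prod_kernel (@kernel_rV R n m) (kernel1 m) z.

Definition mollE (m : nat) (p : E) : R :=
  (\prod_(i < n) moll m (crd (Some i) p)) * moll m (crd None p).

Lemma kernelE_mollE m (p q : E) : kernelE m (p, q) = mollE m (p - q).
Proof.
rewrite /kernelE /prod_kernel /kernel_rV /kernel1 /mollE /=; congr (_ * _).
by apply: eq_bigr => i _; rewrite !mxE.
Qed.

Lemma smoothE_mollE m : smoothE (mollE m).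
Proof.
apply: smoothEM; last exact: (smoothE_base None (smooth1_moll m)).
exact: smoothE_prod (fun i => smoothE_base (Some i) (smooth1_moll m)).
Qed.

Lemma boxed_mollE m : boxed 1 (mollE m).
Proof.
move=> p i p1; have m1 (s : R) : 1 < `|s| -> moll m s = 0.
  move=> s1; apply: moll_eq0; apply: le_trans (ltW s1).
  by rewrite invf_le1// ler1n.
case: i p1 => [i|] /m1 p1; last by rewrite /mollE p1 mulr0.
by rewrite /mollE (bigD1 i)//= -/(crd (Some i) p) p1 !mul0r.
Qed.

Lemma resolves_kernelE N : resolves mu kernelE (window N).
Proof. exact: resolves_prod (resolves_kernel_rV _ _) (resolves_kernel1 _ _). Qed.

Lemma window_boxed N F : boxed N F -> forall p, ~ window N p -> F p = 0.
Proof.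
move=> bF p nW; apply: contrapT => Fp; apply: nW.
have {}bF i : `|crd i p| <= N.
  by rewrite leNgt; apply/negP => /bF.
have lt (s : R) : `|s| <= N -> s \in `]- (N + 1), N + 1].
  by rewrite ler_norml in_itv/= => /andP[? ?]; apply/andP; split; lra.
split => [i|] /=; first exact/lt/(bF (Some i)).
exact/lt/(bF None).
Qed.

(** Square integrable with bounded support: such functions are integrable, and
    coordinates act on them. *)
Definition sqintc F := sqint F /\ exists N, boxed N F.

Lemma sqintcD F G : sqintc F -> sqintc G -> sqintc (fun p => F p + G p).
Proof.
move=> [sF [N bF]] [sG [M bG]]; split; first exact: sqintD.
exists (Num.max N M) => p i; rewrite gt_max => /andP[Np Mp].
by rewrite (bF p i Np) (bG p i Mp) addr0.
Qed.

Lemma sqintcZ c F : sqintc F -> sqintc (fun p => c * F p).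
Proof.
move=> [sF [N bF]]; split; first exact: sqintZ.
by exists N => p i Np; rewrite (bF p i Np) mulr0.
Qed.

Lemma sqintc_sum (I : Type) (s : seq I) (F : I -> mE -> R) :
  (forall i, sqintc (F i)) -> sqintc (fun p => \sum_(i <- s) F i p).
Proof.
move=> sF; elim: s => [|i s IH].
  under eq_fun do rewrite big_nil.
  split; last by exists 0.
  by split => //; under eq_integral do rewrite expr0n; rewrite integral0.
by under eq_fun do rewrite big_cons; exact: sqintcD.
Qed.

Lemma window_fin N : (mu (window N) < +oo)%E.
Proof. by have [] := resolves_kernelE N. Qed.

Lemma measurable_window N : measurable (window N).
Proof. by have [] := resolves_kernelE N. Qed.

Lemma smoothE_sqintc k N : smoothE k -> boxed N k -> sqintc k.
Proof.
move=> sk bk; split; last by exists N.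
have mk := smoothE_measurable sk; have [C kC] := boxed_bounded sk bk.
split => //.
apply: (@le_lt_trans _ _ (\int[mu]_p ((C ^+ 2)%:E * (\1_(window N) p)%:E))%E).
  apply: ge0_le_integral => //.
  - by move=> p _; rewrite lee_fin sqr_ge0.
  - by apply/measurable_EFinP; exact: measurable_funX.
  - apply: measurable_funeM; apply/measurable_EFinP; apply: measurable_indic.
    exact: measurable_window.
  - move=> p _; rewrite -EFinM lee_fin indicE.
    have [Wp|nW] := pselect (window N p).
      rewrite mem_set// mulr1 -real_normK ?num_real// lerXn2r ?nnegrE//.
      exact: le_trans (kC p).
    by rewrite (window_boxed bk nW) expr0n mulr_ge0// sqr_ge0.
rewrite ge0_integralZl_EFin ?sqr_ge0//; last first.
  apply/measurable_EFinP; apply: measurable_indic; exact: measurable_window.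
rewrite integral_indic ?setIT//; last exact: measurable_window.
by rewrite lte_mul_pinfty ?lee_fin ?sqr_ge0// window_fin.
Qed.

Lemma sqintc_integrable F : sqintc F -> mu.-integrable [set: mE] (EFin \o F).
Proof.
move=> [sF [N bF]].
have sW : sqint (\1_(window N) : mE -> R).
  split; first by apply: measurable_indic; exact: measurable_window.
  rewrite (_ : (fun p => _) = (fun p : mE => (\1_(window N) p)%:E)); last first.
    by apply/funext => p; rewrite indicE; case: (_ \in _); rewrite ?expr1n ?expr0n.
  by rewrite integral_indic ?setIT ?window_fin//; exact: measurable_window.
rewrite (_ : EFin \o F = (fun p => (F p * \1_(window N) p)%:E)).
  exact: sqint_integrable.
apply/funext => p /=; rewrite indicE; have [Wp|nW] := pselect (window N p).
  by rewrite mem_set// mulr1.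
by rewrite (window_boxed bF nW) mul0r.
Qed.

(** Weak differentiability, tested against [smoothE] functions of bounded support
    only: they include the mollifiers and are stable under the products that
    arise. *)
Definition wder v F G := forall k, smoothE k -> (exists N, boxed N k) ->
  ip F (pd v k) = - ip G k.

Lemma wderD v F F' G G' : sqint F -> sqint F' -> sqint G -> sqint G' ->
  wder v F F' -> wder v G G' ->
  wder v (fun p => F p + G p) (fun p => F' p + G' p).
Proof.
move=> sF sF' sG sG' wF wG k sk bk; have [N bN] := bk.
have [? _] := smoothE_sqintc sk bN.
have [? _] := smoothE_sqintc (smoothE_pd v sk) (boxed_pd v bN).
by rewrite !ipD// wF// wG// opprD.
Qed.

Lemma boxedM N k F : boxed N F -> boxed N (fun p => k p * F p).
Proof. by move=> bF p i Np; rewrite (bF p i Np) mulr0. Qed.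

(** The cutoff of a smooth factor: a smooth function agrees on a box with a
    smooth function of bounded support. *)
Definition cutoff (N : R) (p : E) : R :=
  (\prod_(i < n) (step (1 * crd (Some i) p + (N + 2)) * step (-1 * crd (Some i) p + (N + 2)))) *
  (step (1 * crd None p + (N + 2)) * step (-1 * crd None p + (N + 2))).

Lemma smoothE_cutoff N : smoothE (cutoff N).
Proof.
have s (i : option 'I_n) : smoothE (fun p => step (1 * crd i p + (N + 2)) * step (-1 * crd i p + (N + 2))).
  exact: smoothEM (smoothE_base i (smooth1_affine 1 (N + 2) smooth1_step))
    (smoothE_base i (smooth1_affine (-1) (N + 2) smooth1_step)).
have sp := smoothE_prod (index_enum _) (fun i : 'I_n => s (Some i)).
exact: (smoothEM sp (s None)).
Qed.

Lemma cutoff1 N p : (forall i, `|crd i p| <= N) -> cutoff N p = 1.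
Proof.
move=> pN; have s (i : option 'I_n) :
    step (1 * crd i p + (N + 2)) * step (-1 * crd i p + (N + 2)) = 1.
  have := pN i; rewrite ler_norml => /andP[? ?].
  by rewrite !step_1 ?mulr1//; lra.
by rewrite /cutoff (s None) mulr1 big1// => i _; exact: (s (Some i)).
Qed.

Lemma boxed_cutoff N : boxed (N + 3) (cutoff N).
Proof.
move=> p i; have s (t : R) : N + 3 < `|t| ->
    step (1 * t + (N + 2)) * step (-1 * t + (N + 2)) = 0.
  rewrite ltr_normr => /orP[?|?].
    by rewrite [X in _ * X]step_0 ?mulr0//; lra.
  by rewrite step_0 ?mul0r//; lra.
case: i => [i|] /s p1; last by rewrite /cutoff p1 mulr0.
by rewrite /cutoff (bigD1 i)//= -/(crd (Some i) p) p1 !mul0r.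
Qed.

Lemma smoothE_sqintcM k F : smoothE k -> sqintc F -> sqintc (fun p => k p * F p).
Proof.
move=> sk [sF [N bF]]; split; last by exists N; exact: boxedM.
have sck : smoothE (fun p => k p * cutoff N p).
  by apply: smoothEM => //; exact: smoothE_cutoff.
have [C HC] := boxed_bounded sck (boxedM k (@boxed_cutoff N)).
rewrite (_ : (fun p => k p * F p) = (fun p => (k p * cutoff N p) * F p)).
  by apply: sqintM HC sF; exact: smoothE_measurable.
apply/funext => p; have [pN|/existsNP[i /negP]] := pselect (forall i, `|crd i p| <= N).
  by rewrite cutoff1// mulr1.
by rewrite -ltNge => Np; rewrite (bF p i Np) !mulr0.
Qed.

Lemma smoothE_boxed_sqint k N F :
  smoothE k -> boxed N k -> sqint F -> sqintc (fun p => k p * F p).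
Proof.
move=> sk bk sF; have [C HC] := boxed_bounded sk bk; split.
  by apply: sqintM HC sF; exact: smoothE_measurable.
by exists N => p i Np; rewrite (bk p i Np) mul0r.
Qed.

Lemma ipMl k F G : ip (fun p => k p * F p) G = ip F (fun p => k p * G p).
Proof. by apply: eq_ip => p; ring. Qed.

(** Leibniz rule: the product of the smooth factor with a test function is again
    a test function. *)
Lemma wderM v k N F F' : smoothE k -> boxed N k -> sqint F -> sqint F' -> wder v F F' ->
  wder v (fun p => k p * F p) (fun p => pd v k p * F p + k p * F' p).
Proof.
move=> sk bk sF sF' wF h sh [M bh].
have sk' := smoothE_pd v sk; have bk' := boxed_pd v bk.
have sh' := smoothE_pd v sh; have bh' := boxed_pd v bh.
have [s1 _] := smoothE_sqintc sh bh.
have [s2 _] := smoothE_boxed_sqint sk' bk' sF.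
have [s3 _] := smoothE_boxed_sqint sk bk sF'.
have := wF _ (smoothEM sk sh) (ex_intro _ M (boxedM _ bh)).
have -> : pd v (fun p => k p * h p) = (fun p => k p * pd v h p + pd v k p * h p).
  by rewrite (pdM _ sk sh); apply/funext => p; rewrite [h p * _]mulrC.
have [s4 _] := smoothE_sqintc (smoothEM sk sh') (boxedM _ bh').
have [s5 _] := smoothE_sqintc (smoothEM sk' sh) (boxedM _ bh).
rewrite ipC ipD// ![ip _ F]ipC => H.
by rewrite ipD// !ipMl; move: H; lra.
Qed.

End WeakDerivative.

Section IntegrationByParts.
Context {R : realType} {n : nat}.
Local Notation E := ('rV[R]_n * R)%type.
Local Notation mE := ('rV[R]_n * measurableTypeR R)%type.
Local Notation leb := (@lebesgue_measure R).
Local Notation mu := (prodm (@leb_rV R n) leb).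
Local Notation mu2 := (mu \x mu)%E.
Implicit Types (F G H : mE -> R) (k : E -> R) (v w : E).

Let diffE (z : mE * mE) : mE := (z.1 : E) - z.2.

Let measurable_diffE : measurable_fun [set: mE * mE] diffE.
Proof.
have m1 : measurable_fun [set: mE * mE] (fun z => ((z.1 : E) - z.2).1).
  apply: measurable_fun_rV => i.
  rewrite (_ : (fun t => _) = (fun t : mE * mE => crd (Some i) t.1 - crd (Some i) t.2)).
    by apply: measurable_funB; apply: measurableT_comp (measurable_crd (Some i)) _.
  by apply/funext => t; rewrite /= !mxE.
have m2 : measurable_fun [set: mE * mE]
    (fun z => ((z.1 : E) - z.2).2 : measurableTypeR R).
  by apply: measurable_funB; apply: measurableT_comp (measurable_crd None) _.
exact: (measurable_fun_pair m1 m2).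
Qed.

(** Mollified pairing: derivatives of either factor can be thrown on the
    mollifier, so that no derivative of the product is ever needed. *)
Definition BF k F G : R := \int[mu2]_z (F z.1 * k ((z.1 : E) - z.2) * G z.2).

Let mBF k F G : smoothE k -> sqintc F -> sqintc G ->
  measurable_fun [set: mE * mE] (fun z => F z.1 * k ((z.1 : E) - z.2) * G z.2).
Proof.
move=> sk [[mF _] _] [[mG _] _].
apply: measurable_funM; last exact: measurableT_comp mG measurable_snd.
apply: measurable_funM; first exact: measurableT_comp mF measurable_fst.
exact: measurableT_comp (smoothE_measurable sk) measurable_diffE.
Qed.

Let iBF k F G : smoothE k -> (exists N, boxed N k) -> sqintc F -> sqintc G ->
  mu2.-integrable [set: mE * mE]
    (fun z => (F z.1 * k ((z.1 : E) - z.2) * G z.2)%:E).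
Proof.
move=> sk [N bk] cF cG.
have [C kC] := boxed_bounded sk bk.
have C0 : 0 <= C by exact: le_trans (kC 0).
have mf : measurable_fun [set: mE * mE]
    (fun z => (F z.1 * k ((z.1 : E) - z.2) * G z.2)%:E).
  by apply/measurable_EFinP; exact: mBF.
have /integrableP[mF iF] := sqintc_integrable cF.
have /integrableP[mG iG] := sqintc_integrable cG.
have mnF : measurable_fun [set: mE] (fun p => `|(F p)%:E|%E) by exact: measurableT_comp.
have mnG : measurable_fun [set: mE] (fun p => `|(G p)%:E|%E) by exact: measurableT_comp.
apply/integrableP; split => //.
apply: (@le_lt_trans _ _ (\int[mu2]_z (C%:E * (`|(F z.1)%:E| * `|(G z.2)%:E|)))%E).
  have mFG : measurable_fun [set: mE * mE] (fun z => `|(F z.1)%:E| * `|(G z.2)%:E|)%E.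
    apply: emeasurable_funM.
      exact: measurableT_comp mnF measurable_fst.
    exact: measurableT_comp mnG measurable_snd.
  apply: ge0_le_integral => //.
  - exact: measurableT_comp.
  - exact: measurable_funeM.
  - move=> z _; rewrite /= -!EFinM lee_fin !normrM mulrAC mulrC.
    by rewrite ler_wpM2r// mulr_ge0.
rewrite ge0_integralZl_EFin//.
- apply: lte_mul_pinfty; rewrite ?lee_fin//.
  rewrite fubini_tonelli1//; last first.
    apply: emeasurable_funM.
      exact: measurableT_comp mnF measurable_fst.
    exact: measurableT_comp mnG measurable_snd.
  rewrite /fubini_F /=.
  under eq_integral => p _ do rewrite ge0_integralZl//.
  rewrite ge0_integralZr//; last exact: integral_ge0.
  by apply: lte_mul_pinfty => //; rewrite ?integral_ge0// ge0_fin_numE// integral_ge0.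
- apply: emeasurable_funM.
    exact: measurableT_comp mnF measurable_fst.
  exact: measurableT_comp mnG measurable_snd.
Qed.

Let slice (f : mE -> R) c : mu.-integrable [set: mE] (EFin \o f) ->
  (\int[mu]_p (c * f p)%:E)%E = (c * \int[mu]_p f p)%:E.
Proof.
move=> If; rewrite -RintegralZl// /Rintegral fineK//.
by apply: integrable_fin_num => //; under eq_fun do rewrite EFinM; exact: integrableZl.
Qed.

Let crd_sum (i : option 'I_n) (q : E) :
  `|crd i q| <= \sum_(j : option 'I_n) `|crd j q|.
Proof. by rewrite (bigD1 i)//= lerDl sumr_ge0. Qed.

Lemma boxed_shift q k : (exists N, boxed N k) -> exists N, boxed N (fun p => k (p - q)).
Proof.
move=> [N bk]; exists (N + \sum_(j : option 'I_n) `|crd j q|) => p i Np.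
apply: (bk _ i); rewrite crdB.
have := ler_normB (crd i p - crd i q) (- crd i q); rewrite opprK subrK normrN.
by have := crd_sum i q; lra.
Qed.

Lemma boxed_reflect q k : (exists N, boxed N k) -> exists N, boxed N (fun p => k (q - p)).
Proof.
move=> [N bk]; exists (N + \sum_(j : option 'I_n) `|crd j q|) => p i Np.
apply: (bk _ i); rewrite crdB distrC.
have := ler_normB (crd i p - crd i q) (- crd i q); rewrite opprK subrK normrN.
by have := crd_sum i q; lra.
Qed.

Lemma BF_left k F G : smoothE k -> (exists N, boxed N k) -> sqintc F -> sqintc G ->
  BF k F G = \int[mu]_q (G q * ip F (fun p => k ((p : E) - q))).
Proof.
move=> sk bk cF cG; rewrite /BF /Rintegral; congr fine.
rewrite -(integral21_prod_meas1 (iBF sk bk cF cG)) /fubini_G.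
apply: eq_integral => q _ /=; rewrite /ip -slice; last first.
  have [N bq] := boxed_shift q bk.
  have [sq _] := smoothE_sqintc (smoothE_shift q sk) bq.
  exact: sqint_integrable cF.1 sq.
by apply: eq_integral => p _; congr EFin; rewrite [RHS]mulrC.
Qed.

Lemma BF_right k F G : smoothE k -> (exists N, boxed N k) -> sqintc F -> sqintc G ->
  BF k F G = \int[mu]_p (F p * ip G (fun q => k ((p : E) - q))).
Proof.
move=> sk bk cF cG; rewrite /BF /Rintegral; congr fine.
rewrite -(integral12_prod_meas1 (iBF sk bk cF cG)) /fubini_F.
apply: eq_integral => p _ /=; rewrite /ip -slice; last first.
  have [N bq] := boxed_reflect p bk.
  have [sq _] := smoothE_sqintc (smoothE_reflect p sk) bq.
  exact: sqint_integrable cG.1 sq.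
by apply: eq_integral => q _; congr EFin; rewrite -mulrA [X in _ * X]mulrC.
Qed.

Lemma BF_wderl k v F F' G : smoothE k -> (exists N, boxed N k) ->
  sqintc F -> sqintc F' -> sqintc G -> wder v F F' ->
  BF k F' G = - BF (pd v k) F G.
Proof.
move=> sk bk cF cF' cG wF.
have sk' := smoothE_pd v sk.
have bk' : exists N, boxed N (pd v k) by case: bk => N bN; exists N; exact: boxed_pd.
transitivity (BF (fun p => -1 * pd v k p) F G); last first.
  rewrite -[RHS]mulN1r /BF -RintegralZl//; last exact: iBF.
  by apply: eq_Rintegral => z _; rewrite !mulN1r mulrN mulNr.
have bk'' : exists N, boxed N (fun p => -1 * pd v k p).
  by case: bk' => N bN; exists N; exact: boxedM.
rewrite (BF_left sk bk cF' cG) (BF_left (smoothEZ _ sk') bk'' cF cG).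
apply: eq_Rintegral => q _; congr (_ * _).
apply: oppr_inj; rewrite -(wF _ (smoothE_shift q sk) (boxed_shift q bk)).
rewrite (pd_shift q v sk).
have [N bq] := boxed_shift q bk'.
have [sq _] := smoothE_sqintc (smoothE_shift q sk') bq.
have e := ipZ (-1) sq cF.1.
by rewrite ipC [X in _ = - X]ipC e mulN1r opprK.
Qed.

Lemma BF_wderr k v F G G' : smoothE k -> (exists N, boxed N k) ->
  sqintc F -> sqintc G -> sqintc G' -> wder v G G' ->
  BF k F G' = BF (pd v k) F G.
Proof.
move=> sk bk cF cG cG' wG.
have sk' := smoothE_pd v sk.
have bk' : exists N, boxed N (pd v k) by case: bk => N bN; exists N; exact: boxed_pd.
rewrite (BF_right sk bk cF cG') (BF_right sk' bk' cF cG).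
apply: eq_Rintegral => p _; congr (_ * _).
apply: oppr_inj; rewrite -(wG _ (smoothE_reflect p sk) (boxed_reflect p bk)).
rewrite (pd_reflect p v sk).
have [N bq] := boxed_reflect p bk'.
have [sq _] := smoothE_sqintc (smoothE_reflect p sk') bq.
rewrite -mulN1r [in RHS]ipC -ipZ//; last by case: cG.
by rewrite ipC; apply: eq_ip => q; rewrite mulN1r.
Qed.

Let bk m := let: And4 b _ _ _ := @resolves_kernelE R n 0 in b m.

Let diag m H : mu.-integrable [set: mE] (EFin \o H) ->
  mu2.-integrable [set: mE * mE] (fun z => (kernelE m z * H z.2)%:E) /\
  \int[mu2]_z (kernelE m z * H z.2) = \int[mu]_q H q.
Proof.
move=> iH; have /integrableP[mH fH] := iH; have [mk k0 _ k1] := bk m.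
have mkp q : measurable_fun [set: mE] (fun p => (kernelE m (p, q))%:E).
  by apply/measurable_EFinP; exact: measurable_fun_pair1 mk.
have mkH : measurable_fun [set: mE * mE] (fun z => (kernelE m z * H z.2)%:E).
  apply/measurable_EFinP; apply: (measurable_funM mk).
  have mH' : measurable_fun [set: mE] H by exact/measurable_EFinP.
  exact: (measurableT_comp mH' measurable_snd).
have IkH : mu2.-integrable [set: mE * mE] (fun z => (kernelE m z * H z.2)%:E).
  apply/integrableP; split => //; rewrite fubini_tonelli2//; last first.
    exact: measurableT_comp.
  rewrite (_ : (fun q => _) = (fun q => `|(H q)%:E|%E))//; apply/funext => q.
  rewrite /fubini_G /=.
  under eq_integral do rewrite normrM mulrC EFinM (ger0_norm (k0 _)).
  rewrite ge0_integralZl_EFin ?k1 ?mule1//.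
  by move=> p _; rewrite lee_fin.
split=> //; rewrite /Rintegral -(integral21_prod_meas1 IkH); congr fine.
apply: eq_integral => q _; rewrite /fubini_G /=.
under eq_integral do rewrite mulrC EFinM.
rewrite integralZl ?k1 ?mule1//.
by apply/integrableP; split => //; under eq_integral do rewrite gee0_abs ?lee_fin//;
  rewrite k1 ltry.
Qed.

(** The mollified pairing differs from the pairing by the integral of
    k (F p - F q) G q; Young's inequality with a large weight [l] splits it into
    a vanishing energy and a small multiple of the norm of [G]. *)
Let BF_dist m F G (l : R) : sqintc F -> sqintc G -> 0 < l ->
  (`|BF (mollE m) F G - ip F G|%:E <=
    l%:E * energy mu (kernelE m) F + (l^-1 * ip G G)%:E)%E.
Proof.
move=> cF cG l0; have [mk k0 _ k1] := bk m.
have bm : exists N, boxed N (@mollE R n m) by exists 1; exact: boxed_mollE.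
have IB := iBF (smoothE_mollE m) bm cF cG.
have [ID FGE] := diag m (sqint_integrable cF.1 cG.1).
have {FGE} -> : ip F G = \int[mu2]_z (kernelE m z * (F z.2 * G z.2)) by rewrite FGE.
have [IG iGG] := diag m (sqint_integrable cG.1 cG.1).
rewrite /BF -RintegralB// EFin_normr_Rintegral//; last first.
  exact: (integrableB measurableT IB ID).
have mF : measurable_fun [set: mE] F by case: cF => -[].
have mG : measurable_fun [set: mE] G by case: cG => -[].
have mE1 := measurable_energy_integrand (bk m) mF.
have /integrableP[mIG _] := IG.
have /integrableP[mIB _] := IB.
have /integrableP[mID _] := ID.
have mBD : measurable_fun [set: mE * mE] (fun z =>
    (F z.1 * mollE m ((z.1 : E) - z.2) * G z.2 -
     kernelE m z * (F z.2 * G z.2))%:E).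
  exact: (emeasurable_funB mIB mID).
apply: le_trans (le_abse_integral _ _ _) _ => //.
apply: (@le_trans _ _ (\int[mu2]_z (l%:E * (kernelE m z * (F z.1 - F z.2) ^+ 2)%:E +
    l^-1%:E * (kernelE m z * (G z.2 * G z.2))%:E))%E).
  apply: ge0_le_integral => //.
  - exact: measurableT_comp.
  - by apply: emeasurable_funD; exact: measurable_funeM.
  - move=> [p q] _ /=; rewrite -!EFinM -EFinD lee_fin -kernelE_mollE.
    have -> : F p * kernelE m (p, q) * G q - kernelE m (p, q) * (F q * G q) =
      kernelE m (p, q) * ((F p - F q) * G q) by ring.
    rewrite normrM (ger0_norm (k0 _)).
    have -> : l * (kernelE m (p, q) * (F p - F q) ^+ 2) +
      l^-1 * (kernelE m (p, q) * (G q * G q)) =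
      kernelE m (p, q) * (l * (F p - F q) ^+ 2 + l^-1 * (G q * G q)) by ring.
    rewrite ler_wpM2l//.
    move: (F p - F q) (G q) => x y; rewrite -(@ler_pM2l _ l)//.
    have -> : l * (l * x ^+ 2 + l^-1 * (y * y)) = (l * x) ^+ 2 + y ^+ 2.
      by field; rewrite gt_eqF.
    rewrite -{1}(ger0_norm (ltW l0)) -normrM mulrA.
    move: (l * x) => t; rewrite ler_norml; apply/andP; split.
      by have := sqr_ge0 (t + y); have := sqr_ge0 t; have := sqr_ge0 y; nra.
    by have := sqr_ge0 (t - y); have := sqr_ge0 t; have := sqr_ge0 y; nra.
have e0 z : (0 <= (kernelE m z * (F z.1 - F z.2) ^+ 2)%:E)%E.
  by rewrite lee_fin mulr_ge0// sqr_ge0.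
have g0 z : (0 <= (kernelE m z * (G z.2 * G z.2))%:E)%E.
  by rewrite lee_fin mulr_ge0// -expr2 sqr_ge0.
rewrite ge0_integralD//; last 4 first.
- by move=> z _; rewrite mule_ge0// lee_fin ltW.
- exact: measurable_funeM.
- by move=> z _; rewrite mule_ge0// lee_fin invr_ge0 ltW.
- exact: measurable_funeM.
rewrite ge0_integralZl_EFin ?(ltW l0)// ge0_integralZl_EFin ?invr_ge0 ?(ltW l0)//.
rewrite leeD2l// EFinM lee_wpmul2l ?lee_fin ?invr_ge0 ?(ltW l0)//.
rewrite -[X in (_ <= X%:E)%E]iGG /Rintegral fineK//.
exact: integrable_fin_num.
Qed.

Lemma BF_cvg F G : sqintc F -> sqintc G ->
  BF (mollE m) F G @[m --> \oo] --> ip F G.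
Proof.
move=> cF cG; apply/cvgrPdist_le => e e0.
have G0 := ip_ge0 G.
(* The term ip G G / l of [BF_dist] is then less than e / 2. *)
pose l := (ip G G + 1) * (e / 2)^-1.
have l0 : 0 < l by rewrite mulr_gt0 ?invr_gt0 ?divr_gt0// ltr_wpDl.
have [[mF iF] [N bF]] := cF.
have v := vanishing_energy_sqint (resolves_kernelE N) mF (window_boxed bF) iF.
have e2 : 0 < e / 2 / l by apply: divr_gt0 => //; exact: divr_gt0.
apply: filterS (v _ e2) => m vm; rewrite distrC -lee_fin.
apply: le_trans (BF_dist m cF cG l0) _.
rewrite [e]splitr EFinD leeD//.
  apply: le_trans (lee_wpmul2l _ vm) _; first by rewrite lee_fin ltW.
  by rewrite -EFinM lee_fin mulrCA mulfV ?mulr1// gt_eqF.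
rewrite lee_fin ler_pdivrMl//.
have -> : l * (e / 2) = ip G G + 1.
  by rewrite /l -mulrA mulVf ?mulr1// gt_eqF// divr_gt0.
by rewrite lerDl.
Qed.

(** Both sides are limits of the same mollified pairing, in which the derivative
    has been thrown on the mollifier from either factor. *)
Lemma wder_ibp v F F' G G' : sqintc F -> sqintc F' -> sqintc G -> sqintc G' ->
  wder v F F' -> wder v G G' -> ip F' G = - ip F G'.
Proof.
move=> cF cF' cG cG' wF wG.
have bm m : exists N, boxed N (@mollE R n m) by exists 1; exact: boxed_mollE.
have c1 := BF_cvg cF' cG.
have c2 : - BF (mollE m) F G' @[m --> \oo] --> - ip F G'.
  by apply: cvgN; exact: BF_cvg.
have e : (fun m => BF (@mollE R n m) F' G) = (fun m => - BF (mollE m) F G').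
  apply/funext => m; rewrite (BF_wderl (smoothE_mollE m) (bm m) cF cF' cG wF).
  by rewrite (BF_wderr (smoothE_mollE m) (bm m) cF cG cG' wG).
move: c1; rewrite e => c1.
exact: (@cvg_unique _ (@Rhausdorff R) _ _ _ _ c1 c2).
Qed.

(** Two derivatives can be exchanged between the factors although neither mixed
    derivative exists: both pairings are mollified limits of the same form. *)
Lemma wder_exchange v w F Fv Fw G Gv Gw :
  sqintc F -> sqintc Fv -> sqintc Fw -> sqintc G -> sqintc Gv -> sqintc Gw ->
  wder v F Fv -> wder w F Fw -> wder v G Gv -> wder w G Gw ->
  ip Fv Gw = ip Fw Gv.
Proof.
move=> cF cFv cFw cG cGv cGw wFv wFw wGv wGw.
have bm m : exists N, boxed N (@mollE R n m) by exists 1; exact: boxed_mollE.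
have bp m u : exists N, boxed N (pd u (@mollE R n m)).
  by exists 1; apply: boxed_pd; exact: boxed_mollE.
have sm m : smoothE (@mollE R n m) by exact: smoothE_mollE.
have sp m u : smoothE (pd u (@mollE R n m)) by exact: smoothE_pd.
have c1 := BF_cvg cFv cGw; have c2 := BF_cvg cFw cGv.
have e : (fun m => BF (@mollE R n m) Fv Gw) = (fun m => BF (mollE m) Fw Gv).
  apply/funext => m.
  rewrite (BF_wderr (sm m) (bm m) cFv cG cGw wGw) (BF_wderl (sp m w) (bp m w) cF cFv cG wFv).
  rewrite (BF_wderr (sm m) (bm m) cFw cG cGv wGv) (BF_wderl (sp m v) (bp m v) cF cFw cG wFw).
  by rewrite (pd_comm _ _ (sm m)).
move: c1; rewrite e => c1.
exact: (@cvg_unique _ (@Rhausdorff R) _ _ _ _ c1 c2).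
Qed.

(** The mollified pairing of [F] with itself is an average of pairings of [F] with
    translated mollifiers, hence 0; its limit is the norm of [F]. *)
Lemma wder_unique0 F : sqintc F ->
  (forall k, smoothE k -> (exists N, boxed N k) -> ip F k = 0) ->
  {ae mu, forall p, F p = 0}.
Proof.
move=> cF F0; have sF := cF.1.
have bm m : exists N, boxed N (@mollE R n m) by exists 1; exact: boxed_mollE.
have FF0 : ip F F = 0.
  have e : (fun m => BF (@mollE R n m) F F) = (fun=> 0).
    apply/funext => m; rewrite (BF_left (smoothE_mollE m) (bm m) cF cF).
  under eq_Rintegral => q _.
      rewrite (F0 _ (smoothE_shift q (smoothE_mollE m)) (boxed_shift q (bm m))) mulr0.
      over.
    by rewrite Rintegral_cst// mul0r.
  have := BF_cvg cF cF; rewrite e => c0.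
  exact: (@cvg_unique _ (@Rhausdorff R) _ _ _ _ c0 (cvg_cst _)).
exact: ip_eq0 sF FF0.
Qed.

End IntegrationByParts.

(** * The Carleman inequality *)

Section Bilinear.
Context {R : realType} {n : nat}.
Local Notation mE := ('rV[R]_n * measurableTypeR R)%type.
Implicit Types (F G H : mE -> R).

Definition lin3 (a b c : R) F G H : mE -> R := fun p => a * F p + b * G p + c * H p.

Lemma sqint_lin3 a b c F G H :
  sqint F -> sqint G -> sqint H -> sqint (lin3 a b c F G H).
Proof. by move=> sF sG sH; apply: sqintD; [apply: sqintD|]; exact: sqintZ. Qed.

Lemma ip_lin3 a b c F G H K : sqint F -> sqint G -> sqint H -> sqint K ->
  ip (lin3 a b c F G H) K = a * ip F K + b * ip G K + c * ip H K.
Proof.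
move=> sF sG sH sK.
rewrite (ipD (sqintD (sqintZ a sF) (sqintZ b sG)) (sqintZ c sH) sK).
by rewrite (ipD (sqintZ a sF) (sqintZ b sG) sK) !ipZ.
Qed.

Lemma ip_lin33 a b c F G H a' b' c' F' G' H' :
  sqint F -> sqint G -> sqint H -> sqint F' -> sqint G' -> sqint H' ->
  ip (lin3 a b c F G H) (lin3 a' b' c' F' G' H') =
  a * (a' * ip F F' + b' * ip F G' + c' * ip F H') +
  b * (a' * ip G F' + b' * ip G G' + c' * ip G H') +
  c * (a' * ip H F' + b' * ip H G' + c' * ip H H').
Proof.
move=> sF sG sH sF' sG' sH'.
have s' := sqint_lin3 a' b' c' sF' sG' sH'.
rewrite (ip_lin3 _ _ _ sF sG sH s').
rewrite (ipC F) (ip_lin3 _ _ _ sF' sG' sH' sF) (ipC G) (ip_lin3 _ _ _ sF' sG' sH' sG).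
rewrite (ipC H) (ip_lin3 _ _ _ sF' sG' sH' sH).
by rewrite ![ip _ F]ipC ![ip _ G]ipC ![ip _ H]ipC.
Qed.

(** For operators, 4 <S f, A f> <= |(S + A) f|^2: only the cross term is kept. *)
Lemma ip_square F G : sqint F -> sqint G ->
  4 * ip F G <= ip (fun p => F p + G p) (fun p => F p + G p).
Proof.
move=> sF sG; rewrite -ipZ//; apply: le_ip => //.
- exact: sqintZ.
- exact: sqintD.
- exact: sqintD.
- move=> p; rewrite -subr_ge0 (_ : _ - _ = (F p - G p) ^+ 2) ?sqr_ge0//.
  by ring.
Qed.

End Bilinear.

Section Carleman.
Context {R : realType} {n : nat}.
Local Notation E := ('rV[R]_n * R)%type.
Local Notation mE := ('rV[R]_n * measurableTypeR R)%type.
Variable x0 : 'rV[R]_n.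

Definition ycrd (j : 'I_n) (p : E) : R := 1 * crd (Some j) p + (- x0 ord0 j).

Lemma smoothE_ycrd j : smoothE (ycrd j).
Proof. exact: (smoothE_base (Some j) (smooth1_affine 1 (- x0 ord0 j) smooth1_id)). Qed.

Lemma pd_ycrd j v : pd v (ycrd j) = fun=> crd (Some j) v.
Proof.
have d (s : R) : is_derive s 1 (fun s : R => 1 * s + - x0 ord0 j) (cst 1 s).
  have dd : is_derive s 1 (fun s : R => id (1 * s + - x0 ord0 j)) (1 * 1).
    by apply: (@is_derive_affine _ id); exact: is_derive_id.
  by apply: (is_derive_eq dd); rewrite mulr1.
have -> : ycrd j = (fun p => (fun s => 1 * s + - x0 ord0 j) (crd (Some j) p)) by [].
by rewrite (pd_crd _ _ d); apply/funext => p; rewrite /= mul1r.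
Qed.

Lemma crd_xdir (j k : 'I_n) : crd (Some j) (xdir R k) = (j == k)%:R.
Proof. by rewrite /= mxE eqxx. Qed.

Lemma crd_tdir (j : 'I_n) : crd (Some j) (tdir R n) = 0.
Proof. by rewrite /= mxE. Qed.

Lemma wderMc v (k : E -> R) (F F' : mE -> R) : smoothE k -> sqintc F -> sqintc F' ->
  wder v F F' ->
  wder v (fun p => k p * F p) (fun p => pd v k p * F p + k p * F' p).
Proof.
move=> sk cF cF' wF h sh [M bh].
have sk' := smoothE_pd v sk.
have sh' := smoothE_pd v sh; have bh' := boxed_pd v bh.
have [s1 _] := smoothE_sqintc sh bh.
have [s2 _] := smoothE_sqintcM sk' cF.
have [s3 _] := smoothE_sqintcM sk cF'.
have := wF _ (smoothEM sk sh) (ex_intro _ M (boxedM _ bh)).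
have -> : pd v (fun p => k p * h p) = (fun p => k p * pd v h p + pd v k p * h p).
  by rewrite (pdM _ sk sh); apply/funext => p; rewrite [h p * _]mulrC.
have [s4 _] := smoothE_sqintc (smoothEM sk sh') (boxedM _ bh').
have [s5 _] := smoothE_sqintc (smoothEM sk' sh) (boxedM _ bh).
have sF := cF.1; have sF' := cF'.1.
rewrite ipC ipD// ![ip _ F]ipC => H.
by rewrite ipD// !ipMl; move: H; lra.
Qed.

Lemma wder_ycrd (j k : 'I_n) (F F' : mE -> R) : sqintc F -> sqintc F' ->
  wder (xdir R k) F F' ->
  wder (xdir R k) (fun p => ycrd j p * F p) (fun p => (j == k)%:R * F p + ycrd j p * F' p).
Proof.
move=> cF cF' wF; have := wderMc (smoothE_ycrd j) cF cF' wF.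
by rewrite pd_ycrd crd_xdir.
Qed.

Lemma wder_ycrd_t (j : 'I_n) (F F' : mE -> R) : sqintc F -> sqintc F' ->
  wder (tdir R n) F F' ->
  wder (tdir R n) (fun p => ycrd j p * F p) (fun p => ycrd j p * F' p).
Proof.
move=> cF cF' wF; rewrite (_ : (fun p => ycrd j p * F' p) =
  (fun p => pd (tdir R n) (ycrd j) p * F p + ycrd j p * F' p)).
  exact: wderMc (smoothE_ycrd j) cF cF' wF.
by apply/funext => p; rewrite pd_ycrd crd_tdir mul0r add0r.
Qed.

(** The first order operator [sum_j y_j d_j] is, up to a constant, antisymmetric. *)
Lemma ip_euler (j : 'I_n) (F F' : mE -> R) : sqintc F -> sqintc F' ->
  wder (xdir R j) F F' ->
  2 * ip F' (fun p => ycrd j p * F p) = - ip F F.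
Proof.
move=> cF cF' wF.
have cY := smoothE_sqintcM (smoothE_ycrd j) cF.
have cY' := smoothE_sqintcM (smoothE_ycrd j) cF'.
have := wder_ibp cF cF' cY (sqintcD (sqintcZ (j == j)%:R cF) cY') wF (wder_ycrd j cF cF' wF).
rewrite eqxx [X in _ = - X]ipC ipD//; last 3 first.
- exact: sqintZ cF.1.
- exact: cY'.1.
- exact: cF.1.
rewrite ipZ; [|exact: cF.1|exact: cF.1].
rewrite ipMl mul1r; lra.
Qed.

Record regular (f ft : mE -> R) (fx : 'I_n -> mE -> R) (fxx : 'I_n -> 'I_n -> mE -> R)
    : Prop := Regular {
  reg_f : sqintc f;
  reg_t : sqintc ft;
  reg_x : forall j, sqintc (fx j);
  reg_xx : forall j k, sqintc (fxx j k);
  reg_dt : wder (tdir R n) f ft;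
  reg_dx : forall j, wder (xdir R j) f (fx j);
  reg_dxx : forall j k, wder (xdir R k) (fx j) (fxx j k) }.

Definition lap (fxx : 'I_n -> 'I_n -> mE -> R) : mE -> R := fun p => \sum_k fxx k k p.
Definition euler (fx : 'I_n -> mE -> R) : mE -> R := fun p => \sum_j ycrd j p * fx j p.
Definition radial (f : mE -> R) : mE -> R := fun p => \sum_k ycrd k p * (ycrd k p * f p).
Definition gradn (fx : 'I_n -> mE -> R) : R := \sum_k ip (fx k) (fx k).
Definition momentum (f : mE -> R) : R :=
  \sum_k ip (fun p => ycrd k p * f p) (fun p => ycrd k p * f p).

Section One.
Variables (f ft : mE -> R) (fx : 'I_n -> mE -> R) (fxx : 'I_n -> 'I_n -> mE -> R).
Hypothesis rf : regular f ft fx fxx.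

Let cf := reg_f rf. Let ct := reg_t rf. Let cx := reg_x rf. Let cxx := reg_xx rf.

Let cY j F : sqintc F -> sqintc (fun p => ycrd j p * F p).
Proof. exact: smoothE_sqintcM (smoothE_ycrd j). Qed.

Lemma sqintc_lap : sqintc (lap fxx).
Proof. exact: sqintc_sum. Qed.

Lemma sqintc_euler : sqintc (euler fx).
Proof. by apply: sqintc_sum => j; exact: cY. Qed.

Lemma sqintc_radial : sqintc (radial f).
Proof. by apply: sqintc_sum => j; do 2 apply: cY. Qed.

Lemma ip_t : ip ft f = 0.
Proof.
have := wder_ibp cf ct cf ct (reg_dt rf) (reg_dt rf); rewrite [X in _ = - X]ipC; lra.
Qed.

Lemma ip_lap : ip (lap fxx) f = - gradn fx.
Proof.
rewrite /lap ip_sum; [|by move=> k; exact: (cxx k k).1|exact: cf.1].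
rewrite /gradn -sumrN; apply: eq_bigr => k _.
exact: (wder_ibp (cx k) (cxx k k) cf (cx k) (reg_dxx rf k k) (reg_dx rf k)).
Qed.

(** The virial identity. For each pair of indices, f_kk is paired with the derivatives
    of y_j f and the roles of j and k are exchanged by [wder_exchange]; then
    [ip_euler] applies to f_k. Third derivatives of [f] never appear. *)
Lemma ip_lap_euler : ip (lap fxx) (euler fx) = (n%:R / 2 - 1) * gradn fx.
Proof.
have Hjk j k : ip (fxx k k) (fun p => ycrd j p * fx j p) =
    (1 / 2 - (j == k)%:R) * ip (fx k) (fx k).
  have cYf := cY j cf; have cYx i := cY j (cx i).
  have := wder_exchange (cx k) (cxx k k) (cxx k j) cYf
    (sqintcD (sqintcZ (j == k)%:R cf) (cYx k)) (sqintcD (sqintcZ (j == j)%:R cf) (cYx j))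
    (reg_dxx rf k k) (reg_dxx rf k j)
    (wder_ycrd j cf (cx k) (reg_dx rf k)) (wder_ycrd j cf (cx j) (reg_dx rf j)).
  have e1 F (a : R) G : sqintc F -> sqintc G ->
      ip F (fun p => a * f p + G p) = a * ip F f + ip F G.
    move=> cF cG; rewrite ipC ipD; [|exact: sqintZ cf.1|exact: cG.1|exact: cF.1].
    by rewrite (ipZ _ cf.1 cF.1) (ipC f) (ipC G).
  rewrite (e1 _ _ _ (cxx k k) (cYx j)) (e1 _ _ _ (cxx k j) (cYx k)) eqxx mul1r.
  have ek := wder_ibp (cx k) (cxx k k) cf (cx k) (reg_dxx rf k k) (reg_dx rf k).
  have eu := ip_euler (cx k) (cxx k j) (reg_dxx rf k j).
  have t1 : true%:R = 1 :> R by [].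
  have f0 : false%:R = 0 :> R by [].
  rewrite ek; have [->|jk] := eqVneq j k; rewrite ?t1 ?f0.
    by have := ip_euler (cx k) (cxx k k) (reg_dxx rf k k); lra.
  by rewrite mul0r; lra.
rewrite /lap ip_sum; [|by move=> k; exact: (cxx k k).1|exact: sqintc_euler.1].
rewrite /gradn mulr_sumr; apply: eq_bigr => k _.
rewrite ipC /euler ip_sum; [|by move=> j; exact: (cY j (cx j)).1|exact: (cxx k k).1].
under eq_bigr do rewrite ipC Hjk.
rewrite -mulr_suml; congr (_ * _).
rewrite sumrB sumr_const card_ord -[X in X - _]mulr_natl mul1r; congr (_ - _).
by rewrite (bigD1 k)//= eqxx big1 ?addr0// => j /negbTE ->.
Qed.

Lemma ip_radial : ip (radial f) f = momentum f.
Proof.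
rewrite /radial ip_sum; [|by move=> k; exact: (cY k (cY k cf)).1|exact: cf.1].
by apply: eq_bigr => k _; rewrite ipMl.
Qed.

Lemma ip_radial_euler : ip (radial f) (euler fx) = - (n%:R / 2 + 1) * momentum f.
Proof.
have Hjk j k : ip (fun p => ycrd k p * (ycrd k p * f p)) (fun p => ycrd j p * fx j p) =
    - (1 / 2 + (j == k)%:R) * ip (fun p => ycrd k p * f p) (fun p => ycrd k p * f p).
  have cYf := cY k cf; have cYx := cY k (cx j).
  have := ip_euler cYf (sqintcD (sqintcZ (k == j)%:R cf) cYx)
    (wder_ycrd k cf (cx j) (reg_dx rf j)).
  have cYY := cY j cYf.
  rewrite ipD; [|exact: sqintZ cf.1|exact: cYx.1|exact: cYY.1].
  rewrite (ipZ _ cf.1 cYY.1) eq_sym.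
  have -> : ip (fun p => ycrd k p * fx j p) (fun p => ycrd j p * (ycrd k p * f p)) =
      ip (fun p => ycrd k p * (ycrd k p * f p)) (fun p => ycrd j p * fx j p).
    by apply: eq_ip => p; ring.
  have t1 : true%:R = 1 :> R by [].
  have f0 : false%:R = 0 :> R by [].
  have [->|jk] := eqVneq j k; rewrite ?t1 ?f0; last by rewrite mul0r; lra.
  have -> : ip f (fun p => ycrd k p * (ycrd k p * f p)) =
      ip (fun p => ycrd k p * f p) (fun p => ycrd k p * f p).
    by apply: eq_ip => p; ring.
  lra.
rewrite /radial ip_sum; [|by move=> k; exact: (cY k (cY k cf)).1|exact: sqintc_euler.1].
rewrite /momentum mulr_sumr; apply: eq_bigr => k _.
rewrite ipC /euler ip_sum; [|by move=> j; exact: (cY j (cx j)).1|exact: (cY k (cY k cf)).1].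
under eq_bigr do rewrite ipC Hjk.
rewrite -mulr_suml; congr (_ * _).
rewrite sumrN big_split /= sumr_const card_ord -[X in X + _]mulr_natl mul1r.
congr (- (_ + _)).
by rewrite (bigD1 k)//= eqxx big1 ?addr0// => j /negbTE ->.
Qed.

(** The uncertainty principle: expand the norm of b y_j f + f_j and use [ip_euler]. *)
Lemma uncertainty (b : R) : 0 < b ->
  n%:R * b * ip f f <= b ^+ 2 * momentum f + gradn fx.
Proof.
move=> b0.
have H j : b * ip f f <= b ^+ 2 * ip (fun p => ycrd j p * f p) (fun p => ycrd j p * f p) +
    ip (fx j) (fx j).
  have e := ip_euler cf (cx j) (reg_dx rf j).
  have [sY _] := cY j cf; have [sx _] := cx j.
  have := ip_ge0 (fun p => b * (ycrd j p * f p) + fx j p).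
  rewrite ipD; [|exact: sqintZ|by []|by apply: sqintD => //; exact: sqintZ].
  rewrite [ip (fx j) _]ipC ipZ//; last by apply: sqintD => //; exact: sqintZ.
  rewrite ipD//; last exact: sqintZ.
  rewrite [ip (fun p => ycrd j p * f p) _]ipC ipD//; last exact: sqintZ.
  rewrite !ipZ// => H0.
  have ec := ipC (fx j) (fun p => ycrd j p * f p).
  have eb : b * (2 * ip (fx j) (fun p => ycrd j p * f p)) = b * - ip f f by rewrite e.
  rewrite -?ec in H0 *; move: H0 eb; lra.
rewrite /momentum /gradn mulr_sumr -big_split /=.
apply: le_trans (ler_sum _ (fun j _ => H j)).
by rewrite sumr_const card_ord -mulrA mulr_natl.
Qed.

End One.

Definition symm (s b : R) (gt : mE -> R) fxx f : mE -> R :=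
  lin3 s 1 (4 * b ^+ 2) gt (lap fxx) (radial f).

Definition skew (s b c : R) fx f (g : mE -> R) : mE -> R :=
  lin3 (- (4 * b)) (- (2 * b * n%:R)) (- (s * (b * c))) (euler fx) f g.

(** The real (s = -1, g the imaginary part of the unknown and f its real part)
    and imaginary (s = 1, roles exchanged) parts of the operator i d_t + Lap
    conjugated by the weight exp (b (|y|^2 + c t)). *)
Definition conjugated (s b c : R) (gt : mE -> R) fx fxx f g : mE -> R :=
  fun p => symm s b gt fxx f p + skew s b c fx f g p.

(** The cross term of the symmetric and skew parts comes from their commutator,
    which is positive: the weight is convex in space, and it is
    linear in time, which makes the time derivative commute with A. *)
Lemma carleman (f ft : mE -> R) (fx : 'I_n -> mE -> R) (fxx : 'I_n -> 'I_n -> mE -> R)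
  (g gt : mE -> R) (gx : 'I_n -> mE -> R) (gxx : 'I_n -> 'I_n -> mE -> R) (b c : R) :
  regular f ft fx fxx -> regular g gt gx gxx ->
  16 * b * (gradn fx + gradn gx) + 64 * b ^+ 3 * (momentum f + momentum g) <=
  ip (conjugated (-1) b c gt fx fxx f g) (conjugated (-1) b c gt fx fxx f g) +
  ip (conjugated 1 b c ft gx gxx g f) (conjugated 1 b c ft gx gxx g f).
Proof.
move=> rf rg.
have [[sf _] [sft _] sfx sfxx dft dfx dfxx] := rf.
have [[sg _] [sgt _] sgx sgxx dgt dgx dgxx] := rg.
have [sLf _] := sqintc_lap rf; have [sLg _] := sqintc_lap rg.
have [sXf _] := sqintc_euler rf; have [sXg _] := sqintc_euler rg.
have [sWf _] := sqintc_radial rf; have [sWg _] := sqintc_radial rg.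
have sS1 : sqint (symm (-1) b gt fxx f) by exact: sqint_lin3.
have sA1 : sqint (skew (-1) b c fx f g) by exact: sqint_lin3.
have sS2 : sqint (symm 1 b ft gxx g) by exact: sqint_lin3.
have sA2 : sqint (skew 1 b c gx g f) by exact: sqint_lin3.
have sq1 := ip_square sS1 sA1; have sq2 := ip_square sS2 sA2.
apply: le_trans (lerD sq1 sq2); rewrite {sq1 sq2 sS1 sA1 sS2 sA2}.
rewrite /symm /skew !ip_lin33//.
rewrite (ip_lap rf) (ip_lap rg) (ip_lap_euler rf) (ip_lap_euler rg).
rewrite (ip_radial rf) (ip_radial rg) (ip_radial_euler rf) (ip_radial_euler rg).
rewrite (ip_t rf) (ip_t rg).
have Yf j : sqint (fun p => ycrd j p * f p).
  exact: (smoothE_sqintcM (smoothE_ycrd j) (reg_f rf)).1.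
have Yfx j : sqint (fun p => ycrd j p * fx j p).
  exact: (smoothE_sqintcM (smoothE_ycrd j) (sfx j)).1.
have Ygx j : sqint (fun p => ycrd j p * gx j p).
  exact: (smoothE_sqintcM (smoothE_ycrd j) (sgx j)).1.
have eL : ip (lap fxx) g = ip (lap gxx) f.
  rewrite /lap !ip_sum//; try by move=> k; case: (sfxx k k) (sgxx k k) => ? _ [? _].
  apply: eq_bigr => k _.
  rewrite (wder_ibp (sfx k) (sfxx k k) (reg_f rg) (sgx k) (dfxx k k) (dgx k)).
  rewrite (wder_ibp (sgx k) (sgxx k k) (reg_f rf) (sfx k) (dgxx k k) (dfx k)).
  by rewrite ipC.
have eW : ip (radial f) g = ip (radial g) f.
  by apply: eq_ip => p; rewrite /radial !mulr_suml; apply: eq_bigr => k _; ring.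
have et : ip gt f = - ip ft g.
  by rewrite (wder_ibp (reg_f rg) (reg_t rg) (reg_f rf) (reg_t rf) dgt dft) ipC.
(* Time and space derivatives are exchanged, at the cost of differentiating y_j. *)
have eX : ip gt (euler fx) = ip ft (euler gx) - n%:R * ip gt f.
  rewrite ipC [ip ft _]ipC /euler !ip_sum//.
  have -> : n%:R * ip gt f = \sum_(j < n) ip f gt.
    by rewrite sumr_const card_ord ipC mulr_natl.
  rewrite -sumrB; apply: eq_bigr => j _.
  have cY := smoothE_sqintcM (smoothE_ycrd j) (reg_f rf).
  have cYt := smoothE_sqintcM (smoothE_ycrd j) (reg_t rf).
  have cYx := smoothE_sqintcM (smoothE_ycrd j) (sfx j).
  have := wder_exchange (reg_f rg) (reg_t rg) (sgx j) cY cYt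
    (sqintcD (sqintcZ (j == j)%:R (reg_f rf)) cYx) dgt (dgx j)
    (wder_ycrd_t j (reg_f rf) (reg_t rf) dft) (wder_ycrd j (reg_f rf) (sfx j) (dfx j)).
  rewrite ipC ipD//; last exact: sqintZ.
  rewrite ipZ// eqxx mul1r => e.
  have -> : ip (fun p => ycrd j p * gx j p) ft = ip (gx j) (fun p => ycrd j p * ft p).
    by apply: eq_ip => p; ring.
  by move: e; lra.
rewrite eL eW eX et.
rewrite le_eqVlt; apply/orP; left; apply/eqP; by field.
Qed.

End Carleman.

(** * Weights and cutoffs *)

Section Weight.
Context {R : realType} {n : nat}.
Local Notation E := ('rV[R]_n * R)%type.
Local Notation mE := ('rV[R]_n * measurableTypeR R)%type.
Implicit Types (f : E -> R) (p v : E).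

Lemma pd_invariant f v : (forall h p, f (h *: v + p) = f p) -> pd v f = fun=> 0.
Proof.
move=> fv; apply/funext => p; apply: is_derive_pd; apply: is_derive_line.
by under eq_fun do rewrite fv; exact: is_derive_cst.
Qed.

Lemma is_derive_expE f p v d : is_derive p v f d ->
  is_derive p v (fun p => expR (f p)) (expR (f p) * d).
Proof.
move=> [df ef]; apply: is_derive_line.
have e : (fun h : R => h^-1 *: (((fun h : R => f (h *: v + p)) \o shift 0)
    (h *: 1) - f (0 *: v + p))) = (fun h : R => h^-1 *: ((f \o shift p) (h *: v) - f p)).
  by apply/funext => h /=; rewrite addr0 scale0r add0r [h *: 1]mulr1.
have d0 : is_derive (0 : R) 1 (fun h : R => f (h *: v + p)) d.
  by split; [move: df; rewrite /derivable e|rewrite -ef /derive e].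
have := @is_derive1_comp _ expR (fun h : R => f (h *: v + p)) 0 _ _
  (is_derive_expR _) d0.
by rewrite scale0r add0r.
Qed.

Definition cut (r s : R) : R := step (1 * s + (r + 2)) * step (-1 * s + (r + 2)).

Lemma smooth1_cut r : smooth1 (cut r).
Proof. by apply: smooth1M; exact: smooth1_affine smooth1_step. Qed.

Lemma cut1 r s : `|s| <= r + 1 -> cut r s = 1.
Proof. by rewrite ler_norml => /andP[? ?]; rewrite /cut !step_1 ?mulr1//; lra. Qed.

Lemma cut0 r s : r + 3 <= `|s| -> cut r s = 0.
Proof.
rewrite ler_normr => /orP[?|?]; rewrite /cut.
  by rewrite [X in _ * X]step_0 ?mulr0//; lra.
by rewrite step_0 ?mul0r//; lra.
Qed.

Lemma cut_ge0 r s : 0 <= cut r s.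
Proof. by rewrite mulr_ge0// step_ge0. Qed.

Lemma cut_le1 r s : cut r s <= 1.
Proof. by rewrite mulr_ile1 ?step_ge0 ?step_le1. Qed.

Definition cut' (r s : R) : R :=
  step (1 * s + (r + 2)) * - step' (-1 * s + (r + 2)) +
  step (-1 * s + (r + 2)) * step' (1 * s + (r + 2)).

Lemma is_derive_cut r (s : R) : is_derive s 1 (cut r) (cut' r s).
Proof.
have d1 := is_derive_affine (is_derive_step (1 * s + (r + 2))).
have d2 := is_derive_affine (is_derive_step (-1 * s + (r + 2))).
have dd : is_derive s 1 (cut r) _ := is_deriveM d1 d2.
by apply: (is_derive_eq dd); rewrite mulr1 mulrN1.
Qed.

Lemma step'_bounded : exists C : R, forall s, step' s <= C.
Proof.
pose f (p : 'rV[R]_0 * R) := step' (crd None p).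
have sf : smoothE f by exact: (smoothE_base None smooth1_step').
have bf : boxed 1 f.
  by move=> p [[]//|] p1; rewrite /f step'_0// ltW.
have [C HC] := boxed_bounded sf bf; exists C => s.
exact: le_trans (ler_norm _) (HC (0, s)).
Qed.

Lemma cut'_bounded : exists2 C : R, 0 <= C & forall r s, `|cut' r s| <= C.
Proof.
have [C HC] := step'_bounded; have C0 : 0 <= C by exact: le_trans (step'_ge0 0) (HC 0).
exists (C + C); first by rewrite addr_ge0.
move=> r s; rewrite /cut' (le_trans (ler_normD _ _))// lerD//.
  rewrite normrM normrN ger0_norm ?step_ge0// ger0_norm ?step'_ge0//.
  by rewrite (le_trans (ler_piMl (step'_ge0 _) (step_le1 _)))// HC.
rewrite normrM ger0_norm ?step_ge0// ger0_norm ?step'_ge0//.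
by rewrite (le_trans (ler_piMl (step'_ge0 _) (step_le1 _)))// HC.
Qed.

Lemma smoothE_sum (I : Type) (s : seq I) (F : I -> E -> R) :
  (forall i, smoothE (F i)) -> smoothE (fun p => \sum_(i <- s) F i p).
Proof.
move=> sF; elim: s => [|i s IH].
  by under eq_fun do rewrite big_nil; exact: smoothE_cst.
by under eq_fun do rewrite big_cons; exact: smoothED.
Qed.

Lemma pd_sum (I : Type) (s : seq I) (F : I -> E -> R) v :
  (forall i, smoothE (F i)) ->
  pd v (fun p => \sum_(i <- s) F i p) = (fun p => \sum_(i <- s) pd v (F i) p).
Proof.
move=> sF; elim: s => [|i s IH].
  under eq_fun do rewrite big_nil; rewrite pd_cst.
  by apply/funext => p; rewrite big_nil.
under eq_fun do rewrite big_cons.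
rewrite (pdD _ (sF i) (smoothE_sum s sF)) IH.
by apply/funext => p; rewrite big_cons.
Qed.

Variables (c t0 : R) (x0 : 'rV[R]_n).

(** The exponent of the weight; the support condition is that it is at most 0. *)
Definition parabola p : R := c * (1 * crd None p + - t0) + \sum_(j < n) ycrd x0 j p * ycrd x0 j p.

Lemma smoothE_parabola : smoothE parabola.
Proof.
apply: smoothED.
  apply: smoothEZ; exact: (smoothE_base None (smooth1_affine 1 (- t0) smooth1_id)).
by apply: smoothE_sum => j; apply: smoothEM; exact: smoothE_ycrd.
Qed.

Lemma pd_parabola v : pd v parabola = fun p =>
  c * crd None v + \sum_(j < n) 2 * (ycrd x0 j p * crd (Some j) v).
Proof.
have st : smoothE (fun p => 1 * crd None p + - t0).
  exact: (smoothE_base None (smooth1_affine 1 (- t0) smooth1_id)).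
have sy j := smoothE_ycrd x0 j.
rewrite /parabola (pdD _ (smoothEZ c st) (smoothE_sum _ (fun j => smoothEM (sy j) (sy j)))).
rewrite (pdM _ (smoothE_cst c) st) (pd_sum _ _ (fun j => smoothEM (sy j) (sy j))).
have d (s : R) : is_derive s 1 (fun s : R => 1 * s + - t0) (cst 1 s).
  have dd : is_derive s 1 (fun s : R => id (1 * s + - t0)) (1 * 1).
    by apply: (@is_derive_affine _ id); exact: is_derive_id.
  by apply: (is_derive_eq dd); rewrite mulr1.
rewrite (pd_crd _ _ d) pd_cst; apply/funext => p /=; congr (_ + _).
  by rewrite mulr0 addr0 mul1r.
by apply: eq_bigr => j _; rewrite (pdM _ (sy j) (sy j)) pd_ycrd /=; ring.
Qed.

Lemma parabolaE p : parabola p = c * (p.2 - t0) + sqnorm (p.1 - x0).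
Proof.
rewrite /parabola /= mul1r; congr (_ + _); apply: eq_bigr => j _.
by rewrite /ycrd /= !mxE mul1r expr2.
Qed.

Definition weight (b : R) p : R := expR (b * parabola p).

(** The exponential of a sum of functions of one coordinate is a product of such
    functions. *)
Lemma smoothE_weight b : smoothE (weight b).
Proof.
have -> : weight b = (fun p => expR (b * (c * (1 * crd None p + - t0))) *
    \prod_(j < n) expR (b * ((1 * crd (Some j) p + - x0 ord0 j) *
      (1 * crd (Some j) p + - x0 ord0 j)))).
  by apply/funext => p; rewrite /weight /parabola mulrDr expRD mulr_sumr expR_sum.
apply: smoothEM.
  apply: (smoothE_base None (f := fun s => expR (b * (c * (1 * s + - t0))))).
  apply: smooth1_expR; apply: smooth1M; first exact: smooth1_cst.
  apply: smooth1M; first exact: smooth1_cst.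
  exact: (smooth1_affine 1 (- t0) smooth1_id).
apply: smoothE_prod => j.
apply: (smoothE_base (Some j) (f := fun s => expR (b * ((1 * s + - x0 ord0 j) *
  (1 * s + - x0 ord0 j))))).
apply: smooth1_expR; apply: smooth1M; first exact: smooth1_cst.
by apply: smooth1M; exact: (smooth1_affine 1 (- x0 ord0 j) smooth1_id).
Qed.

Lemma pd_weight b v : pd v (weight b) = fun p => weight b p * (b * pd v parabola p).
Proof.
have sb : smoothE (fun p => b * parabola p) by exact: smoothEZ smoothE_parabola.
apply/funext => p; apply: is_derive_pd.
have := is_derive_expE (smoothE_is_derive v p sb).
by rewrite (pdM _ (smoothE_cst b) smoothE_parabola) pd_cst mulr0 addr0.
Qed.

(** The cutoff in time. Its derivative is of order 1/T, the source of all smallness. *)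
Definition chi (T : R) p : R := cut 0 (T^-1 * crd None p + 0).

Lemma smoothE_chi T : smoothE (chi T).
Proof. exact: (smoothE_base None (smooth1_affine T^-1 0 (smooth1_cut 0))). Qed.

Lemma pd_chi_x T j : pd (xdir R j) (chi T) = fun=> 0.
Proof.
by apply: pd_invariant => h p; rewrite /chi crd_shift /= mul0r add0r.
Qed.

Lemma pd_chi_t T : pd (tdir R n) (chi T) = fun p => cut' 0 (T^-1 * crd None p + 0) * T^-1.
Proof.
rewrite /chi (pd_crd _ _ (fun s => is_derive_affine (is_derive_cut 0 (T^-1 * s + 0)))).
by apply/funext => p; rewrite /= mulr1.
Qed.

Definition eta (N : R) p : R := \prod_(j < n) cut N (ycrd x0 j p).

Lemma smoothE_eta N : smoothE (eta N).
Proof.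
apply: smoothE_prod => j.
exact: (smoothE_base (Some j) (smooth1_affine 1 (- x0 ord0 j) (smooth1_cut N))).
Qed.

Lemma pd_eta_t N : pd (tdir R n) (eta N) = fun=> 0.
Proof.
apply: pd_invariant => h p; apply: eq_bigr => j _.
by rewrite /ycrd crd_shift crd_tdir mul0r add0r.
Qed.

Lemma eta1 N p : (forall j, `|ycrd x0 j p| <= N + 1) -> eta N p = 1.
Proof. by move=> pN; apply: big1 => j _; exact: cut1. Qed.

Lemma eta_ge0 N p : 0 <= eta N p.
Proof. by apply: prodr_ge0 => j _; exact: cut_ge0. Qed.

Lemma eta_le1 N p : eta N p <= 1.
Proof.
rewrite /eta; elim: (index_enum _) => [|j s IH]; first by rewrite big_nil.
rewrite big_cons mulr_ile1 ?cut_ge0 ?cut_le1//.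
by apply: prodr_ge0 => k _; exact: cut_ge0.
Qed.

(** The cutoff is constant in a neighbourhood of such points. *)
Lemma pd_eta0 N p v : (forall j, `|ycrd x0 j p| < N + 1) ->
  pd v (eta N) p = 0 /\ forall w, pd w (pd v (eta N)) p = 0.
Proof.
move=> pN.
have op : \forall q \near p, forall j, `|ycrd x0 j q| < N + 1.
  apply: (@filter_forall _ _ _ _ (nbhs_filter p)) => j.
  have : (fun q : E => `|ycrd x0 j q|) @ p --> `|ycrd x0 j p|.
    by apply: cvg_norm; exact: (smoothE_continuous (smoothE_ycrd x0 j)).
  by move=> /cvgr_lt; apply.
have d0 q : (forall j, `|ycrd x0 j q| < N + 1) -> pd v (eta N) q = 0.
  move=> qN; apply: is_derive_pd; apply: (@near_eq_is_derive _ _ _ (fun=> 1 : R)).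
    have oq : \forall r \near q, forall j, `|ycrd x0 j r| < N + 1.
      apply: (@filter_forall _ _ _ _ (nbhs_filter q)) => j.
      have : (fun q : E => `|ycrd x0 j q|) @ q --> `|ycrd x0 j q|.
        by apply: cvg_norm; exact: (smoothE_continuous (smoothE_ycrd x0 j)).
      by move=> /cvgr_lt; apply.
    by apply: filterS oq => r rN; rewrite eta1// => j; exact: ltW.
split; first exact: d0.
move=> w; apply: is_derive_pd; apply: (@near_eq_is_derive _ _ _ (fun=> 0 : R)).
  by apply: filterS op => q qN; rewrite d0.
Qed.

End Weight.

(** * Localising a Sobolev function *)

Section Localisation.
Context {R : realType} {n : nat}.
Local Notation E := ('rV[R]_n * R)%type.
Local Notation mE := ('rV[R]_n * measurableTypeR R)%type.
Local Notation leb := (@lebesgue_measure R).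
Local Notation mu := (prodm (@leb_rV R n) leb).
Implicit Types (F G Q : mE -> R) (k : E -> R) (v : E).

(** For nonnegative integrands one equation in the extended reals contains both
    integrability and the value. *)
Definition has_integral Q (r : R) := [/\ measurable_fun [set: mE] Q,
  forall p, 0 <= Q p & (\int[mu]_p (Q p)%:E = r%:E)%E].

Lemma has_integral_sqr (a : R) F : 0 <= a -> sqint F ->
  has_integral (fun p => a * F p ^+ 2) (a * ip F F).
Proof.
move=> a0 sF; have [mF _] := sF.
have mF2 : measurable_fun [set: mE] (fun p => F p ^+ 2) by exact: measurable_funX.
split; [exact: measurable_funM|by move=> p; rewrite mulr_ge0 ?sqr_ge0|].
under eq_integral do rewrite EFinM.
rewrite ge0_integralZl_EFin//; first by rewrite -ip_fin.
- by move=> p _; rewrite lee_fin sqr_ge0.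
- exact/measurable_EFinP.
Qed.

Lemma has_integralD F G r s : has_integral F r -> has_integral G s ->
  has_integral (fun p => F p + G p) (r + s).
Proof.
move=> [mF F0 iF] [mG G0 iG]; split; [exact: measurable_funD|by move=> p; rewrite addr_ge0|].
under eq_integral do rewrite EFinD.
rewrite ge0_integralD ?iF ?iG//; try exact/measurable_EFinP.
  by move=> p _; rewrite lee_fin.
by move=> p _; rewrite lee_fin.
Qed.

Lemma has_integral_sum (I : Type) (s : seq I) (F : I -> mE -> R) (r : I -> R) :
  (forall i, has_integral (F i) (r i)) ->
  has_integral (fun p => \sum_(i <- s) F i p) (\sum_(i <- s) r i).
Proof.
move=> iF; elim: s => [|i s IH].
  rewrite big_nil (_ : (fun p => _) = fun=> 0); last by apply/funext => p; rewrite big_nil.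
  by split => //; rewrite integral0.
rewrite big_cons (_ : (fun p => _) = (fun p => F i p + \sum_(j <- s) F j p)).
  exact: has_integralD.
by apply/funext => p; rewrite big_cons.
Qed.

Lemma has_integral_le F G r s : has_integral F r -> has_integral G s ->
  {ae mu, forall p, F p <= G p} -> r <= s.
Proof.
move=> [mF F0 iF] [mG G0 iG] FG; rewrite -lee_fin -iF -iG.
apply: ae_ge0_le_integral => //; try exact/measurable_EFinP.
- by move=> p _; rewrite lee_fin.
- by move=> p _; rewrite lee_fin.
by apply: filterS FG => p Fp _; rewrite lee_fin.
Qed.

Lemma ip_ae0 F G : sqint F -> sqint G -> {ae mu, forall p, F p = 0} -> ip F G = 0.
Proof.
move=> sF sG F0; rewrite /ip /Rintegral (ae_eq_integral (cst 0%E)) ?integral0//.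
- by have /integrableP[] := sqint_integrable sF sG.
- by apply: filterS F0 => p Fp _; rewrite Fp mul0r.
Qed.

(** Weak derivatives are local: where a function vanishes, so do they. By the
    Leibniz rule [k F'] is the weak derivative of [k F] up to a term in F, and it
    is orthogonal to all test functions. *)
Lemma wder_local v k N F F' : smoothE k -> boxed N k -> sqint F -> sqint F' ->
  wder v F F' -> {ae mu, forall p, k p * F p = 0} ->
  {ae mu, forall p, pd v k p * F p = 0} -> {ae mu, forall p, k p * F' p = 0}.
Proof.
move=> sk bk sF sF' wF z z'.
have [s1 _] := smoothE_boxed_sqint sk bk sF.
have [s2 _] := smoothE_boxed_sqint (smoothE_pd v sk) (boxed_pd v bk) sF.
have c3 := smoothE_boxed_sqint sk bk sF'; have [s3 _] := c3.
apply: wder_unique0 => // h sh bh; have [M bM] := bh.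
have [s4 _] := smoothE_sqintc sh bM.
have [s5 _] := smoothE_sqintc (smoothE_pd v sh) (boxed_pd v bM).
have := wderM sk bk sF sF' wF sh bh.
by rewrite (ip_ae0 s1 s5 z) ipD// (ip_ae0 s2 s4 z'); lra.
Qed.

(** [axx j k] differentiates [ax j] along [k], so that second derivatives enter only
    through the relation between first derivatives and theirs. *)
Record sobolev (a at_ : mE -> R) (ax : 'I_n -> mE -> R) (axx : 'I_n -> 'I_n -> mE -> R)
    : Prop := Sobolev {
  sob : sqint a;
  sob_t : sqint at_;
  sob_x : forall j, sqint (ax j);
  sob_xx : forall j k : 'I_n, sqint (axx j k);
  sob_dt : wder (tdir R n) a at_;
  sob_dx : forall j, wder (xdir R j) a (ax j);
  sob_dxx : forall j k : 'I_n, wder (xdir R k) (ax j) (axx j k) }.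

Lemma sobolev_regular (e : E -> R) N a at_ ax axx : smoothE e -> boxed N e ->
  sobolev a at_ ax axx ->
  regular (fun p => e p * a p)
    (fun p => pd (tdir R n) e p * a p + e p * at_ p)
    (fun j p => pd (xdir R j) e p * a p + e p * ax j p)
    (fun (j k : 'I_n) p => (pd (xdir R k) (pd (xdir R j) e) p * a p + pd (xdir R j) e p * ax k p) +
      (pd (xdir R k) e p * ax j p + e p * axx j k p)).
Proof.
move=> se be [sa st sx sxx dt dx dxx].
have se' v := smoothE_pd v se; have be' v := boxed_pd v be.
have L (k : E -> R) F : smoothE k -> boxed N k -> sqint F -> sqintc (fun p => k p * F p).
  exact: smoothE_boxed_sqint.
split.
- exact: L.
- by apply: sqintcD; exact: L.
- by move=> j; apply: sqintcD; exact: L.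
- move=> j k; apply: sqintcD; apply: sqintcD; apply: L => //.
    exact: smoothE_pd.
  exact: boxed_pd.
- exact: (wderM se be sa st dt).
- move=> j; exact: (wderM se be sa (sx j) (dx j)).
- move=> j k; apply: wderD.
  + exact: (L _ _ (se' _) (be' _) sa).1.
  + apply: (sqintcD (L _ _ _ _ _) (L _ _ _ _ _)).1 => //.
      exact: smoothE_pd.
    exact: boxed_pd.
  + exact: (L _ _ se be (sx j)).1.
  + exact: (sqintcD (L _ _ (se' _) (be' _) (sx j)) (L _ _ se be (sxx j k))).1.
  + exact: (wderM (se' _) (be' _) sa (sx k) (dx k)).
  + exact: (wderM se be (sx j) (sxx j k) (dxx j k)).
Qed.

End Localisation.

(** * Unique continuation for real systems *)

Section Continuation.
Context {R : realType} {n : nat}.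
Local Notation E := ('rV[R]_n * R)%type.
Local Notation mE := ('rV[R]_n * measurableTypeR R)%type.
Local Notation leb := (@lebesgue_measure R).
Local Notation mu := (prodm (@leb_rV R n) leb).
Variables (c t0 : R) (x0 : 'rV[R]_n).
Local Notation phi := (parabola c t0 x0).
Local Notation expw := (weight c t0 x0).
Local Notation y := (ycrd x0).

Lemma pd_parabola_x j : pd (xdir R j) phi = fun p => 2 * y j p.
Proof.
rewrite pd_parabola; apply/funext => p; rewrite /= mulr0 add0r (bigD1 j)//= mxE !eqxx mulr1.
by rewrite big1 ?addr0// => k kj; rewrite mxE eqxx (negbTE kj) !mulr0.
Qed.

Lemma pd_parabola_t : pd (tdir R n) phi = fun=> c.
Proof.
rewrite pd_parabola; apply/funext => p; rewrite mulr1 big1 ?addr0// => j _.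
by rewrite crd_tdir !mulr0.
Qed.

Definition local_cutoff (T N : R) : E -> R := fun p => chi T p * eta x0 N p.

Lemma smoothE_local_cutoff T N : smoothE (local_cutoff T N).
Proof. exact: smoothEM (smoothE_chi T) (smoothE_eta x0 N). Qed.

Lemma boxed_local_cutoff T N : 0 < T -> exists M, boxed M (local_cutoff T N).
Proof.
move=> T0; exists (3 * T + (`|N| + 3 + \sum_j `|x0 ord0 j|)) => p i.
have S0 : 0 <= \sum_j `|x0 ord0 j| by exact: sumr_ge0.
case: i => [j|] Mp.
- rewrite /local_cutoff /eta (bigD1 j)//= cut0 ?mul0r ?mulr0// /ycrd mul1r.
  have x0j : `|x0 ord0 j| <= \sum_j `|x0 ord0 j| by rewrite (bigD1 j)//= lerDl sumr_ge0.
  have := lerB_dist (crd (Some j) p) (x0 ord0 j); have := ler_norm N.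
  lra.
- rewrite /local_cutoff /chi cut0 ?mul0r// add0r addr0 normrM gtr0_norm ?invr_gt0//.
  rewrite ler_pdivlMl// mulrC; have := normr_ge0 N; lra.
Qed.

Lemma pd_local_cutoff_x T N j : pd (xdir R j) (local_cutoff T N) = fun p => chi T p * pd (xdir R j) (eta x0 N) p.
Proof.
rewrite (pdM _ (smoothE_chi T) (smoothE_eta x0 N)) pd_chi_x.
by apply/funext => p; rewrite mulr0 addr0.
Qed.

Lemma pd_local_cutoff_xx T N j : pd (xdir R j) (pd (xdir R j) (local_cutoff T N)) =
  fun p => chi T p * pd (xdir R j) (pd (xdir R j) (eta x0 N)) p.
Proof.
rewrite pd_local_cutoff_x (pdM _ (smoothE_chi T) (smoothE_pd _ (smoothE_eta x0 N))) pd_chi_x.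
by apply/funext => p; rewrite mulr0 addr0.
Qed.

Lemma pd_local_cutoff_t T N : pd (tdir R n) (local_cutoff T N) =
  fun p => eta x0 N p * (cut' 0 (T^-1 * crd None p + 0) * T^-1).
Proof.
rewrite (pdM _ (smoothE_chi T) (smoothE_eta x0 N)) pd_eta_t pd_chi_t.
by apply/funext => p; rewrite mulr0 add0r.
Qed.

(** On the support of [chi T], |t| <= 3 T, and then |y|^2 <= |c| (3 T + |t0|) where
    the exponent of the weight is at most 0. *)
Definition support_radius (T : R) := `|c| * (3 * T + `|t0|) + 1.

Lemma support_bounded T p j : 0 < T -> phi p <= 0 -> chi T p != 0 ->
  `|y j p| < support_radius T + 1.
Proof.
move=> T0 phi0 chi0.
have tT : `|crd None p| <= 3 * T.
  rewrite leNgt; apply: contra_neqN chi0 => tT; apply: cut0.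
  rewrite add0r addr0 normrM gtr0_norm ?invr_gt0// ler_pdivlMl// mulrC; exact: ltW.
have : y j p ^+ 2 <= `|c| * (3 * T + `|t0|).
  move: phi0; rewrite /parabola (bigD1 j)//= => phi0.
  have s0 : 0 <= \sum_(i | i != j) y i p * y i p.
    by apply: sumr_ge0 => i _; rewrite -expr2 sqr_ge0.
  have ct : - (c * (1 * p.2 + - t0)) <= `|c| * (3 * T + `|t0|).
    apply: le_trans (ler_norm _) _; rewrite normrN normrM ler_wpM2l//.
    by rewrite mul1r (le_trans (ler_normB _ _))// lerD.
  by rewrite expr2; move: phi0 s0 ct; lra.
rewrite /support_radius; move: (`|c| * _) => r yr.
have r0 : 0 <= r by exact: le_trans (sqr_ge0 _) yr.
rewrite ltNge; apply/negP => ry.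
have : (r + 1 + 1) ^+ 2 <= `|y j p| ^+ 2 by rewrite lerXn2r// nnegrE; lra.
rewrite real_normK ?num_real// => h; have := le_trans h yr.
by rewrite expr2; nra.
Qed.

(** The support of [u] is not seen by the derivatives of the cutoff in space: either
    the cutoff in time vanishes or [y] lies well inside the cube. *)
Lemma pd_local_cutoff0 T p j : 0 < T -> phi p <= 0 ->
  pd (xdir R j) (local_cutoff T (support_radius T)) p = 0 /\
  pd (xdir R j) (pd (xdir R j) (local_cutoff T (support_radius T))) p = 0.
Proof.
move=> T0 phi0; rewrite pd_local_cutoff_xx pd_local_cutoff_x.
have [-> | chi0] := eqVneq (chi T p) 0; first by rewrite !mul0r.
have [-> h] := pd_eta0 (xdir R j) (fun j => support_bounded j T0 phi0 chi0).
by rewrite h !mulr0.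
Qed.

Lemma local_cutoff_support T p : 0 < T -> phi p <= 0 -> local_cutoff T (support_radius T) p = chi T p.
Proof.
move=> T0 phi0; rewrite /local_cutoff.
have [-> | chi0] := eqVneq (chi T p) 0; first by rewrite mul0r.
rewrite eta1 ?mulr1// => j; apply: ltW; exact: support_bounded.
Qed.

Definition local_weight (b T N : R) : E -> R := fun p => expw b p * local_cutoff T N p.

Lemma smoothE_local_weight b T N : smoothE (local_weight b T N).
Proof. exact: smoothEM (smoothE_weight c t0 x0 b) (smoothE_local_cutoff T N). Qed.

Lemma pd_local_weight_x b T N j : pd (xdir R j) (local_weight b T N) = fun p =>
  expw b p * pd (xdir R j) (local_cutoff T N) p + (2 * b) * (y j p * local_weight b T N p).
Proof.
rewrite (pdM _ (smoothE_weight c t0 x0 b) (smoothE_local_cutoff T N)) pd_weight pd_parabola_x.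
by apply/funext => p; rewrite /local_weight; ring.
Qed.

Lemma pd_local_weight_xx b T N j : pd (xdir R j) (pd (xdir R j) (local_weight b T N)) = fun p =>
  expw b p * pd (xdir R j) (pd (xdir R j) (local_cutoff T N)) p +
  pd (xdir R j) (local_cutoff T N) p * (expw b p * (2 * b * y j p)) +
  (2 * b) * (y j p * pd (xdir R j) (local_weight b T N) p + local_weight b T N p).
Proof.
have sl := smoothE_pd (xdir R j) (smoothE_local_cutoff T N).
have sw := smoothE_local_weight b T N; have sy := smoothE_ycrd x0 j.
have se := smoothE_weight c t0 x0 b.
rewrite {1}pd_local_weight_x (pdD _ (smoothEM se sl) (smoothEZ (2 * b) (smoothEM sy sw))).
rewrite (pdM _ se sl) (pdM _ (smoothE_cst (2 * b)) (smoothEM sy sw)) (pdM _ sy sw).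
rewrite pd_cst pd_ycrd crd_xdir eqxx pd_weight pd_parabola_x; apply/funext => p /=.
have -> : true%:R = 1 :> R by []; ring.
Qed.

Lemma pd_local_weight_t b T N : pd (tdir R n) (local_weight b T N) = fun p =>
  expw b p * pd (tdir R n) (local_cutoff T N) p + b * c * local_weight b T N p.
Proof.
rewrite (pdM _ (smoothE_weight c t0 x0 b) (smoothE_local_cutoff T N)) pd_weight pd_parabola_t.
by apply/funext => p; rewrite /local_weight; ring.
Qed.

Lemma conjugatedE s b gt fx fxx f g (p : mE) :
  conjugated x0 s b c gt fx fxx f g p = s * (gt p - b * c * g p) +
  \sum_j (fxx j j p + 4 * b ^+ 2 * (y j p * (y j p * f p)) -
    4 * b * (y j p * fx j p) - 2 * b * f p).
Proof.
rewrite /conjugated /symm /skew /lin3 /lap /euler /radial.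
rewrite !sumrB big_split /= -!mulr_sumr sumr_const card_ord -(mulr_natl (f p)).
by move: (\sum_j fxx j j p) (\sum_j y j p * (y j p * f p)) (\sum_j _) => A B C; ring.
Qed.

(** Conjugation by the weight. The hypotheses express that the derivatives of the
    cutoff in space do not meet the unknown; the only commutator left is the one
    with the cutoff in time. *)
Lemma conjugated_local_weight s b T N (a : mE -> R) ax axx (g gt : mE -> R) (p : mE) :
  (forall j, pd (xdir R j) (local_cutoff T N) p * a p = 0) ->
  (forall j, pd (xdir R j) (local_cutoff T N) p * ax j p = 0) ->
  (forall j, pd (xdir R j) (pd (xdir R j) (local_cutoff T N)) p * a p = 0) ->
  conjugated x0 s b c
    (fun p => pd (tdir R n) (local_weight b T N) p * g p + local_weight b T N p * gt p)
    (fun j p => pd (xdir R j) (local_weight b T N) p * a p + local_weight b T N p * ax j p)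
    (fun (j k : 'I_n) p =>
      (pd (xdir R k) (pd (xdir R j) (local_weight b T N)) p * a p +
       pd (xdir R j) (local_weight b T N) p * ax k p) +
      (pd (xdir R k) (local_weight b T N) p * ax j p + local_weight b T N p * axx j k p))
    (fun p => local_weight b T N p * a p) (fun p => local_weight b T N p * g p) p =
  local_weight b T N p * (s * gt p + \sum_j axx j j p) +
  s * (expw b p * pd (tdir R n) (local_cutoff T N) p * g p).
Proof.
move=> z0 z1 z2; rewrite conjugatedE pd_local_weight_t.
rewrite (eq_bigr (fun j => local_weight b T N p * axx j j p)) => [|j _].
  by rewrite -mulr_sumr; move: (\sum_j _) => A; ring.
rewrite pd_local_weight_xx pd_local_weight_x.
have := z0 j; have := z1 j; have := z2 j.
move: (pd (xdir R j) (pd (xdir R j) (local_cutoff T N)) p) (pd (xdir R j) (local_cutoff T N) p) => A B.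
move: (local_weight b T N p) (expw b p) => e w.
move=> e2 e1 e0.
rewrite (_ : _ - _ = e * axx j j p + w * (A * a p) + 2 * w * (B * ax j p)); last by ring.
by rewrite e1 e2 !mulr0 !addr0.
Qed.

End Continuation.

Section System.
Context {R : realType} {n : nat}.
Local Notation E := ('rV[R]_n * R)%type.
Local Notation mE := ('rV[R]_n * measurableTypeR R)%type.
Local Notation leb := (@lebesgue_measure R).
Local Notation mu := (prodm (@leb_rV R n) leb).
Variables (c t0 : R) (x0 : 'rV[R]_n).
Local Notation phi := (parabola c t0 x0).
Local Notation expw := (weight c t0 x0).
Local Notation y := (ycrd x0).
Local Notation wloc := (local_weight c t0 x0).
Local Notation radius := (support_radius c t0).
Variables (a at_ : mE -> R) (ax : 'I_n -> mE -> R) (axx : 'I_n -> 'I_n -> mE -> R).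
Variables (b bt : mE -> R) (bx : 'I_n -> mE -> R) (bxx : 'I_n -> 'I_n -> mE -> R).
Hypotheses (sa : sobolev a at_ ax axx) (sb : sobolev b bt bx bxx).
Variable M : R.
Hypothesis M0 : 0 <= M.
Hypothesis hineq : {ae mu, forall p : mE,
  (- bt p + \sum_j axx j j p) ^+ 2 + (at_ p + \sum_j bxx j j p) ^+ 2 <=
  M * (a p ^+ 2 + b p ^+ 2 + \sum_j (ax j p ^+ 2 + bx j p ^+ 2))}.
Hypothesis hvan : {ae mu, forall p : mE, 0 < phi p -> a p = 0 /\ b p = 0}.
Hypothesis n1 : (1 <= n)%N.

Let va : {ae mu, forall p : mE, 0 < phi p -> a p = 0}.
Proof. by apply: filterS hvan => p H /H[]. Qed.

Let vb : {ae mu, forall p : mE, 0 < phi p -> b p = 0}.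
Proof. by apply: filterS hvan => p H /H[]. Qed.

(** The choice [l = 1 + M] lets the Carleman weights 16 l and 64 l^3 dominate the
    coefficients 4 M and 16 M l^2 with room to spare, and the remaining multiple
    of [P] and [G] dominates [2 * M * F] by the uncertainty principle. *)
Let absorb (G P F K l Q : R) : l = 1 + M -> 0 <= G -> 0 <= P -> 0 <= F ->
  l * F <= l ^+ 2 * P + G -> 16 * l * G + 64 * l ^+ 3 * P <= Q ->
  Q <= 2 * M * F + 4 * M * G + 16 * M * l ^+ 2 * P + 2 * K -> F <= K.
Proof.
move=> lM G0 P0 F0 u q1 q2.
have l1 : 1 <= l by rewrite lM lerDl.
have l0 : 0 <= l by exact: le_trans l1.
have Ml : M <= l by rewrite lM lerDr.
have h1 : M * G <= l * G by exact: ler_wpM2r.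
have h2 : M * (l ^+ 2 * P) <= l * (l ^+ 2 * P) by rewrite ler_wpM2r// mulr_ge0 ?sqr_ge0.
have h3 := ler_wpM2l l0 u.
have h4 : M * F <= l * (l * F) by rewrite (le_trans (ler_wpM2r F0 Ml))// ler_peMl// mulr_ge0.
have h5 : F <= l * (l * F) by rewrite (le_trans (ler_peMl F0 l1))// ler_peMl// mulr_ge0.
have h6 : 0 <= l * (l ^+ 2 * P) by rewrite !mulr_ge0// sqr_ge0.
move: q1 q2 h1 h2 h3 h4 h5 h6; rewrite exprS.
have -> : 16 * M * l ^+ 2 * P = 16 * (M * (l ^+ 2 * P)) by ring.
have -> : 64 * (l * l ^+ 2) * P = 64 * (l * (l ^+ 2 * P)) by ring.
rewrite mulrDr.
lra.
Qed.

Let localized_zero (T : R) (F Ft : mE -> R) (Fx : 'I_n -> mE -> R) Fxx : 0 < T ->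
  sobolev F Ft Fx Fxx ->
  {ae mu, forall p : mE, 0 < phi p -> F p = 0} -> {ae mu, forall p, forall j,
    [/\ pd (xdir R j) (local_cutoff x0 T (radius T)) p * F p = 0,
        pd (xdir R j) (local_cutoff x0 T (radius T)) p * Fx j p = 0 &
        pd (xdir R j) (pd (xdir R j) (local_cutoff x0 T (radius T))) p * F p = 0]}.
Proof.
move=> T0 sF vF; have [N bN] := boxed_local_cutoff x0 (radius T) T0.
have sl := smoothE_local_cutoff x0 T (radius T).
apply: (@filter_forall _ _ _ _ (ae_filter_ringOfSetsType mu)) => j.
have z0 : {ae mu, forall p : mE, pd (xdir R j) (local_cutoff x0 T (radius T)) p * F p = 0}.
  apply: filterS vF => p Fp; have [p0|/Fp ->] := leP (phi p) 0; last by rewrite mulr0.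
  by rewrite (pd_local_cutoff0 _ T0 p0).1 mul0r.
have z2 : {ae mu, forall p : mE,
    pd (xdir R j) (pd (xdir R j) (local_cutoff x0 T (radius T))) p * F p = 0}.
  apply: filterS vF => p Fp; have [p0|/Fp ->] := leP (phi p) 0; last by rewrite mulr0.
  by rewrite (pd_local_cutoff0 _ T0 p0).2 mul0r.
have z1 := wder_local (smoothE_pd (xdir R j) sl) (boxed_pd _ bN) (sob sF) (sob_x sF j)
  (sob_dx sF j) z0 z2.
by apply: filterS3 z0 z1 z2 => p.
Qed.

Let sqint_conjugated s l (f ft : mE -> R) fx fxx g (gt : mE -> R) : regular f ft fx fxx -> sqint g -> sqint gt ->
  sqint (conjugated x0 s l c gt fx fxx f g).
Proof.
move=> rf sg sgt; apply: sqintD; apply: sqint_lin3 => //.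
- exact: (sqintc_lap rf).1.
- exact: (sqintc_radial x0 rf).1.
- exact: (sqintc_euler x0 rf).1.
- exact: (reg_f rf).1.
Qed.

(** The constant does not depend on [T], although the cutoff in space does: all error
    terms but the derivative of [chi] have been absorbed. *)
Lemma carleman_localized (C T : R) : 0 <= C -> (forall r s : R, `|cut' r s| <= C) -> 0 < T ->
  ip (fun p => wloc (1 + M) T (radius T) p * a p)
     (fun p => wloc (1 + M) T (radius T) p * a p) +
  ip (fun p => wloc (1 + M) T (radius T) p * b p)
     (fun p => wloc (1 + M) T (radius T) p * b p) <=
  (C / T) ^+ 2 * (ip a a + ip b b).
Proof.
move=> C0 HC T0; set l := 1 + M; set w := wloc l T (radius T); set k := C / T.
have l1 : 1 <= l by rewrite lerDl.
have [N bl] := boxed_local_cutoff x0 (radius T) T0.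
have sl := smoothE_local_cutoff x0 T (radius T).
have sw : smoothE w := smoothE_local_weight c t0 x0 l T (radius T).
have bw : boxed N w by exact: boxedM bl.
have rf := sobolev_regular sw bw sa; have rg := sobolev_regular sw bw sb.
have za := localized_zero T0 sa va; have zb := localized_zero T0 sb vb.
have := carleman x0 l c rf rg.
have uf := uncertainty x0 rf (lt_le_trans ltr01 l1).
have ug := uncertainty x0 rg (lt_le_trans ltr01 l1).
move: rf rg uf ug.
set f := (fun p => w p * a p); set g := (fun p => w p * b p).
set ft := (fun p => pd _ w p * a p + _); set gt := (fun p => pd _ w p * b p + _).
set fx := (fun j p => pd _ w p * a p + _); set gx := (fun j p => pd _ w p * b p + _).
set fxx := (fun j k p => _ * a p + _ + _); set gxx := (fun j k p => _ * b p + _ + _).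
move=> rf rg uf ug; set P1 := conjugated _ _ _ _ gt _ _ _ _; set P2 := conjugated _ _ _ _ ft _ _ _ _.
move=> car.
have [[sf _] [sft _] sfx sfxx _ _ _] := rf; have [[sg _] [sgt _] sgx sgxx _ _ _] := rg.
have sP1 : sqint P1 by exact: sqint_conjugated rf sg sgt.
have sP2 : sqint P2 by exact: sqint_conjugated rg sf sft.
have syf j : sqint (fun p => y j p * f p).
  exact: (smoothE_sqintcM (smoothE_ycrd x0 j) (reg_f rf)).1.
have syg j : sqint (fun p => y j p * g p).
  exact: (smoothE_sqintcM (smoothE_ycrd x0 j) (reg_f rg)).1.
have M2 : 0 <= 2 * M by rewrite mulr_ge0.
have M4 : 0 <= 4 * M by rewrite mulr_ge0.
have M16 : 0 <= 16 * M * l ^+ 2 by rewrite (mulr_ge0 _ (sqr_ge0 _))// mulr_ge0.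
have k2 : 0 <= 2 * k ^+ 2 by rewrite mulr_ge0 ?sqr_ge0.
have iP := has_integralD (has_integral_sqr ler01 sP1) (has_integral_sqr ler01 sP2).
have iQ := has_integralD (has_integralD
  (has_integralD (has_integral_sqr M2 sf) (has_integral_sqr M2 sg))
  (has_integral_sum (index_enum _) (fun j => has_integralD
    (has_integralD (has_integral_sqr M4 (sfx j).1) (has_integral_sqr M4 (sgx j).1))
    (has_integralD (has_integral_sqr M16 (syf j)) (has_integral_sqr M16 (syg j))))))
  (has_integralD (has_integral_sqr k2 (sob sa)) (has_integral_sqr k2 (sob sb))).
have {iP iQ} PQ := has_integral_le iP iQ.
suff ae_le : {ae mu, forall p : mE, 1 * P1 p ^+ 2 + 1 * P2 p ^+ 2 <=
    2 * M * f p ^+ 2 + 2 * M * g p ^+ 2 +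
    \sum_i (4 * M * fx i p ^+ 2 + 4 * M * gx i p ^+ 2 +
      (16 * M * l ^+ 2 * (y i p * f p) ^+ 2 + 16 * M * l ^+ 2 * (y i p * g p) ^+ 2)) +
    (2 * k ^+ 2 * a p ^+ 2 + 2 * k ^+ 2 * b p ^+ 2)}.
  have := PQ ae_le; rewrite !mul1r !big_split /= -!mulr_sumr => {}PQ.
  have gx0 (h : 'I_n -> mE -> R) : 0 <= gradn h by apply: sumr_ge0 => j _; exact: ip_ge0.
  have mo0 h : 0 <= momentum x0 h by apply: sumr_ge0 => j _; exact: ip_ge0.
  apply: (@absorb (gradn fx + gradn gx) (momentum x0 f + momentum x0 g) _ _ l _ erefl).
  - exact: addr_ge0.
  - exact: addr_ge0.
  - by rewrite addr_ge0// ip_ge0.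
  - have nl F : 0 <= F -> l * F <= n%:R * l * F.
      move=> F0; rewrite -mulrA ler_peMl ?ler1n//.
      by rewrite mulr_ge0// (le_trans _ l1).
    have := nl _ (ip_ge0 f); have := nl _ (ip_ge0 g); move: uf ug; lra.
  - exact: car.
  - by move: PQ; rewrite /gradn /momentum; lra.
have fmu : Filter (almost_everywhere mu) := ae_filter_ringOfSetsType mu.
apply: (@filter_app _ _ fmu _ _ _ hvan).
apply: (@filterS3 _ _ fmu _ _ _ _ _ za zb hineq) => p zap zbp hp vp.
set D := expw l p * pd (tdir R n) (local_cutoff x0 T (radius T)) p.
have -> : P1 p = w p * (-1 * bt p + \sum_j axx j j p) + -1 * (D * b p).
  by apply: (@conjugated_local_weight R n c t0 x0 (-1) l T (radius T) a ax axx b bt p) => j; case: (zap j).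
have -> : P2 p = w p * (1 * at_ p + \sum_j bxx j j p) + 1 * (D * a p).
  by apply: (@conjugated_local_weight R n c t0 x0 1 l T (radius T) b bx bxx a at_ p) => j; case: (zbp j).
have wax j : w p * ax j p = fx j p - 2 * l * (y j p * f p).
  rewrite /fx /f pd_local_weight_x -/w; have [z0 _ _] := zap j.
  have -> : forall A B : R, (expw l p * A + B) * a p = expw l p * (A * a p) + B * a p.
    by move=> *; ring.
  by rewrite z0; ring.
have wbx j : w p * bx j p = gx j p - 2 * l * (y j p * g p).
  rewrite /gx /g pd_local_weight_x -/w; have [z0 _ _] := zbp j.
  have -> : forall A B : R, (expw l p * A + B) * b p = expw l p * (A * b p) + B * b p.
    by move=> *; ring.
  by rewrite z0; ring.
have Dab : D ^+ 2 * (a p ^+ 2 + b p ^+ 2) <= k ^+ 2 * (a p ^+ 2 + b p ^+ 2).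
  have [p0|/vp[-> ->]] := leP (phi p) 0; last by rewrite expr0n addr0 !mulr0.
  rewrite ler_wpM2r ?addr_ge0 ?sqr_ge0//.
  have k0 : 0 <= k by rewrite divr_ge0// ltW.
  rewrite -real_normK ?num_real// lerXn2r ?nnegrE//.
  rewrite /D pd_local_cutoff_t !normrM (ger0_norm (expR_ge0 _)) (ger0_norm (eta_ge0 _ _ _)).
  rewrite [`|T^-1|]gtr0_norm ?invr_gt0//.
  have e1 : expw l p <= 1.
    by rewrite /weight -expR0 ler_expR mulr_ge0_le0// (le_trans _ l1).
  have eta1 := eta_le1 x0 (radius T) p.
  have Ti : 0 <= T^-1 by rewrite invr_ge0 ltW.
  rewrite -[k]mul1r; apply: ler_pM => //.
    by rewrite mulr_ge0 ?eta_ge0// mulr_ge0.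
  rewrite -[k]mul1r; apply: ler_pM => //; [exact: eta_ge0|by rewrite mulr_ge0|].
  by rewrite ler_wpM2r.
have Sw : 2 * M * (w p ^+ 2 * \sum_j (ax j p ^+ 2 + bx j p ^+ 2)) <=
    \sum_i (4 * M * fx i p ^+ 2 + 4 * M * gx i p ^+ 2 +
      (16 * M * l ^+ 2 * (y i p * f p) ^+ 2 + 16 * M * l ^+ 2 * (y i p * g p) ^+ 2)).
  rewrite !mulr_sumr; apply: ler_sum => j _.
  have -> : 2 * M * (w p ^+ 2 * (ax j p ^+ 2 + bx j p ^+ 2)) =
    2 * M * ((w p * ax j p) ^+ 2 + (w p * bx j p) ^+ 2) by ring.
  rewrite wax wbx -subr_ge0.
  move: (fx j p) (gx j p) (y j p * f p) (y j p * g p) => A B U V.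
  have -> : 4 * M * A ^+ 2 + 4 * M * B ^+ 2 +
    (16 * M * l ^+ 2 * U ^+ 2 + 16 * M * l ^+ 2 * V ^+ 2) -
    2 * M * ((A - 2 * l * U) ^+ 2 + (B - 2 * l * V) ^+ 2) =
    2 * M * ((A + 2 * l * U) ^+ 2 + (B + 2 * l * V) ^+ 2) by ring.
  by rewrite mulr_ge0// addr_ge0 ?sqr_ge0.
rewrite /f /g; move: Sw hp Dab; rewrite !mul1r mulN1r.
move: (\sum_i (4 * M * fx i p ^+ 2 + _ + _)) => S.
move: (\sum_j (_ ^+ 2 + _)) => S'.
move: (w p) (- bt p + _) (at_ p + _) (a p) (b p) => e X Y A B Sw hp Dab.
have h1 := ler_wpM2l (mulr_ge0 (ler0n R 2) (sqr_ge0 e)) hp.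
have h2 := sqr_ge0 (e * X + D * B); have h3 := sqr_ge0 (e * Y - D * A).
move: Sw Dab h1 h2 h3.
have -> : (e * X + -1 * (D * B)) ^+ 2 = 2 * e ^+ 2 * X ^+ 2 + 2 * (D ^+ 2 * B ^+ 2) - (e * X + D * B) ^+ 2 by ring.
have -> : (e * Y + D * A) ^+ 2 = 2 * e ^+ 2 * Y ^+ 2 + 2 * (D ^+ 2 * A ^+ 2) - (e * Y - D * A) ^+ 2 by ring.
lra.
Qed.

Let small (x K C T0 : R) : 0 < T0 ->
  (forall T, T0 <= T -> x <= (C / T) ^+ 2 * K) -> x <= 0.
Proof.
move=> T00 H; rewrite leNgt; apply/negP => xp.
have q0 : 0 <= `|C ^+ 2 * K| / x by rewrite divr_ge0// (ltW xp).
have T1 : 1 <= T0 + 1 + `|C ^+ 2 * K| / x by move: T00 q0; lra.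
(* The hypothesis fails for T >= 1 larger than C^2 K / x, since T <= T^2. *)
have := H (T0 + 1 + `|C ^+ 2 * K| / x).
have -> : T0 <= T0 + 1 + `|C ^+ 2 * K| / x by rewrite -addrA lerDl addr_ge0.
move=> /(_ isT); apply/negP; rewrite -ltNge.
have : `|C ^+ 2 * K| / x < T0 + 1 + `|C ^+ 2 * K| / x by rewrite ltrDr ltr_wpDr.
move: (T0 + 1 + _) T1 => T T1; rewrite ltr_pdivrMr// => KT.
have Tp : 0 < T by exact: lt_le_trans T1.
rewrite exprMn exprVn mulrAC ltr_pdivrMr ?exprn_gt0//.
apply: le_lt_trans (ler_norm _) _; apply: (lt_le_trans KT).
by rewrite [x * _]mulrC ler_wpM2r ?(ltW xp)// expr2 ler_peMl ?(ltW Tp).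
Qed.

Let chi1 (T : R) (p : E) : 0 < T -> `|crd None p| <= T -> chi T p = 1 :> R.
Proof.
move=> T0 pT; apply: cut1; rewrite addr0 add0r normrM gtr0_norm ?invr_gt0//.
by rewrite ler_pdivrMl// mulr1.
Qed.

Let wloc_mono (l T T' : R) (p : E) : 0 < T -> 3 * T <= T' -> phi p <= 0 ->
  wloc l T (radius T) p ^+ 2 <= wloc l T' (radius T') p ^+ 2.
Proof.
move=> T0 TT' p0; have T'0 : 0 < T' by move: T0 TT'; lra.
rewrite /local_weight !local_cutoff_support// 2!(exprMn _ (weight c t0 x0 l p)) ler_wpM2l ?sqr_ge0//.
have [tT|tT] := leP (3 * T) `|crd None p|.
  rewrite {1}/chi cut0 ?expr0n ?sqr_ge0//.
  rewrite add0r addr0 normrM gtr0_norm ?invr_gt0//.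
  by rewrite ler_pdivlMl// mulrC.
rewrite (chi1 T'0) ?expr1n; last by rewrite ltW// (lt_le_trans tT).
by rewrite expr_le1// ?cut_ge0// cut_le1.
Qed.

Let wloc0 (T : R) : 0 < T ->
  {ae mu, forall p : mE, wloc (1 + M) T (radius T) p * a p = 0} /\
  {ae mu, forall p : mE, wloc (1 + M) T (radius T) p * b p = 0}.
Proof.
move=> T0; have [C C0 HC] := @cut'_bounded R.
have sq (S : R) F : 0 < S -> sqint F -> sqint (fun p : mE => wloc (1 + M) S (radius S) p * F p).
  move=> S0 sF; have [N bl] := boxed_local_cutoff x0 (radius S) S0.
  exact: (smoothE_boxed_sqint (smoothE_local_weight c t0 x0 _ _ _) (boxedM _ bl) sF).1.
pose I S F := ip (fun p : mE => wloc (1 + M) S (radius S) p * F p)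
  (fun p => wloc (1 + M) S (radius S) p * F p).
have mono F (S : R) : 3 * T <= S -> sqint F -> {ae mu, forall p : mE, 0 < phi p -> F p = 0} ->
    I T F <= I S F.
  move=> TS sF vF; have S0 : 0 < S by move: T0 TS; lra.
  rewrite -[I T F]mul1r -[I S F]mul1r.
  apply: has_integral_le (has_integral_sqr ler01 (sq _ _ T0 sF))
    (has_integral_sqr ler01 (sq _ _ S0 sF)) _.
  apply: filterS vF => p Fp; rewrite !mul1r.
  have [p0|/Fp ->] := leP (phi p) 0; last by rewrite !mulr0.
  by rewrite 2!(exprMn _ _ (F p)) ler_wpM2r ?sqr_ge0// wloc_mono.
have : I T a + I T b <= 0.
  apply: (@small _ (ip a a + ip b b) C (3 * T)); first by rewrite mulr_gt0.
  move=> S TS; have S0 : 0 < S by move: T0 TS; lra.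
  apply: le_trans (carleman_localized C0 HC S0).
  by apply: lerD; [exact: mono TS (sob sa) va|exact: mono TS (sob sb) vb].
have := ip_ge0 (fun p : mE => wloc (1 + M) T (radius T) p * a p).
have := ip_ge0 (fun p : mE => wloc (1 + M) T (radius T) p * b p).
rewrite -/(I T a) -/(I T b) => Ib Ia Iab.
have Ia0 : I T a = 0 by move: Ia Ib Iab; lra.
have Ib0 : I T b = 0 by move: Ia Ib Iab; lra.
by split; [exact: ip_eq0 (sq _ _ T0 (sob sa)) Ia0|exact: ip_eq0 (sq _ _ T0 (sob sb)) Ib0].
Qed.

(** The norms of [carleman_localized] increase with the cutoff in time and are
    bounded by a multiple of T^-2; so each of them is 0, and integer cutoffs
    exhaust space-time. *)
Lemma system_unique_continuation : {ae mu, forall p : mE, a p = 0 /\ b p = 0}.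
Proof.
have z (F : mE -> R) :
    (forall T, 0 < T -> {ae mu, forall p : mE, wloc (1 + M) T (radius T) p * F p = 0}) ->
    {ae mu, forall p : mE, 0 < phi p -> F p = 0} -> {ae mu, forall p : mE, F p = 0}.
  move=> F0 vF.
  have : {ae mu, forall p : mE, forall m : nat,
      wloc (1 + M) m.+1%:R (radius m.+1%:R) p * F p = 0}.
    by apply: ae_foralln => m; apply: F0.
  apply: filterS2 vF => p vp Fp; have [p0|/vp//] := leP (phi p) 0.
  have := Fp (Num.truncn `|crd None p|).
  have tp := truncnS_gt `|crd None p|.
  rewrite /local_weight local_cutoff_support// chi1 ?mulr1//; last exact: ltW.
  by move=> /eqP; rewrite mulf_eq0 gt_eqF ?expR_gt0//= => /eqP.
have za := z a (fun T T0 => (wloc0 T0).1) va.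
have zb := z b (fun T T0 => (wloc0 T0).2) vb.
by apply: filterS2 za zb.
Qed.

End System.

(** * Lebesgue measurable functions *)

Section LebesgueMeasurable.
Import HBNNSimple.
Context d (T : measurableType d) (R : realType) (m : {measure set T -> \bar R}).
Implicit Types f g : T -> \bar R.

Let ae_integral_le f g : (forall x, 0 <= f x)%E -> (forall x, 0 <= g x)%E ->
  {ae m, forall x, f x = g x} -> (\int[m]_x f x <= \int[m]_x g x)%E.
Proof.
move=> f0 g0 [N [mN N0 fgN]]; rewrite [leLHS]ge0_integralTE//.
apply: ge_ereal_sup => _ [h /= hf <-].
pose h' := proj_nnsfun h (measurableC mN).
have h'g x : ((h' x)%:E <= g x)%E.
  rewrite /h' /= mindicE; case: (boolP (x \in ~` N)) => [|_].
    rewrite inE /= => Nx; rewrite mulr1 (le_trans (hf x))//.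
    have -> // : f x = g x by apply: contrapT => fgx; apply: Nx; exact: fgN.
  by rewrite mulr0.
have -> : sintegral m h = sintegral m h'.
  rewrite -!integralT_nnsfun; apply: ge0_ae_eq_integral => //.
  - exact/measurable_EFinP.
  - exact/measurable_EFinP.
  - by move=> x _; rewrite lee_fin.
  - by move=> x _; rewrite lee_fin.
  exists N; split => // x /=; apply: contra_notP => Nx _; congr EFin.
  by rewrite /h' /= mindicE mem_set ?mulr1.
by rewrite [leRHS]ge0_integralTE//; apply: ereal_sup_ubound => /=; exists h'.
Qed.

(** The simple functions below one integrand can be cut off on the exceptional
    set. This covers integrands that agree only almost everywhere with a Borel
    function. *)
Lemma ae_integral_eq f g : {ae m, forall x, f x = g x} ->
  (\int[m]_x f x = \int[m]_x g x)%E.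
Proof.
move=> fg; have gf : {ae m, forall x, g x = f x} by apply: filterS fg.
have H (F G : T -> \bar R) : (forall x, 0 <= F x)%E -> (forall x, 0 <= G x)%E ->
    {ae m, forall x, F x = G x} -> (\int[m]_x F x = \int[m]_x G x)%E.
  move=> F0 G0 FG; apply/eqP; rewrite eq_le !ae_integral_le//.
  by apply: filterS FG.
rewrite integralE [RHS]integralE; congr (_ - _)%E; apply: H => //.
- by apply: filterS fg => x e; rewrite !funeposE e.
- by apply: filterS fg => x e; rewrite !funenegE e.
Qed.

End LebesgueMeasurable.

(** * Reduction to real systems *)

Section Reduction.
Context {R : realType} {n : nat}.
Local Notation E := ('rV[R]_n * R)%type.
Local Notation mE := ('rV[R]_n * measurableTypeR R)%type.
Local Notation mu := (lebesgue_spacetime R n).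
Implicit Types (u : E -> R[i]) (a b : mE -> R) (k : E -> R) (v : E).

Let aeS (P Q : mE -> Prop) : {ae mu, forall p, P p} -> (forall p, P p -> Q p) ->
  {ae mu, forall p, Q p}.
Proof. by move=> aeP PQ; exact: (@filterS _ _ (ae_filter_ringOfSetsType mu) _ _ PQ aeP). Qed.

Definition represents u a b :=
  [/\ sqint a, sqint b & {ae mu, forall p : mE, u p = Complex (a p) (b p)}].

Lemma normc_sqr (x y : R) : normc (Complex x y) ^+ 2 = x ^+ 2 + y ^+ 2.
Proof. by rewrite /= sqr_sqrtr// addr_ge0 ?sqr_ge0. Qed.

Lemma normc_ge0 (z : R[i]) : 0 <= normc z.
Proof. by case: z => x y; exact: sqrtr_ge0. Qed.

(** The Borel representative has the same norm, by [ae_integral_eq]. *)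
Lemma inL2_represents u : inL2 u -> exists a b, represents u a b.
Proof.
move=> [[g [mre mim ug]] fu].
have {}ug : {ae mu, forall p : mE, u p = Complex (complex.Re (g p)) (complex.Im (g p))}.
  by apply: aeS ug _ => p ->; case: (g p).
exists (fun p => complex.Re (g p)), (fun p => complex.Im (g p)).
have {fu} iu : (\int[mu]_p ((complex.Re (g p)) ^+ 2 + (complex.Im (g p)) ^+ 2)%:E < +oo)%E.
  have := poweR_lty 2 fu; rewrite poweR_Lnorm ?pnatr_eq0//.
  rewrite (@ae_integral_eq _ _ _ _ _
    (fun p : mE => ((complex.Re (g p)) ^+ 2 + (complex.Im (g p)) ^+ 2)%:E))//.
  apply: aeS ug _ => p; rewrite /comp => ->.
  by rewrite -normc_sqr /= ger0_norm ?sqrtr_ge0// powR_mulrn ?sqrtr_ge0.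
have mX (F : mE -> R) : measurable_fun [set: mE] F ->
    measurable_fun [set: mE] (fun p => (F p ^+ 2)%:E).
  by move=> mF; apply/measurable_EFinP; exact: measurable_funX.
have mD : measurable_fun [set: mE]
    (fun p => ((complex.Re (g p)) ^+ 2 + (complex.Im (g p)) ^+ 2)%:E).
  by apply/measurable_EFinP; apply: measurable_funD; exact: measurable_funX.
split => //; split => //; apply: le_lt_trans iu; apply: ge0_le_integral => //;
  try exact: mX; try (by move=> p _; rewrite lee_fin ?addr_ge0 ?sqr_ge0).
- by move=> p _; rewrite lee_fin lerDl sqr_ge0.
- by move=> p _; rewrite lee_fin lerDr sqr_ge0.
Qed.

Lemma cintegral_test u a b (psi : E -> R) : represents u a b ->
  cintegral (fun p => u p * (psi p)%:C%C) = Complex (ip a psi) (ip b psi).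
Proof.
move=> [_ _ uab]; rewrite /cintegral /ip /Rintegral; congr Complex; congr fine;
  by apply: ae_integral_eq; apply: aeS uab _ => p -> /=; congr EFin; ring.
Qed.

Lemma wder_weak v u u' a b a' b' : represents u a b -> represents u' a' b' ->
  is_weak_derivative [:: v] u u' -> wder v a a' /\ wder v b b'.
Proof.
move=> ru ru' H.
have {}H k : smoothE k -> (exists N, boxed N k) ->
    ip a (pd v k) = - ip a' k /\ ip b (pd v k) = - ip b' k.
  move=> sk [N bk]; have := H _ (smoothE_test sk bk).
  rewrite (cintegral_test _ ru) (cintegral_test _ ru') expr1 mulN1r.
  have -> : iter_derive k [:: v] = pd v k by apply/funext => p; rewrite pdE.
  by case.
by split => k sk bk; case: (H k sk bk).
Qed.

(** Test the first derivative against the derivative of a test function. *)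
Lemma wder_weak2 v w u u' u'' a' b' a'' b'' a b :
  represents u a b -> represents u' a' b' -> represents u'' a'' b'' ->
  is_weak_derivative [:: v] u u' -> is_weak_derivative [:: v; w] u u'' ->
  wder w a' a'' /\ wder w b' b''.
Proof.
move=> ru ru' ru'' H1 H2.
have {H1 H2} H k : smoothE k -> (exists N, boxed N k) ->
    ip a' (pd w k) = - ip a'' k /\ ip b' (pd w k) = - ip b'' k.
  move=> sk [N bk]; have := H2 _ (smoothE_test sk bk).
  have := H1 _ (smoothE_test (smoothE_pd w sk) (boxed_pd w bk)).
  have -> : iter_derive k [:: v; w] = iter_derive (pd w k) [:: v].
    by rewrite /iter_derive /=; congr (fun h p => 'D_v h p); apply/funext => p; rewrite pdE.
  move=> ->; rewrite (cintegral_test _ ru') (cintegral_test _ ru'') expr1 mulN1r sqrrN expr1n mul1r.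
  by case=> <- <-; rewrite !opprK.
by split => k sk bk; case: (H k sk bk).
Qed.

Lemma weak_derivativeP vs u : has_weak_derivative_in_L2 vs u ->
  inL2 (weak_derivative vs u) /\ is_weak_derivative vs u (weak_derivative vs u).
Proof. by move=> H; exact: (xgetPex (cst 0) H). Qed.

Lemma inLoo_bound (F : E -> R) : finite_norm mu +oo%E F ->
  exists2 C : R, 0 <= C & {ae mu, forall p : mE, `|F p| <= C}.
Proof.
rewrite /finite_norm unlock; case: ifPn => [mu0 fin|mu0 _]; last first.
  exists 0 => //; exists setT; split => //.
  by apply/eqP; rewrite eq_le measure_ge0 andbT leNgt.
set x := ess_sup _ _ in fin; exists `|fine x|; first exact: normr_ge0.
have /ess_supP H : (x <= `|fine x|%:E)%E.
  by case: x fin => [r _| |_] //=; rewrite ?leNye// lee_fin ler_norm.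
by apply: aeS H _ => p; rewrite /= lee_fin.
Qed.

Lemma normc_sum_le (w z : 'I_n -> R[i]) (B : R) : (forall j, normc (w j) <= B) ->
  normc (\sum_j w j * z j) ^+ 2 <= (n%:R * B) ^+ 2 * \sum_j normc (z j) ^+ 2.
Proof.
move=> wB; case: n w z wB => [|m] w z wB.
  by rewrite !big_ord0 normc0 expr0n mulr0.
have B0 : 0 <= B by exact: le_trans (normc_ge0 _) (wB ord0).
set S := \sum_j normc (z j) ^+ 2.
have S0 : 0 <= S by apply: sumr_ge0 => j _; exact: sqr_ge0.
have zS j : normc (z j) <= Num.sqrt S.
  rewrite -(ler_pXn2r (ltn0Sn 1)) ?nnegrE ?normc_ge0 ?sqrtr_ge0// sqr_sqrtr//.
  by rewrite /S (bigD1 j)//= lerDl; apply: sumr_ge0 => i _; exact: sqr_ge0.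
rewrite -[S](sqr_sqrtr S0) -exprMn lerXn2r ?nnegrE ?normc_ge0//.
  by rewrite !mulr_ge0 ?sqrtr_ge0.
have tri (s : seq 'I_m.+1) : normc (\sum_(j <- s) w j * z j) <=
    \sum_(j <- s) (B * Num.sqrt S).
  elim: s => [|j s IH]; first by rewrite !big_nil normc0.
  rewrite !big_cons; apply: le_trans (le_normcD _ _) (lerD _ IH).
  by rewrite normcM ler_pM ?normc_ge0.
apply: le_trans (tri _) _.
by rewrite sumr_const card_ord -mulrA mulr_natl.
Qed.

Let filt : Filter (almost_everywhere mu) := ae_filter_ringOfSetsType mu.

Lemma sum_Complex (I : Type) (s : seq I) (x y : I -> R) :
  \sum_(j <- s) Complex (x j) (y j) = Complex (\sum_(j <- s) x j) (\sum_(j <- s) y j).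
Proof. by elim: s => [|j s IH]; rewrite ?big_nil// !big_cons IH. Qed.

Lemma normc_le_euclidean (w : 'rV[R[i]]_n) j : normc (w ord0 j) <= euclidean_norm w.
Proof.
rewrite -(ler_pXn2r (ltn0Sn 1)) ?nnegrE ?normc_ge0 ?sqrtr_ge0//.
rewrite sqr_sqrtr; last by apply: sumr_ge0 => i _; exact: sqr_ge0.
by rewrite (bigD1 j)//= lerDl; apply: sumr_ge0 => i _; exact: sqr_ge0.
Qed.

(** Squaring the triangle inequality costs a factor 2 on each term; each component
    of the gradient is bounded by the norm of the whole, which costs n. *)
Lemma schroedinger_sqr (at_ bt a b A B : R) (axx bxx ax bx : 'I_n -> R) (v : R[i])
    (w : 'rV[R[i]]_n) :
  normc v <= A -> euclidean_norm w <= B ->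
  normc ('i%C * Complex at_ bt + \sum_j Complex (axx j) (bxx j)) <=
    normc (v * Complex a b) + normc (\sum_j w ord0 j * Complex (ax j) (bx j)) ->
  (- bt + \sum_j axx j) ^+ 2 + (at_ + \sum_j bxx j) ^+ 2 <=
  (2 * A ^+ 2 + 2 * (n%:R * B) ^+ 2) * (a ^+ 2 + b ^+ 2 + \sum_j (ax j ^+ 2 + bx j ^+ 2)).
Proof.
move=> vA wB.
have -> : 'i%C * Complex at_ bt + \sum_j Complex (axx j) (bxx j) =
    Complex (- bt + \sum_j axx j) (at_ + \sum_j bxx j).
  by rewrite sum_Complex; congr Complex; ring.
move: (- bt + _) (at_ + _) => X Y; rewrite -normc_sqr => H.
have ws := normc_sum_le (fun j => Complex (ax j) (bx j)) (fun j => le_trans (normc_le_euclidean w j) wB).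
move: (\sum_j w ord0 j * _) H ws => W H ws.
under eq_bigr do rewrite -normc_sqr.
move: ws; set S := \sum_j _ => ws.
rewrite -normc_sqr; set U := normc (Complex a b).
have S0 : 0 <= S by apply: sumr_ge0 => j _; exact: sqr_ge0.
have A0 : 0 <= A by exact: le_trans (normc_ge0 _) vA.
have vU : normc (v * Complex a b) ^+ 2 <= A ^+ 2 * U ^+ 2.
  by rewrite normcM exprMn ler_wpM2r ?sqr_ge0// lerXn2r ?nnegrE ?normc_ge0.
move: H vU ws; move: (normc_ge0 (v * Complex a b)) (normc_ge0 W) (normc_ge0 (Complex X Y)).
move: (normc (v * Complex a b)) (normc W) (normc (Complex X Y)) => P Q N P0 Q0 N0 H vU ws.
have N2 : N ^+ 2 <= 2 * P ^+ 2 + 2 * Q ^+ 2.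
  apply: (@le_trans _ _ ((P + Q) ^+ 2)); first by rewrite lerXn2r ?nnegrE ?addr_ge0.
  by rewrite -subr_ge0 (_ : _ - _ = (P - Q) ^+ 2) ?sqr_ge0//; ring.
have h1 : 0 <= A ^+ 2 * S by rewrite mulr_ge0 ?sqr_ge0.
have h2 : 0 <= (n%:R * B) ^+ 2 * U ^+ 2 by rewrite mulr_ge0 ?sqr_ge0.
have -> : (2 * A ^+ 2 + 2 * (n%:R * B) ^+ 2) * (U ^+ 2 + S) =
  2 * (A ^+ 2 * U ^+ 2) + 2 * (A ^+ 2 * S) +
  2 * ((n%:R * B) ^+ 2 * U ^+ 2) + 2 * ((n%:R * B) ^+ 2 * S) by ring.
move: N2 vU ws h1 h2; lra.
Qed.

Lemma H1t_H2x_sobolev (u : E -> R[i]) : H1t u -> H2x u ->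
  exists a at_ ax axx, exists b bt bx bxx,
  [/\ sobolev a at_ ax axx, sobolev b bt bx bxx &
    {ae mu, forall p : mE,
      [/\ u p = Complex (a p) (b p), time_derivative u p = Complex (at_ p) (bt p),
          forall j, gradient u p ord0 j = Complex (ax j p) (bx j p) &
          laplacian u p = \sum_j Complex (axx j j p) (bxx j j p)]}].
Proof.
move=> [u2 ut] [_ ux].
have [iut dut] := weak_derivativeP ut.
have Px j := weak_derivativeP (ux [:: j] isT).
have Pxx j i := weak_derivativeP (ux [:: j; i] isT).
have [a [b ru]] := inL2_represents u2.
have [at_ [bt rt]] := inL2_represents iut.
have /choice[ab rx] : forall j, exists ab : (mE -> R) * (mE -> R),
    represents (weak_derivative (map (@xdir R n) [:: j]) u) ab.1 ab.2.
  by move=> j; have [x [y ?]] := inL2_represents (Px j).1; exists (x, y).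
have /choice[abb rxx] : forall jk : 'I_n * 'I_n, exists ab : (mE -> R) * (mE -> R),
    represents (weak_derivative (map (@xdir R n) [:: jk.1; jk.2]) u) ab.1 ab.2.
  by move=> [j k]; have [x [y ?]] := inL2_represents (Pxx j k).1; exists (x, y).
exists a, at_, (fun j => (ab j).1), (fun j i => (abb (j, i)).1).
exists b, bt, (fun j => (ab j).2), (fun j i => (abb (j, i)).2).
have [sa sb eu] := ru; have [sat sbt et] := rt.
have [dta dtb] := wder_weak ru rt dut.
have dx j := wder_weak ru (rx j) (Px j).2.
have dxx j i := wder_weak2 ru (rx j) (rxx (j, i)) (Px j).2 (Pxx j i).2.
split.
- split=> // [j|j k|j|j k].
  + by case: (rx j).
  + by case: (rxx (j, k)).
  + exact: (dx j).1.
  + exact: (dxx j k).1.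
- split=> // [j|j k|j|j k].
  + by case: (rx j).
  + by case: (rxx (j, k)).
  + exact: (dx j).2.
  + exact: (dxx j k).2.
have ex : {ae mu, forall p : mE, forall j, gradient u p ord0 j = Complex ((ab j).1 p) ((ab j).2 p)}.
  apply: (@filter_forall _ _ _ _ filt) => j; have [_ _ e] := rx j.
  by apply: (@filterS _ _ filt _ _ _ e) => p; rewrite /gradient mxE.
have exx : {ae mu, forall p : mE, forall j,
    weak_derivative [:: xdir R j; xdir R j] u p = Complex ((abb (j, j)).1 p) ((abb (j, j)).2 p)}.
  apply: (@filter_forall _ _ _ _ filt) => j; by have [_ _ e] := rxx (j, j).
apply: (@filter_app _ _ filt _ _ _ eu); apply: (@filterS3 _ _ filt _ _ _ _ _ et ex exx).
by move=> p etp exp exxp eup; split => //; rewrite /laplacian; apply: eq_bigr => j _.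
Qed.

End Reduction.

Theorem theorem1p1 (R : realType) (n : nat) (hn : (1 <= n)%N)
  (V : 'rV[R]_n * R -> R[i]) (W : 'rV[R]_n * R -> 'rV[R[i]]_n)
  (hV : inLoo V) (hW : inLoo_vector W)
  (c : R) (hc : c != 0) (x0 : 'rV[R]_n) (t0 : R)
  (u : 'rV[R]_n * R -> R[i]) (hut : H1t u) (hux : H2x u)
  (hineq : {ae lebesgue_spacetime R n, forall p,
     normc ('i%C * time_derivative u p + laplacian u p) <=
     normc (V p * u p) +
     normc (\sum_(j < n) W p ord0 j * gradient u p ord0 j)})
  (hvan : {ae lebesgue_spacetime R n, forall p,
     0 < c * (p.2 - t0) + sqnorm (p.1 - x0) -> u p = 0}) :
  {ae lebesgue_spacetime R n, forall p, u p = 0}.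
Proof.
have filt : Filter (almost_everywhere (lebesgue_spacetime R n)).
  exact: ae_filter_ringOfSetsType.
have [a [at_ [ax [axx [b [bt [bx [bxx [sa sb rep]]]]]]]]] := H1t_H2x_sobolev hut hux.
have [A A0 VA] := inLoo_bound hV.2; have [B B0 WB] := inLoo_bound hW.2.
have M0 : 0 <= 2 * A ^+ 2 + 2 * (n%:R * B) ^+ 2.
  by rewrite addr_ge0// mulr_ge0 ?sqr_ge0.
have ineq : {ae lebesgue_spacetime R n, forall p,
    (- bt p + \sum_j axx j j p) ^+ 2 + (at_ p + \sum_j bxx j j p) ^+ 2 <=
    (2 * A ^+ 2 + 2 * (n%:R * B) ^+ 2) *
      (a p ^+ 2 + b p ^+ 2 + \sum_j (ax j p ^+ 2 + bx j p ^+ 2))}.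
  apply: (@filter_app _ _ filt _ _ _ hineq).
  apply: (@filterS3 _ _ filt _ _ _ _ _ rep VA WB) => p [-> -> eg ->] VAp WBp.
  under [in X in _ + normc X]eq_bigr do rewrite eg.
  apply: schroedinger_sqr.
    by apply: le_trans VAp; exact: ler_norm.
  by apply: le_trans WBp; exact: ler_norm.
have van : {ae lebesgue_spacetime R n, forall p,
    0 < parabola c t0 x0 p -> a p = 0 /\ b p = 0}.
  apply: (@filterS2 _ _ filt _ _ _ _ rep hvan) => p [up _ _ _] vp; rewrite parabolaE => /vp.
  by rewrite up => -[-> ->].
have z := system_unique_continuation sa sb M0 ineq van hn.
by apply: (@filterS2 _ _ filt _ _ _ _ rep z) => p [-> _ _ _] [-> ->].
Qed.
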